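(* Let $s>2$. There is a constant $C=C(s)$ such that for every divergence-free $b=(b^1,b^2,b^3)\in C^\infty(\mathbb T^3,\mathbb R^3)$ and every $\varphi\in C^\infty(\mathbb T^3,\mathbb R^2)$ with $\mathcal P\varphi=\varphi$, $$\|[\mathcal P,b\cdot\nabla]\varphi\|_s\le C\big(\|b\|_{s+1}\|\varphi\|_s+\|\partial_z(b^1,b^2)\|_{s-1}\|\varphi\|_{s+1}\big).$$ If in addition $s>\frac52$, then (with a constant $C=C(s)$) $$\big\|\Lambda^{-\frac12}[\Lambda^s,b\cdot\nabla][\mathcal P,b\cdot\nabla]\varphi\big\|\le C\big(\|b\|_{s+3}^2\|\varphi\|_{s-\frac12}+\|b\|_{s+3}\|\partial_z(b^1,b^2)\|_{s-\frac32}\|\varphi\|_{s+\frac12}\big).$$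
   Context: $\mathbb T^3=\mathbb R^3/\mathbb Z^3$ with points $(x_1,x_2,z)$, $x'=(x_1,x_2)$; $\nabla=(\partial_{x_1},\partial_{x_2},\partial_z)$, $\nabla_h=(\partial_{x_1},\partial_{x_2})$, $\Delta_h=\partial_{x_1}^2+\partial_{x_2}^2$. $\|\cdot\|$ is the $L^2(\mathbb T^3)$ norm. With $\widehat f_k=\int_{\mathbb T^3}e^{-ik\cdot x}f(x)\,dx$, $k\in2\pi\mathbb Z^3$, $\|f\|_r=\|f\|_{H^r}=\big(\sum_k(1+|k|^{2r})|\widehat f_k|^2\big)^{1/2}$. $\Lambda^r=(-\Delta)^{r/2}$ is the Fourier multiplier $|k|^r$; for negative $r$ it acts on functions of zero mean. The hydrostatic Leray projection is $\mathcal P\varphi=\varphi-\nabla_h\Delta_h^{-1}\nabla_h\cdot\overline\varphi$, where $\overline\varphi(x')=\int_0^1\varphi(x',z)\,dz$ and $\Delta_h^{-1}$ acts on zero-mean functions of $x'$. $[A,B]=AB-BA$, and $b\cdot\nabla$ acts componentwise on vector fields. *)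

(* Defs.v *)
From HB Require Import structures.
From mathcomp Require Import all_boot all_order all_algebra.
From mathcomp Require Import all_classical all_reals all_analysis.
From mathcomp Require Import complex.

Set Implicit Arguments.
Unset Strict Implicit.
Unset Printing Implicit Defensive.

Import Order.TTheory GRing.Theory Num.Theory.
Import numFieldNormedType.Exports.

Local Open Scope classical_set_scope.
Local Open Scope ring_scope.

(* A function on the torus R^3/Z^3 is a function on R^3 that is 1-periodic in
   each variable (see [torus_smooth]); integrals over the torus are integrals
   over the unit cube.  The point ((x1, x2), z) is (x', z). *)
Notation space R := (R * R * R)%type.
Notation scalar R := (space R -> R).
Notation field n R := ('I_n -> scalar R).

Definition basis_vec (R : realType) (i : 'I_3) : space R :=
  ((i == 0%N :> nat)%:R, (i == 1%N :> nat)%:R, (i == 2%N :> nat)%:R).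

Definition partial (R : realType) (i : 'I_3) (f : scalar R) : scalar R :=
  fun x => 'D_(basis_vec R i) f x.

Definition iter_partial (R : realType) (l : seq 'I_3) (f : scalar R) :
  scalar R := foldr (@partial R) f l.

Definition torus_smooth (R : realType) (f : scalar R) : Prop :=
  (forall i, periodic f (basis_vec R i)) /\
  (forall l : seq 'I_3,
     continuous (iter_partial l f) /\
     forall i x, derivable (iter_partial l f) x (basis_vec R i)).

Definition smooth_field (R : realType) (n : nat) (u : field n R) : Prop :=
  forall i, torus_smooth (u i).

(* The horizontal index i = 0, 1 as an index of R^3, and the vertical one. *)
Definition hor (i : 'I_2) : 'I_3 := widen_ord (isT : 2 <= 3)%N i.
Definition vert : 'I_3 := ord_max.

Definition divergence_free (R : realType) (b : field 3 R) : Prop :=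
  forall x, \sum_(i < 3) partial i (b i) x = 0.

Definition advect (R : realType) (n : nat) (b : field 3 R) (u : field n R) :
  field n R := fun j x => \sum_(i < 3) b i x * partial i (u j) x.

Definition dz_hor (R : realType) (b : field 3 R) : field 2 R :=
  fun i => partial vert (b (hor i)).

Definition commutator (R : realType) (n : nat) (A B : field n R -> field n R)
  (u : field n R) : field n R := fun i x => A (B u) i x - B (A u) i x.

Definition unit_cube (R : realType) : set (space R) :=
  (`[0, 1] `*` `[0, 1]) `*` `[0, 1].

Definition leb3 (R : realType) :
  {measure set (measurableTypeR R * measurableTypeR R * measurableTypeR R)
     -> \bar R} :=
  ((@lebesgue_measure R \x @lebesgue_measure R) \x @lebesgue_measure R)%E.

(* The index n in Z^3 stands for the frequency k = 2 pi n. *)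
Notation freq := (int * int * int)%type.

Definition wave (R : realType) (n : freq) : space R :=
  (2 * pi * n.1.1%:~R, 2 * pi * n.1.2%:~R, 2 * pi * n.2%:~R).

Definition dot3 (R : realType) (k x : space R) : R :=
  k.1.1 * x.1.1 + k.1.2 * x.1.2 + k.2 * x.2.

Definition wave_norm (R : realType) (n : freq) : R :=
  Num.sqrt (dot3 (wave R n) (wave R n)).

Definition expi (R : realType) (t : R) : R[i] := Complex (cos t) (sin t).

Definition cube_integral (R : realType) (f : space R -> R[i]) : R[i] :=
  Complex (\int[@leb3 R]_(x in @unit_cube R) complex.Re (f x))
          (\int[@leb3 R]_(x in @unit_cube R) complex.Im (f x)).

Definition fourier (R : realType) (f : scalar R) (n : freq) : R[i] :=
  cube_integral (fun x => expi (- dot3 (wave R n) x) * real_complex R (f x)).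

Definition freq_box (N : nat) : set freq :=
  [set n | (`|n.1.1| <= N)%N /\ (`|n.1.2| <= N)%N /\ (`|n.2| <= N)%N].

(* The Fourier multiplier with symbol m, as the pointwise sum of the series
   with coefficients m(k) f^_k.  For smooth f and m of polynomial growth the
   series converges absolutely, so the order of summation is immaterial; for
   f real and m real and even, the sum is real, hence equal to its real part. *)
Definition multiplier (R : realType) (m : freq -> R) (f : scalar R) :
  scalar R := fun x =>
  limn (fun N : nat =>
    complex.Re (\sum_(n \in freq_box N)
          (real_complex R (m n) * fourier f n * expi (dot3 (wave R n) x)))).

(* As 0 `^ r = 0 for r != 0, the mean of f is discarded also for r < 0, where
   Lambda^r is only meant to be applied to functions of zero mean. *)
Definition Lambda (R : realType) (n : nat) (r : R) (u : field n R) :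
  field n R := fun i => multiplier (fun k => wave_norm R k `^ r) (u i).

(* A function of x' is seen as a function on R^3 that does not depend on z;
   its Fourier coefficients vanish unless the vertical frequency is 0.  The
   symbol is - 1 / |k'|^2, which is 0 at k' = 0 since 0^-1 = 0. *)
Definition inv_hor_laplacian (R : realType) (f : scalar R) : scalar R :=
  multiplier (fun n => - ((wave R n).1.1 ^+ 2 + (wave R n).1.2 ^+ 2)^-1) f.

Definition vert_avg (R : realType) (f : scalar R) : scalar R :=
  fun x => \int[@lebesgue_measure R]_(z in `[0, 1]) f (x.1, z).

Definition hydro_leray (R : realType) (u : field 2 R) : field 2 R :=
  fun i x => u i x - partial (hor i) (inv_hor_laplacian
    (fun y => \sum_(j < 2) partial (hor j) (vert_avg (u j)) y)) x.

(* Norms take values in [0, +oo]. *)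
Definition L2norm (R : realType) (n : nat) (u : field n R) : \bar R :=
  ((\int[@leb3 R]_(x in @unit_cube R) (\sum_(i < n) u i x ^+ 2)%:E) `^ 2^-1)%E.

Definition Hnorm (R : realType) (n : nat) (r : R) (u : field n R) : \bar R :=
  ((\esum_(k in [set: freq])
     ((1 + wave_norm R k `^ (2 * r)) *
      \sum_(i < n) ComplexField.Normc.normc (fourier (u i) k) ^+ 2)%:E)
   `^ 2^-1)%E.

(* Main.v *)
(** Everything is estimated on Fourier coefficients.  If P phi = phi, then
    [P, b.grad] phi = - grad_h lap_h^-1 div_h avg(b.grad phi), so only the
    frequencies k with k_3 = 0 contribute, through the coefficients
    (k / |k|^2) sum_l (k.phi^_l) (k.b^_(k-l)), where div b = 0 was used to
    replace l.b^_(k-l) by k.b^_(k-l).  If l_3 = 0, then k.phi^_l =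
    (k - l).phi^_l because P phi = phi, and the derivative falls on b; if
    l_3 <> 0, then (k - l)_3 <> 0 and b^_(k-l) is controlled by dz b_h.
    Young's inequality on Z^3, with l^1 norms bounded by Cauchy-Schwarz,
    gives the first estimate.  For the second one, the symbol satisfies
    |k|^(-1/2) ||k|^s - |l|^s| |l| <= C (1 + |k-l|)^(s+1/2) (1 + |l|)^(s-1/2),
    so the norm is at most C |b|_(s+3) |G|_(s-1/2) for G = [P, b.grad] phi,
    and the first estimate applies to G with s - 1/2 in place of s.

    The multipliers are pointwise sums of Fourier series, so a smooth function
    has to be the sum of its own series.  A continuous f with zero coefficients
    is orthogonal to the trigonometric polynomials
    (prod_i (1 + cos(2 pi (x_i - a_i))) / 2)^N, which concentrate at a as N
    grows; hence f(a) = 0. *)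
Require Import Defs.
From HB Require Import structures.
From mathcomp Require Import all_boot all_order all_algebra.
From mathcomp Require Import all_classical all_reals all_analysis.
From mathcomp Require Import complex ring lra.

Set Implicit Arguments.
Unset Strict Implicit.
Unset Printing Implicit Defensive.

Import Order.TTheory GRing.Theory Num.Theory.
Import numFieldNormedType.Exports.

Local Open Scope classical_set_scope.
Local Open Scope ring_scope.

(** The threshold s > 2 comes from the part of b that oscillates in z. Its coefficients have to be
    summable, and dz supplies only powers of the vertical frequency: Cauchy-Schwarz leads to the sum
    of (1 + |m|)^(-2(s-1)) |m_3|^(-2) over m_3 <> 0, whose horizontal part converges exactly when
    2(s - 1) > 2. The condition s > 5/2 is the same one at level s - 1/2. When the weight |k|^(s+1)
    is split between k - l and l, the share of k - l would ask for more regularity of dz b than the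
    estimate grants. It is charged to the full b, in the first product; only the share of l keeps
    the oscillating part. Estimates are proved for squares of norms, as sums with values in
    [0, +oo], so that each inequality makes sense whether or not the sums are finite; square roots
    are taken at the end. The L^2 norm enters through its bound by the coefficients, read off the
    convolution formula for f f at frequency 0. *)

Local Notation point R := (R * R * R)%type.

(* [R] itself has no canonical measurable structure, its alias does. *)
Local Notation measurable_space R :=
  (measurableTypeR R * measurableTypeR R * measurableTypeR R)%type.

(** * Integrals over the torus *)

Section Cube.
Variable R : realType.
Local Notation mu := (@lebesgue_measure R).

(* The product sigma-algebra on R^3 is not known to contain the open sets, so
   continuous functions are shown measurable as limits of [f] on a grid. *)
Definition grid (m : nat) (t : R) : R := (Num.floor (m.+1%:R * t))%:~R / m.+1%:R.

Lemma cvg_grid (t : R) : grid ^~ t @ \oo --> t.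
Proof.
apply/cvgrPdist_le => e e0.
have := near_infty_natSinv_lt (PosNum e0) => /=; apply: filterS => m me.
have m0 : 0 < m.+1%:R :> R by rewrite ltr0n.
have /andP[h1 h2] := floor_itv (m.+1%:R * t).
apply: le_trans (ltW me); rewrite /grid -(@ler_pM2l _ m.+1%:R)//.
rewrite divff ?gt_eqF// -[leLHS]ger0_norm ?mulr_ge0// normrM normr_id -normrM.
rewrite mulrBr mulrC [X in _ - X]mulrC divfK ?gt_eqF// mulrC.
move: h2; rewrite intrD ger0_norm; lra.
Qed.

Lemma continuous_measurable3 (f : point R -> R) : continuous f ->
  measurable_fun setT (f : measurable_space R -> R).
Proof.
move=> cf.
pose h m (x : point R) := f (grid m x.1.1, grid m x.1.2, grid m x.2).
apply: (@measurable_realfun.measurable_fun_cvg _ _ _ _ h) => [m|x _].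
  pose cell (n : freq) : set (measurable_space R) := [set x | Num.floor (m.+1%:R * x.1.1) = n.1.1 /\
    Num.floor (m.+1%:R * x.1.2) = n.1.2 /\ Num.floor (m.+1%:R * x.2) = n.2].
  have mstrip (k : int) : measurable ([set t : measurableTypeR R | Num.floor (m.+1%:R * t) = k]).
    rewrite (_ : [set _ | _] = `[k%:~R / m.+1%:R, (k + 1)%:~R / m.+1%:R[%classic)//.
    apply/seteqP; split => t /=; rewrite in_itv/= ler_pdivrMr// ltr_pdivlMr// mulrC.
      by move/eqP; rewrite floor_eq.
    by move=> /floor_def.
  have mcell n : measurable (cell n).
    rewrite (_ : cell n = (([set t : measurableTypeR R | Num.floor (m.+1%:R * t) = n.1.1] `*`
      [set t : measurableTypeR R | Num.floor (m.+1%:R * t) = n.1.2]) `*`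
      [set t : measurableTypeR R | Num.floor (m.+1%:R * t) = n.2])).
      by apply: measurableX => //; exact: measurableX.
    by apply/seteqP; split => x /=; rewrite /cell/=; tauto.
  move=> _ Y mY; rewrite setTI.
  (* [h m] is constant on each cell, so its preimage of [Y] is the union of the cells at whose
     corner f lies in [Y]. *)
  rewrite (_ : _ @^-1` _ = \bigcup_n
      (if (n.1.1%:~R / m.+1%:R, n.1.2%:~R / m.+1%:R, n.2%:~R / m.+1%:R) \in f @^-1` Y
       then cell n else set0)).
    apply: countable_bigcupT_measurable => [|n]; first exact: countableP.
    case: ifP => _; [exact: mcell|exact: measurable0].
  apply/seteqP; split => x /=.
    move=> Yx; exists (Num.floor (m.+1%:R * x.1.1), Num.floor (m.+1%:R * x.1.2),
      Num.floor (m.+1%:R * x.2)) => //=.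
    by rewrite mem_set.
  move=> [n _]; case: ifPn => // /set_mem/= Yn [n1 [n2 n3]].
  by rewrite /h /grid n1 n2 n3.
have g12 : (fun m => (grid m x.1.1, grid m x.1.2)) @ \oo --> (x.1.1, x.1.2).
  exact: (cvg_pair (@cvg_grid x.1.1) (@cvg_grid x.1.2)).
have g123 : (fun m => (grid m x.1.1, grid m x.1.2, grid m x.2)) @ \oo --> x.
  rewrite [X in _ --> X]surjective_pairing [X in _ --> (X, _)]surjective_pairing.
  exact: (cvg_pair g12 (@cvg_grid x.2)).
exact: (continuous_cvg _ (cf x) g123).
Qed.

Lemma compact_unit_cube : compact (@unit_cube R).
Proof.
by apply: compact_setX; [apply: compact_setX|]; exact: segment_compact.
Qed.

Lemma measurable01 : measurable (`[0, 1]%classic : set (measurableTypeR R)).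
Proof. exact: measurable_itv. Qed.

Lemma lebesgue_unit_interval : mu (`[0, 1]%classic : set (measurableTypeR R)) = 1%E.
Proof. by rewrite lebesgue_measure_itv/= lte_fin ltr01 oppr0 adde0. Qed.

Lemma measurable_unit_cube : measurable (@unit_cube R : set (measurable_space R)).
Proof.
by apply: measurableX; [apply: measurableX|]; exact: measurable_itv.
Qed.

Lemma leb3_unit_cube : leb3 R (@unit_cube R) = 1%E.
Proof.
apply: (etrans (@product_measure1E _ _ _ _ _ (mu \x mu)%E mu _ _ _ measurable01)).
  by apply: measurableX; exact: measurable01.
apply: (etrans (congr2 mule (@product_measure1E _ _ _ _ _ mu mu _ _ measurable01 measurable01)
  lebesgue_unit_interval)).
by rewrite (etrans (congr2 mule lebesgue_unit_interval lebesgue_unit_interval) (mule1 _)) mule1.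
Qed.

Lemma cube_bounded (f : point R -> R) : continuous f -> [bounded f x | x in @unit_cube R].
Proof.
move=> cf.
have : compact (f @` @unit_cube R).
  apply: continuous_compact; last exact: compact_unit_cube.
  exact: continuous_subspaceT.
move=> /compact_bounded[M [Mr HM]]; exists M; split=> // y My x Cx.
by apply: (HM _ My); exists x.
Qed.

Lemma cube_integrable (f : point R -> R) : continuous f ->
  (leb3 R).-integrable (@unit_cube R) (EFin \o f).
Proof.
move=> cf; apply: measurable_bounded_integrable.
- exact: measurable_unit_cube.
- by rewrite leb3_unit_cube ltry.
- apply: (@measurable_funS _ _ _ _ setT) => //; exact: continuous_measurable3.
- exact: cube_bounded.
Qed.

End Cube.

Section Mean.
Variable R : realType.
Local Notation mu := (@lebesgue_measure R).
Implicit Types (f g : point R -> R).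

Lemma continuousD3 f g : continuous f -> continuous g -> continuous (fun x => f x + g x).
Proof. by move=> cf cg x; apply: continuousD; [exact: cf|exact: cg]. Qed.

Lemma continuousM3 f g : continuous f -> continuous g -> continuous (fun x => f x * g x).
Proof. by move=> cf cg x; apply: continuousM; [exact: cf|exact: cg]. Qed.

Lemma continuousN3 f : continuous f -> continuous (fun x => - f x).
Proof. by move=> cf x; apply: continuousN; exact: cf. Qed.

Lemma continuous_cst3 (c : R) : continuous (fun _ : point R => c).
Proof. by move=> x; exact: cvg_cst. Qed.

Definition mean f : R := \int[leb3 R]_(x in @unit_cube R) f x.

Lemma meanD f g : continuous f -> continuous g ->
  mean (fun x => f x + g x) = mean f + mean g.
Proof.
by move=> cf cg; apply: RintegralD; [exact: measurable_unit_cube|exact: cube_integrable..].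
Qed.

Lemma meanZ c f : continuous f -> mean (fun x => c * f x) = c * mean f.
Proof.
by move=> cf; apply: RintegralZl; [exact: measurable_unit_cube|exact: cube_integrable].
Qed.

Lemma mean_cst (c : R) : mean (fun=> c) = c.
Proof.
rewrite /mean Rintegral_cst; last exact: measurable_unit_cube.
by rewrite leb3_unit_cube mulr1.
Qed.

Lemma eq_mean f g : f =1 g -> mean f = mean g.
Proof. by move=> fg; apply: eq_Rintegral => x _. Qed.

Lemma le_mean f g : continuous f -> continuous g ->
  (forall x, unit_cube x -> f x <= g x) -> mean f <= mean g.
Proof.
by move=> cf cg fg; apply: le_Rintegral => //; [exact: measurable_unit_cube|exact: cube_integrable..].
Qed.

Lemma mean_norm_le f (M : R) : continuous f ->
  (forall x, unit_cube x -> `|f x| <= M) -> `|mean f| <= M.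
Proof.
move=> cf fM; rewrite ler_norml -[- M]mean_cst -[X in _ <= _ <= X]mean_cst.
by apply/andP; split; apply: le_mean => //; (try exact: continuous_cst3) => x /fM; rewrite ler_norml => /andP[].
Qed.

Lemma mean_sum (I : Type) (r : seq I) (F : I -> point R -> R) :
  (forall i, continuous (F i)) ->
  continuous (fun x => \sum_(i <- r) F i x) /\
  mean (fun x => \sum_(i <- r) F i x) = \sum_(i <- r) mean (F i).
Proof.
move=> cF; elim: r => [|i r [c IH]].
  split; first by under eq_fun do rewrite big_nil; exact: continuous_cst3.
  by under eq_mean do rewrite big_nil; rewrite mean_cst big_nil.
split; first by under eq_fun do rewrite big_cons; apply: continuousD3.
by under eq_mean do rewrite big_cons; rewrite meanD// IH big_cons.
Qed.

(** Fubini, in whichever order makes the inner integral vanish. *)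
Lemma integral_prod_eq0 d1 d2 (T1 : measurableType d1) (T2 : measurableType d2)
  (m1 : {sigma_finite_measure set T1 -> \bar R}) (m2 : {sigma_finite_measure set T2 -> \bar R})
  (F : T1 * T2 -> \bar R) : (m1 \x m2)%E.-integrable setT F ->
  ((forall x, \int[m2]_y F (x, y) = 0) \/ (forall y, \int[m1]_x F (x, y) = 0))%E ->
  (\int[m1 \x m2]_x F x = 0)%E.
Proof.
move=> iF [h|h].
- by rewrite -integral12_prod_meas1//; apply: integral0_eq => x _; exact: h.
- by rewrite -integral21_prod_meas1//; apply: integral0_eq => x _; exact: h.
Qed.

(** Difference quotients in R^3 become those of the restriction to a line, so that the fundamental
    theorem of calculus and the chain rule in one variable apply to [partial]. *)
Lemma line_quotient (f : point R -> R) (p v : point R) (t : R) :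
  (fun h : R => h^-1 *: ((fun s : R => f (p + s *: v)) (h *: (1 : R) + t) - f (p + t *: v))) =
  (fun h : R => h^-1 *: (f (h *: v + (p + t *: v)) - f (p + t *: v))).
Proof.
apply/funext => h; congr (_ *: (f _ - _)).
by rewrite scalerDl [RHS]addrCA; congr (_ + _); rewrite -[in RHS](mulr1 h).
Qed.

Lemma line_derivable (f : point R -> R) (p v : point R) (t : R) :
  derivable f (p + t *: v) v -> derivable (fun s : R => f (p + s *: v)) t 1.
Proof. by rewrite /derivable line_quotient. Qed.

Lemma line_derive (f : point R -> R) (p v : point R) (t : R) :
  'D_1 (fun s : R => f (p + s *: v)) t = 'D_v f (p + t *: v).
Proof. by rewrite /derive line_quotient. Qed.

Lemma continuous_line (f : point R -> R) (p v : point R) : continuous f ->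
  continuous (fun s : R => f (p + s *: v)).
Proof.
move=> cf s; apply: (@continuous_comp _ _ _ (fun s : R => p + s *: v)); last exact: cf.
by apply: cvgD; [exact: cvg_cst|apply: cvgZr_tmp; exact: cvg_id].
Qed.

(** The fundamental theorem of calculus along a closed loop of the torus: the endpoint values agree
    by periodicity. *)
Lemma line_integral_partial0 (f : point R -> R) (i : 'I_3) (p : point R) :
  continuous f -> (forall x, derivable f x (basis_vec R i)) ->
  continuous (partial i f) -> periodic f (basis_vec R i) ->
  (\int[mu]_(t in `[0%R, 1%R]) (partial i f (p + t *: basis_vec R i))%:E = 0)%E.
Proof.
move=> cf df cpf pf.
pose F t := f (p + t *: basis_vec R i).
have cF : continuous F by exact: continuous_line.
rewrite (@continuous_FTC2 _ _ F 0 1)//.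
- by rewrite /F scale0r addr0 scale1r pf subee.
- by apply: continuous_subspaceT; exact: continuous_line.
- split => [t _||]; first exact: line_derivable.
  + exact/cvg_at_right_filter/cF.
  + exact/cvg_at_left_filter/cF.
- by move=> t _; rewrite derive1E line_derive.
Qed.

End Mean.

(** * Derivatives of periodic functions have mean zero *)

Section MeanPartial.
Variable R : realType.
Local Notation mu := (@lebesgue_measure R).
Implicit Types (f g : point R -> R).

(* The inner product measure of [leb3] has no sigma-finite instance under its
   original name. *)
Definition leb2 : set (measurableTypeR R * measurableTypeR R) -> \bar R := (mu \x mu)%E.

HB.instance Definition _ := Measure.on leb2.

Lemma leb2_sigma_finite : sigma_finite setT leb2.
Proof.
have [F [TF ndF Foo]] := iffLR (sigma_finiteP _ mu) (sigma_finiteT mu).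
exists (fun n => F n `*` F n).
  apply/seteqP; split => // -[x y] _.
  have [n _ Fn] : (\bigcup_n F n) x by rewrite -TF.
  have [m _ Fm] : (\bigcup_n F n) y by rewrite -TF.
  exists (maxn n m) => //; split => /=.
    by move: (x) Fn; apply/subsetPset/ndF; rewrite leq_maxl.
  by move: (y) Fm; apply/subsetPset/ndF; rewrite leq_maxr.
move=> n; have [mF Fn] := Foo n.
split; first exact: measurableX.
rewrite [X in (X < _)%E](@product_measure1E _ _ _ _ _ mu mu _ _ mF mF).
by apply: lte_mul_pinfty => //; rewrite ge0_fin_numE.
Qed.

HB.instance Definition _ := Measure_isSigmaFinite.Build _ _ _ leb2 leb2_sigma_finite.

Lemma leb3_eq0 (F : measurable_space R -> \bar R) : (leb3 R).-integrable setT F ->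
  ((forall x, \int[mu]_y F (x, y) = 0) \/ (forall y, \int[leb2]_x F (x, y) = 0))%E ->
  (\int[leb3 R]_x F x = 0)%E.
Proof. exact: (@integral_prod_eq0 _ _ _ _ _ leb2 mu). Qed.

(** Fubini alone gives integrable slices for almost every z; continuity gives all of them, as the
    second use of [integral_prod_eq0] at a fixed z requires. *)
Lemma slice_integrable (h : point R -> R) (z : R) : continuous h ->
  leb2.-integrable setT
   (fun xy : measurableTypeR R * measurableTypeR R => ((EFin \o h) \_ (@unit_cube R)) (xy, z)).
Proof.
move=> ch.
have [zC|zC] := boolP (z \in `[0, 1]%classic); last first.
  apply: (eq_integrable measurableT (fun=> 0%E)); last exact: integrable0.
  move=> xy _; rewrite patchE; case: ifPn => // /set_mem[_ /= zz].
  by move: zC; rewrite mem_set.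
pose sq : set (measurableTypeR R * measurableTypeR R) := `[0, 1]%classic `*` `[0, 1]%classic.
have sq1 : leb2 sq = 1%E.
  etransitivity; first exact: (@product_measure1E _ _ _ _ _ mu mu _ _ (@measurable01 R) (@measurable01 R)).
  etransitivity; last exact: (mule1 1%E). congr mule; exact: lebesgue_unit_interval.
have sqm : measurable sq.
  by apply: measurableX; exact: measurable01.
apply: (eq_integrable measurableT ((EFin \o (fun xy => h (xy, z))) \_ sq)).
  move=> xy _; rewrite !patchE /=.
  have -> : (((xy, z) : point R) \in @unit_cube R) = (xy \in sq) => //.
  by apply/idP/idP => /set_mem m; apply/mem_set; [case: m|split => //; exact: set_mem].
apply: (iffLR (integrable_mkcond _ sqm)).
apply: (@measurable_bounded_integrable _ _ _ leb2 (fun xy => h (xy, z)) sq) => //.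
- by move: sq1 => /= ->; exact: ltry.
- apply: (@measurable_funS _ _ _ _ setT) => //.
  apply: (@measurableT_comp _ _ _ _ _ _ (h : measurable_space R -> R)); first exact: continuous_measurable3.
  exact: measurable_pair2.
- have [M [Mr HM]] := cube_bounded ch.
  by exists M; split => // y My xy sqxy; apply: (HM _ My); split => //; exact: set_mem.
Qed.

(** Fubini with x_i integrated innermost, where [line_integral_partial0] gives 0. For the vertical
    direction one splitting of the product suffices; for a horizontal one the (x_1, x_2) slice is
    split again. *)
Lemma mean_partial f i :
  continuous f -> (forall x, derivable f x (basis_vec R i)) ->
  continuous (partial i f) -> periodic f (basis_vec R i) ->
  mean (partial i f) = 0.
Proof.
move=> cf df cpf pf; rewrite /mean /Rintegral integral_mkcond.
set F := patch _ _ _.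
have iF : (leb3 R).-integrable setT F.
  by apply: (iffLR (integrable_mkcond _ (@measurable_unit_cube R))); exact: cube_integrable.
have line p : (\int[mu]_(t in `[0%R, 1%R]) (partial i f (p + t *: basis_vec R i))%:E = 0)%E.
  exact: line_integral_partial0.
have slice (F1 : measurableTypeR R -> \bar R) (P : Prop) (p : point R) :
    (forall t, F1 t = if `[< P >] && (t \in `[0%R, 1%R]%classic)
      then (partial i f (p + t *: basis_vec R i))%:E else 0%E) ->
    (\int[mu]_t F1 t = 0)%E.
  move=> F1E; have [p1|p0] := pselect P; last first.
    by apply: integral0_eq => t _; rewrite F1E asboolF.
  rewrite -[RHS](line p) [RHS]integral_mkcond; apply: eq_integral => t _.
  by rewrite F1E asboolT// patchE.
have inC x y z (P : Prop) (Q : set R) (t : R) : (unit_cube (x, y, z) <-> P /\ Q t) ->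
   (((x, y, z) : point R) \in @unit_cube R) = `[< P >] && (t \in Q).
  move=> e; apply/idP/idP => [/set_mem/e[p q]|/andP[/asboolP p /set_mem q]].
    by rewrite mem_set// asboolT.
  by apply/mem_set/e.
rewrite -[RHS]/(fine 0%E); congr fine.
case: i @F iF line slice df cpf pf => -[|[|[|//]]] i3 F iF line slice df cpf pf.
- apply: (leb3_eq0 iF); right => z.
  apply: (@integral_prod_eq0 _ _ _ _ _ mu mu _ (slice_integrable z cpf)).
  right => y; apply: (slice _ (y \in `[0,1] /\ z \in `[0, 1]) (0, y, z)) => x.
  rewrite /F patchE; rewrite (inC _ _ _ (y \in `[0,1] /\ z \in `[0, 1]) `[0, 1]%classic x).
    by rewrite /basis_vec /=; case: ifP => // _; congr (partial _ f _)%:E;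
       congr (_, _, _) => /=; rewrite ?scaler0 ?addr0 ?add0r// /GRing.scale/= ?mulr0 ?mulr1 ?addr0.
  by rewrite /unit_cube/=; split => [[[]]|[[]]].
- apply: (leb3_eq0 iF); right => z.
  apply: (@integral_prod_eq0 _ _ _ _ _ mu mu _ (slice_integrable z cpf)).
  left => x; apply: (slice _ (x \in `[0,1] /\ z \in `[0, 1]) (x, 0, z)) => y.
  rewrite /F patchE; rewrite (inC _ _ _ (x \in `[0,1] /\ z \in `[0, 1]) `[0, 1]%classic y).
    by rewrite /basis_vec /=; case: ifP => // _; congr (partial _ f _)%:E;
       congr (_, _, _) => /=; rewrite ?scaler0 ?addr0 ?add0r// /GRing.scale/= ?mulr0 ?mulr1 ?addr0.
  by rewrite /unit_cube/=; split => [[[]]|[[]]].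
- apply: (leb3_eq0 iF); left => -[x y].
  apply: (slice _ (x \in `[0,1] /\ y \in `[0, 1]) (x, y, 0)) => z.
  rewrite /F patchE; rewrite (inC _ _ _ (x \in `[0,1] /\ y \in `[0, 1]) `[0, 1]%classic z).
    by rewrite /basis_vec /=; case: ifP => // _; congr (partial _ f _)%:E;
       congr (_, _, _) => /=; rewrite ?scaler0 ?addr0 ?add0r// /GRing.scale/= ?mulr0 ?mulr1 ?addr0.
  by rewrite /unit_cube/=; split => [[[]]|[[]]].
Qed.

End MeanPartial.

(** * Smooth periodic functions and their Fourier coefficients *)

Section ComplexModulus.
Variable R : realType.
Local Notation nc := (@ComplexField.Normc.normc R).
Implicit Types (z w : R[i]).

Lemma ncM z w : nc (z * w) = nc z * nc w. Proof. exact: ComplexField.Normc.normcM. Qed.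
Lemma ncD z w : nc (z + w) <= nc z + nc w. Proof. exact: le_normcD. Qed.
Lemma ncN z : nc (- z) = nc z. Proof. exact: normcN. Qed.
Lemma nc0 : nc 0 = 0. Proof. exact: ComplexField.Normc.normc0. Qed.
Lemma ncE z : nc z = Num.sqrt (complex.Re z ^+ 2 + complex.Im z ^+ 2).
Proof. by case: z. Qed.
Lemma nc_ge0 z : 0 <= nc z. Proof. by rewrite ncE sqrtr_ge0. Qed.
Lemma nc_sqr z : nc z ^+ 2 = complex.Re z ^+ 2 + complex.Im z ^+ 2.
Proof. by rewrite ncE sqr_sqrtr// addr_ge0 ?sqr_ge0. Qed.
Lemma nc_real (a : R) : nc a%:C%C = `|a|.
Proof. by rewrite ncE /= expr0n addr0 sqrtr_sqr. Qed.
Lemma nc_Re z : `|complex.Re z| <= nc z.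
Proof. by rewrite ncE -sqrtr_sqr ler_wsqrtr// lerDl sqr_ge0. Qed.
Lemma nc_le z : nc z <= `|complex.Re z| + `|complex.Im z|.
Proof.
rewrite -(@ler_pXn2r _ 2)// ?nnegrE ?nc_ge0 ?addr_ge0// nc_sqr sqrrD !real_normK ?num_real//.
by rewrite -addrA lerD2l lerDr mulrn_wge0// mulr_ge0.
Qed.
Lemma nc_i : nc 'i%C = 1.
Proof. by rewrite ncE /= expr0n add0r expr1n sqrtr1. Qed.
Lemma nc_expi (t : R) : nc (expi t) = 1.
Proof. by rewrite ncE /= cos2Dsin2 sqrtr1. Qed.
Lemma nc_sum (I : Type) (r : seq I) (P : pred I) (F : I -> R[i]) :
  nc (\sum_(i <- r | P i) F i) <= \sum_(i <- r | P i) nc (F i).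
Proof.
elim/big_ind2: _ => [|x a y b xa yb|//]; first by rewrite nc0.
exact: le_trans (ncD _ _) (lerD xa yb).
Qed.
Lemma nc_conj z : nc z^*%C = nc z.
Proof. by case: z => a b; rewrite !ncE /= sqrrN. Qed.
Lemma expiD (s t : R) : expi (s + t) = expi s * expi t.
Proof. by rewrite /expi cosD sinD; congr Complex; rewrite addrC. Qed.
Lemma expi0 : expi 0 = 1 :> R[i].
Proof. by rewrite /expi cos0 sin0. Qed.
Lemma expiN (t : R) : expi (- t) = (expi t)^*%C.
Proof. by rewrite /expi cosN sinN. Qed.

Lemma expi_2piM (m : int) : expi (2 * pi * m%:~R) = 1 :> R[i].
Proof.
have H (n : nat) : expi (2 * pi * n%:R) = 1 :> R[i].
  elim: n => [|n IH]; first by rewrite mulr0 expi0.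
  have -> : 2 * pi * n.+1%:R = 2 * pi * n%:R + 2 * pi :> R by rewrite -(@natr1 _ n); ring.
  rewrite expiD IH mul1r /expi mulr_natl.
  by rewrite -[pi *+ 2]add0r sinD2pi cosD2pi sin0 cos0.
case: m => n; first exact: H.
by rewrite NegzE mulrNz mulrN expiN H conjc1.
Qed.

End ComplexModulus.

Section Waves.
Variable R : realType.
Implicit Types (f g : point R -> R) (x : point R) (n m : freq).

Definition idx (i : 'I_3) n : int :=
  match nat_of_ord i with 0%N => n.1.1 | 1%N => n.1.2 | _ => n.2 end.

Definition kc (i : 'I_3) n : R := 2 * pi * (idx i n)%:~R.

Definition phase n x : R := dot3 (wave R n) x.

Lemma phase_shift n x (i : 'I_3) (t : R) :
  phase n (x + t *: basis_vec R i) = phase n x + t * kc i n.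
Proof.
case: i => -[|[|[|//]]] i3; rewrite /phase /dot3 /kc /idx /basis_vec /wave /= /GRing.scale /=; ring.
Qed.

Lemma phaseD n m x : phase (n + m) x = phase n x + phase m x.
Proof. rewrite /phase /dot3 /wave/= !intrD; ring. Qed.

Lemma phaseN n x : phase (- n) x = - phase n x.
Proof. rewrite /phase /dot3 /wave/= !mulrNz; ring. Qed.

Lemma kcD i n m : kc i (n + m) = kc i n + kc i m.
Proof. by rewrite /kc -mulrDr -intrD; case: i => -[|[|[|//]]]. Qed.

Lemma kcN i n : kc i (- n) = - kc i n.
Proof. by rewrite /kc -mulrN -mulrNz; case: i => -[|[|[|//]]]. Qed.

Lemma kcB i n m : kc i (n - m) = kc i n - kc i m.
Proof. by rewrite kcD kcN. Qed.

Lemma directional f x v (d : R) :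
  is_derive (0 : R) 1 (fun t : R => f (x + t *: v)) d -> derivable f x v /\ 'D_v f x = d.
Proof.
move=> [df Df]; move: df Df; rewrite /derivable /derive.
by rewrite -[X in shift X]/(0 : R) (line_quotient f x v 0) scale0r addr0.
Qed.

Definition cosw n x := cos (phase n x).
Definition sinw n x := sin (phase n x).

Lemma is_derive_affine (a k : R) : is_derive (0 : R) 1 (fun t : R => a + t * k) k.
Proof.
have : is_derive (0 : R) 1 (cst a + (fun t : R => t * k)) (0 + k).
  apply: is_deriveD.
  have -> : (fun t : R => t * k) = k \*: id by apply/funext => t /=; rewrite mulrC.
  by rewrite -[X in is_derive _ _ _ X](mulr1 k); exact: is_deriveZ.
by rewrite add0r.
Qed.

Lemma cosw_partial n (i : 'I_3) x :
  derivable (cosw n) x (basis_vec R i) /\ partial i (cosw n) x = - (kc i n * sinw n x).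
Proof.
apply: directional; rewrite /cosw; under eq_fun do rewrite phase_shift.
have H := is_derive_affine (phase n x) (kc i n).
have := @is_derive1_comp _ cos (fun t => phase n x + t * kc i n) 0 _ _ (is_derive_cos _) H.
by rewrite /= mul0r addr0 /sinw mulNr mulrC.
Qed.

Lemma sinw_partial n (i : 'I_3) x :
  derivable (sinw n) x (basis_vec R i) /\ partial i (sinw n) x = kc i n * cosw n x.
Proof.
apply: directional; rewrite /sinw; under eq_fun do rewrite phase_shift.
have H := is_derive_affine (phase n x) (kc i n).
have := @is_derive1_comp _ sin (fun t => phase n x + t * kc i n) 0 _ _ (is_derive_sin _) H.
by rewrite /= mul0r addr0 /cosw mulrC.
Qed.

Lemma phase_continuous n : continuous (phase n).
Proof.
move=> x; rewrite /phase /dot3; apply: cvgD; [apply: cvgD|]; apply: cvgM; try exact: cvg_cst.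
- by apply: (continuous_comp (f := fst) (g := fst)); exact: cvg_fst.
- by apply: (continuous_comp (f := fst) (g := snd)); [exact: cvg_fst|exact: cvg_snd].
- exact: cvg_snd.
Qed.

Lemma cosw_continuous n : continuous (cosw n).
Proof. by move=> x; apply: continuous_comp; [exact: phase_continuous|exact: continuous_cos]. Qed.

Lemma sinw_continuous n : continuous (sinw n).
Proof. by move=> x; apply: continuous_comp; [exact: phase_continuous|exact: continuous_sin]. Qed.

Lemma expi_phase_periodic n (i : 'I_3) x :
  expi (phase n (x + basis_vec R i)) = expi (phase n x).
Proof. by rewrite -[basis_vec R i]scale1r phase_shift mul1r expiD expi_2piM mulr1. Qed.

Lemma cosw_periodic n (i : 'I_3) : periodic (cosw n) (basis_vec R i).
Proof. by move=> x; have [] := expi_phase_periodic n i x. Qed.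

Lemma sinw_periodic n (i : 'I_3) : periodic (sinw n) (basis_vec R i).
Proof. by move=> x; have [] := expi_phase_periodic n i x. Qed.

End Waves.

Section Smooth.
Variable R : realType.
Implicit Types (f g : point R -> R) (x : point R) (n m : freq).
Local Notation nc := (@ComplexField.Normc.normc R).

(* [torus_smooth] adds derivatives at the outside of a composition, [Ck] at the
   inside, which is what an induction over products needs. *)
Fixpoint Ck (k : nat) f : Prop :=
  continuous f /\
  if k is k'.+1 then forall i, (forall x, derivable f x (basis_vec R i)) /\ Ck k' (partial i f)
  else True.

Lemma Ck_continuous k f : Ck k f -> continuous f.
Proof. by case: k => [|k] []. Qed.

Lemma CkS k f : Ck k.+1 f -> Ck k f.
Proof.
elim: k f => [|k IH] f [cf H]; first by [].
by split=> // i; have [df Hf] := H i; split => //; exact: IH.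
Qed.

(** [iter_partial] applies the last index of the list first, so peeling lists from the right matches
    the recursion of [Ck]. *)
Lemma torus_smoothP f : torus_smooth f <->
  (forall i, periodic f (basis_vec R i)) /\ forall k, Ck k f.
Proof.
split => -[pf H]; split => //.
- move=> k; elim: k f H {pf} => [|k IH] f H; first by split => //; have [] := H [::].
  split; first by have [] := H [::].
  move=> i; split; first by move=> x; have [_ h] := H [::]; exact: h.
  by apply: IH => l; have := H (rcons l i); rewrite /iter_partial foldr_rcons.
- move=> l; elim/last_ind: l f H {pf} => [|l i IH] f H.
    by split; [exact: (Ck_continuous (H 0%N))|move=> i x; have [_] := H 1%N; move=> /(_ i)[]].
  rewrite /iter_partial foldr_rcons; apply: IH => k.
  by have [_] := H k.+1; move=> /(_ i)[].
Qed.

Lemma partial_periodic f i v : periodic f v -> periodic (partial i f) v.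
Proof.
move=> pf x; rewrite /partial /derive;
suff -> : (fun h : R => h^-1 *: ((f \o shift (x + v)) (h *: basis_vec R i) - f (x + v))) =
  (fun h : R => h^-1 *: ((f \o shift x) (h *: basis_vec R i) - f x)) by [].
by apply/funext => h; rewrite /= pf addrA pf.
Qed.

Lemma smooth_partial f i : torus_smooth f -> torus_smooth (partial i f).
Proof.
move=> /torus_smoothP[pf Hf]; apply/torus_smoothP; split.
  by move=> j; exact: partial_periodic.
by move=> k; have [_] := Hf k.+1; move=> /(_ i)[].
Qed.

Lemma smooth_continuous f : torus_smooth f -> continuous f.
Proof. by move=> [_ /(_ [::])[]]. Qed.

Lemma smooth_derivable f i x : torus_smooth f -> derivable f x (basis_vec R i).
Proof. by move=> [_ /(_ [::])[_ h]]; exact: h. Qed.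

Lemma partialD f g i x : derivable f x (basis_vec R i) -> derivable g x (basis_vec R i) ->
  derivable (fun y => f y + g y) x (basis_vec R i) /\
  partial i (fun y => f y + g y) x = partial i f x + partial i g x.
Proof. by move=> df dg; split; [exact: derivableD|rewrite /partial deriveD]. Qed.

Lemma partialM f g i x : derivable f x (basis_vec R i) -> derivable g x (basis_vec R i) ->
  derivable (fun y => f y * g y) x (basis_vec R i) /\
  partial i (fun y => f y * g y) x = f x * partial i g x + g x * partial i f x.
Proof. by move=> df dg; split; [exact: (derivableM df dg)|exact: (deriveM df dg)]. Qed.

Lemma CkD k f g : Ck k f -> Ck k g -> Ck k (fun x => f x + g x).
Proof.
elim: k f g => [|k IH] f g [cf Hf] [cg Hg]; first by split => //; exact: continuousD3.
split=> [|i]; first exact: continuousD3.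
have [df Hf'] := Hf i; have [dg Hg'] := Hg i; split => [x|].
  by have [] := partialD (df x) (dg x).
rewrite (_ : partial i _ = fun x => partial i f x + partial i g x); first exact: IH.
by apply/funext => x; have [] := partialD (df x) (dg x).
Qed.

Lemma CkM k f g : Ck k f -> Ck k g -> Ck k (fun x => f x * g x).
Proof.
elim: k f g => [|k IH] f g Hf0 Hg0.
  by split => //; apply: continuousM3; [exact: Ck_continuous Hf0|exact: Ck_continuous Hg0].
have [cf Hf] := Hf0; have [cg Hg] := Hg0.
split=> [|i]; first exact: continuousM3.
have [df Hf'] := Hf i; have [dg Hg'] := Hg i; split => [x|].
  by have [] := partialM (df x) (dg x).
rewrite (_ : partial i _ = fun x => f x * partial i g x + g x * partial i f x).
  by apply: CkD; apply: IH => //; exact: CkS.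
by apply/funext => x; have [] := partialM (df x) (dg x).
Qed.

Lemma smoothD f g : torus_smooth f -> torus_smooth g -> torus_smooth (fun x => f x + g x).
Proof.
move=> /torus_smoothP[pf Hf] /torus_smoothP[pg Hg]; apply/torus_smoothP; split.
  by move=> i x; rewrite pf pg.
by move=> k; exact: CkD.
Qed.

Lemma smoothM f g : torus_smooth f -> torus_smooth g -> torus_smooth (fun x => f x * g x).
Proof.
move=> /torus_smoothP[pf Hf] /torus_smoothP[pg Hg]; apply/torus_smoothP; split.
  by move=> i x; rewrite pf pg.
by move=> k; exact: CkM.
Qed.

Lemma Ck_cst k (c : R) : Ck k (fun=> c).
Proof.
elim: k c => [|k IH] c; first by split => //; exact: continuous_cst3.
split=> [|i]; first exact: continuous_cst3.
split=> [x|]; first exact: derivable_cst.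
rewrite (_ : partial i _ = fun=> 0)//.
by apply/funext => x; rewrite /partial; apply: derive_cst.
Qed.

Lemma smooth_cst (c : R) : torus_smooth (fun=> c).
Proof. by apply/torus_smoothP; split => // k; exact: Ck_cst. Qed.

Lemma smooth_sum (I : Type) (r : seq I) (F : I -> point R -> R) :
  (forall i, torus_smooth (F i)) -> torus_smooth (fun x => \sum_(i <- r) F i x).
Proof.
move=> sF; elim: r => [|i r IH].
  by under eq_fun do rewrite big_nil; exact: smooth_cst.
by under eq_fun do rewrite big_cons; exact: (smoothD (sF i) IH).
Qed.

Lemma smoothN f : torus_smooth f -> torus_smooth (fun x => - f x).
Proof.
move=> sf; under eq_fun do rewrite -mulN1r.
exact: (smoothM (smooth_cst (-1)) sf).
Qed.

Lemma smooth_waves n : torus_smooth (cosw n : point R -> R) /\ torus_smooth (sinw n : point R -> R).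
Proof.
have H k : Ck k (cosw n : point R -> R) /\ Ck k (sinw n : point R -> R).
  elim: k => [|k [IHc IHs]].
    by split; split => //; [exact: cosw_continuous|exact: sinw_continuous].
  split; split; [exact: cosw_continuous| |exact: sinw_continuous|] => i; split.
  - by move=> x; have [] := cosw_partial n i x.
  - rewrite (_ : partial i _ = fun x => (- kc R i n) * sinw n x).
      by apply: CkM => //; exact: Ck_cst.
    by apply/funext => x; have [_ ->] := cosw_partial n i x; rewrite mulNr.
  - by move=> x; have [] := sinw_partial n i x.
  - rewrite (_ : partial i _ = fun x => kc R i n * cosw n x).
      by apply: CkM => //; exact: Ck_cst.
    by apply/funext => x; have [_ ->] := sinw_partial n i x.
by split; apply/torus_smoothP; split => [i|k]; [exact: cosw_periodic|have [] := H k|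
  exact: sinw_periodic|have [] := H k].
Qed.

Lemma fourierE f n : continuous f -> fourier f n =
  Complex (mean (fun x => cosw n x * f x)) (- mean (fun x => sinw n x * f x)).
Proof.
move=> cf; rewrite /fourier /cube_integral; congr Complex.
  by apply: eq_mean => x; rewrite /= mulr0 subr0 cosN.
rewrite -[LHS]/(mean (fun x => complex.Im (expi (- phase n x) * (f x)%:C%C))).
rewrite -mulN1r -meanZ; last by apply: continuousM3 => //; exact: sinw_continuous.
by apply: eq_mean => x /=; rewrite mulr0 add0r sinN mulNr mulN1r.
Qed.

(** The product rule, and the vanishing mean of the derivative of g f. *)
Lemma mean_by_parts f g i : torus_smooth f -> torus_smooth g ->
  mean (fun x => g x * partial i f x) = - mean (fun x => partial i g x * f x).
Proof.
move=> sf sg; apply/eqP; rewrite -addr_eq0 -meanD; last 2 first.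
- exact: (continuousM3 (smooth_continuous sg) (smooth_continuous (smooth_partial i sf))).
- exact: (continuousM3 (smooth_continuous (smooth_partial i sg)) (smooth_continuous sf)).
have sgf := smoothM sg sf.
rewrite -(mean_partial (smooth_continuous sgf) (fun x => @smooth_derivable _ i x sgf)
  (smooth_continuous (smooth_partial i sgf)) (sgf.1 i)); apply/eqP/eq_mean => x.
have [_ ->] := partialM (@smooth_derivable _ i x sg) (@smooth_derivable _ i x sf).
by rewrite [X in _ + X]mulrC.
Qed.

Lemma fourier_partial f i n : torus_smooth f ->
  fourier (partial i f) n = 'i%C * (kc R i n)%:C%C * fourier f n.
Proof.
move=> sf; have [sc ss] := smooth_waves n.
rewrite !fourierE; [|exact: smooth_continuous|exact/smooth_continuous/smooth_partial].
rewrite !mean_by_parts//.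
have -> : mean (fun x => partial i (cosw n) x * f x) = - kc R i n * mean (fun x => sinw n x * f x).
  rewrite -meanZ; last by apply: continuousM3; exact: smooth_continuous.
  by apply: eq_mean => x; have [_ ->] := cosw_partial n i x; rewrite !mulNr mulrA.
have -> : mean (fun x => partial i (sinw n) x * f x) = kc R i n * mean (fun x => cosw n x * f x).
  rewrite -meanZ; last by apply: continuousM3; exact: smooth_continuous.
  by apply: eq_mean => x; have [_ ->] := sinw_partial n i x; rewrite mulrA.
by simpc; congr Complex; ring.
Qed.

Lemma fourier_herm f n : continuous f -> fourier f (- n) = (fourier f n)^*%C.
Proof.
move=> cf; rewrite !fourierE//=; congr Complex.
  by apply: eq_mean => x; rewrite /cosw phaseN cosN.
congr (- _); rewrite -[in RHS]mulN1r -meanZ; last by apply: continuousM3 => //; exact: sinw_continuous.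
by apply: eq_mean => x; rewrite /sinw phaseN sinN mulN1r mulNr.
Qed.

Lemma fourier_bounded f : continuous f -> exists C, forall n, nc (fourier f n) <= C.
Proof.
move=> cf; have [M [Mr HM]] := cube_bounded cf.
exists ((M + 1) + (M + 1)) => n; rewrite fourierE//; apply: le_trans (nc_le _) _ => /=.
have fM x : unit_cube x -> `|f x| <= M + 1 by move=> Cx; apply: HM => //; rewrite ltrDl.
rewrite normrN; apply: lerD; apply: mean_norm_le.
- by apply: continuousM3 => //; exact: cosw_continuous.
- move=> x /fM h; rewrite normrM -[leRHS]mul1r; apply: ler_pM => //.
  by rewrite ler_norml cos_geN1 cos_le1.
- by apply: continuousM3 => //; exact: sinw_continuous.
- move=> x /fM h; rewrite normrM -[leRHS]mul1r; apply: ler_pM => //.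
  by rewrite ler_norml sin_geN1 sin_le1.
Qed.

Lemma fourierD f g n : continuous f -> continuous g ->
  fourier (fun x => f x + g x) n = fourier f n + fourier g n.
Proof.
move=> cf cg; have cfg := continuousD3 cf cg; rewrite !fourierE//.
have cM := @continuousM3 R; have cc := @cosw_continuous R n; have cs := @sinw_continuous R n.
simpc; rewrite -opprD -!meanD; try exact: cM.
by congr Complex; [|congr (- _)]; apply: eq_mean => x; rewrite mulrDr.
Qed.

Lemma fourierZ (a : R) f n : continuous f ->
  fourier (fun x => a * f x) n = a%:C%C * fourier f n.
Proof.
move=> cf; have caf := continuousM3 (@continuous_cst3 _ a) cf; rewrite !fourierE//.
have cM := @continuousM3 R; have cc := @cosw_continuous R n; have cs := @sinw_continuous R n.
simpc; rewrite ?mul0r ?subr0 ?addr0 ?mulrN -!meanZ; try exact: cM.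
by congr Complex; [|congr (- _)]; apply: eq_mean => x; rewrite mulrCA.
Qed.

Lemma fourier_sum (I : Type) (r : seq I) (F : I -> point R -> R) n :
  (forall i, continuous (F i)) ->
  fourier (fun x => \sum_(i <- r) F i x) n = \sum_(i <- r) fourier (F i) n.
Proof.
move=> cF; elim: r => [|i r IH].
  under eq_fun do rewrite big_nil; rewrite big_nil.
  have := fourierZ 0 n (@continuous_cst3 R 0).
  by under eq_fun do rewrite mul0r; rewrite mul0r.
under eq_fun do rewrite big_cons.
rewrite big_cons fourierD// ?IH//; by have [] := mean_sum r cF.
Qed.

End Smooth.

(** * Sums over Z^3 *)

Section Esum.
Variable R : realType.
Local Open Scope ereal_scope.

Lemma sum_le_esum (T : choiceType) (a : T -> \bar R) (s : seq T) :
  (forall i, 0 <= a i) -> uniq s -> \sum_(i <- s) a i <= \esum_(i in [set: T]) a i.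
Proof.
move=> a0 us; apply: ereal_sup_ubound; exists [set` s]; last by rewrite -fsbig_seq.
by split => //; exact: finite_seq.
Qed.

Lemma term_le_esum (T : choiceType) (a : T -> \bar R) (i : T) :
  (forall i, 0 <= a i) -> a i <= \esum_(i in [set: T]) a i.
Proof. by move=> a0; have := @sum_le_esum _ a [:: i] a0; rewrite big_seq1; exact. Qed.

Lemma esum_le_sup (T : choiceType) (a : T -> \bar R) (M : \bar R) :
  (forall s : seq T, uniq s -> \sum_(i <- s) a i <= M) -> \esum_(i in [set: T]) a i <= M.
Proof.
move=> H; apply: ge_ereal_sup => _ [F [finF _] <-].
by rewrite fsbig_finite//; apply: H; exact: finmap.fset_uniq.
Qed.

(** One inequality is enough: applied with c^-1 to the scaled family it yields the reverse one. *)
Lemma esumZ (T : choiceType) (c : R) (a : T -> \bar R) : (0 <= c)%R -> (forall i, 0 <= a i) ->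
  \esum_(i in [set: T]) (c%:E * a i) = c%:E * \esum_(i in [set: T]) a i.
Proof.
have le (d : R) (b : T -> \bar R) : (0 <= d)%R -> (forall i, 0 <= b i) ->
    \esum_(i in [set: T]) (d%:E * b i) <= d%:E * \esum_(i in [set: T]) b i.
  move=> d0 b0; apply: esum_le_sup => s us.
  by rewrite -ge0_sume_distrr//; apply: lee_pmul => //; [exact: sume_ge0|exact: sum_le_esum].
move=> c0 a0; have [->|cn0] := eqVneq c 0%R.
  by rewrite mul0e; apply: esum1 => i _; rewrite mul0e.
apply/le_anti/andP; split; first exact: le.
have cE0 : 0 <= c%:E by rewrite lee_fin.
have ci0 : (0 <= c^-1)%R by rewrite invr_ge0.
have := @le c^-1%R (fun i => c%:E * a i) ci0 (fun i => mule_ge0 cE0 (a0 i)).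
under eq_esum do rewrite muleA -EFinM mulVf// mul1e.
move=> h; apply: (le_trans (lee_pmul _ _ (lexx c%:E) h)) => //; first exact: esum_ge0.
by rewrite muleA -EFinM divff// mul1e.
Qed.

Lemma esum_swap (T1 T2 : choiceType) (a : T1 -> T2 -> \bar R) : (forall i j, 0 <= a i j) ->
  \esum_(i in [set: T1]) \esum_(j in [set: T2]) a i j =
  \esum_(j in [set: T2]) \esum_(i in [set: T1]) a i j.
Proof.
move=> a0; rewrite esum_esum// [RHS]esum_esum//.
rewrite (@reindex_esum _ _ _ ([set: T2] `*`` fun=> [set: T1]) _ (fun k => (k.2, k.1)))//.
split => //; first by move=> [i j] [i' j'] _ _ /= [-> ->].
by move=> [i j] _; exists (j, i).
Qed.

Lemma esum_shift (V : zmodType) (k : V) (a : V -> \bar R) :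
  \esum_(l in [set: V]) a (k - l)%R = \esum_(l in [set: V]) a l.
Proof.
apply/esym/reindex_esum; split => //.
  by move=> i j _ _ /addrI/oppr_inj.
by move=> l _; exists (k - l)%R => //; rewrite opprB addrC subrK.
Qed.

Lemma esum_pair (T1 T2 : choiceType) (f : T1 -> R) (g : T2 -> R) :
  (forall i, 0 <= f i)%R -> (forall j, 0 <= g j)%R ->
  \esum_(k in [set: T1]) (f k)%:E < +oo -> \esum_(k in [set: T2]) (g k)%:E < +oo ->
  \esum_(k in [set: T1 * T2]) (f k.1 * g k.2)%:E < +oo.
Proof.
move=> f0 g0 fF gF.
rewrite (_ : [set: T1 * T2] = [set: T1] `*`` (fun=> [set: T2])); last first.
  by apply/seteqP; split.
rewrite -(@esum_esum _ _ _ _ _ (fun i j => (f i * g j)%:E)); last by move=> i j _ _; rewrite lee_fin mulr_ge0.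
have [G GE] : exists G : R, \esum_(j in [set: T2]) (g j)%:E = G%:E.
  have : \esum_(j in [set: T2]) (g j)%:E \is a fin_num.
    by rewrite ge0_fin_numE//; apply: esum_ge0 => j _; rewrite lee_fin.
  by move=> /fineK <-; eexists.
have G0 : (0 <= G)%R by rewrite -lee_fin -GE; apply: esum_ge0 => j _; rewrite lee_fin.
rewrite (eq_esum (b := fun i => G%:E * (f i)%:E)); last first.
  move=> i _; by rewrite muleC -GE -esumZ.
by rewrite esumZ// lte_mul_pinfty.
Qed.

(** The cases where a factor on the right is 0 come first: since 0 * +oo = 0, the bound then says
    that the left side vanishes, whatever the other factor is. *)
Lemma weighted_CS (T : choiceType) (p q : T -> R) :
  (forall i, 0 <= p i)%R -> (forall i, 0 <= q i)%R ->
  (\esum_(i in [set: T]) (p i * q i)%:E) ^+ 2 <=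
  (\esum_(i in [set: T]) (p i)%:E) * \esum_(i in [set: T]) (p i * q i ^+ 2)%:E.
Proof.
move=> p0 q0.
set S := \esum_(i in _) _; set A := \esum_(i in _) _; set B := \esum_(i in _) _.
have pq0 i : 0 <= (p i * q i)%:E by rewrite lee_fin mulr_ge0.
have pqq0 i : 0 <= (p i * q i ^+ 2)%:E by rewrite lee_fin mulr_ge0// sqr_ge0.
have pE0 i : 0 <= (p i)%:E by rewrite lee_fin.
have S0 : 0 <= S by apply: esum_ge0.
have A0 : 0 <= A by apply: esum_ge0.
have B0 : 0 <= B by apply: esum_ge0.
have AB0 : A = 0 \/ B = 0 -> S = 0.
  move=> AB; apply: esum1 => i _; congr (_%:E).
  case: AB => [AB|AB].
    have := term_le_esum i pE0; rewrite -/A AB lee_fin => pi0.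
    by have -> : p i = 0%R; [apply/le_anti/andP|rewrite mul0r].
  have := term_le_esum i pqq0; rewrite -/B AB lee_fin => pi0.
  have /eqP : (p i * q i ^+ 2)%R = 0%R by apply/le_anti/andP; split => //; rewrite -lee_fin.
  by rewrite mulf_eq0 expf_eq0/= => /orP[/eqP->|/eqP->]; rewrite ?mul0r ?mulr0.
have [A00|An0] := eqVneq A 0; first by rewrite AB0; [rewrite expe2 mule0 mule_ge0|left].
have [B00|Bn0] := eqVneq B 0; first by rewrite AB0; [rewrite expe2 mule0 mule_ge0|right].
have Apos : 0 < A by rewrite lt_def An0.
have Bpos : 0 < B by rewrite lt_def Bn0.
(* Discriminant argument: [0 <= \sum p (t - q)^2], to be used at [t = S / A]. *)
have quad (t : R) : (0 <= t)%R -> (2 * t)%:E * S <= (t ^+ 2)%:E * A + B.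
  move=> t0; rewrite -!esumZ ?mulr_ge0 ?sqr_ge0// -esumD//; last first.
    by move=> i _; rewrite mule_ge0// lee_fin sqr_ge0.
  apply: le_esum => i _; rewrite -!EFinM -EFinD lee_fin -subr_ge0.
  have -> : (t ^+ 2 * p i + p i * q i ^+ 2 - 2 * t * (p i * q i) = p i * (t - q i) ^+ 2)%R by ring.
  by rewrite mulr_ge0// sqr_ge0.
case: (A) Apos An0 quad => [a| |//] apos _; last by move=> _; rewrite gt0_mulye// leey.
case: (B) Bpos => [b| |//] bpos; last by move=> _; rewrite gt0_muley// leey.
(* If the left sum were infinite, t = 1 would contradict the finiteness of both factors. *)
case: (S) S0 => [c| |//] c0 quad; last first.
  by have := quad 1%R ler01; rewrite mulr1 gt0_muley ?lte_fin// -EFinM -EFinD leye_eq.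
rewrite !lte_fin in apos bpos; rewrite lee_fin in c0.
have := quad (c / a)%R (divr_ge0 c0 (ltW apos)); rewrite -EFin_expe -!EFinM -EFinD !lee_fin => h.
have := ler_wpM2l (ltW apos) h.
have -> : (a * (2 * (c / a) * c) = 2 * c ^+ 2)%R by field; rewrite gt_eqF.
have -> : (a * ((c / a) ^+ 2 * a + b) = c ^+ 2 + a * b)%R by field; rewrite gt_eqF.
by lra.
Qed.

(** Cauchy-Schwarz with the weight a(k - l), then summation over k first. The case [B] = 0 is
    separate because [A] may be +oo. *)
Lemma young (V : zmodType) (a c : V -> R) : (forall i, 0 <= a i)%R -> (forall i, 0 <= c i)%R ->
  \esum_(k in [set: V]) (\esum_(l in [set: V]) (a (k - l)%R * c l)%:E) ^+ 2 <=
  (\esum_(m in [set: V]) (a m)%:E) ^+ 2 * \esum_(l in [set: V]) (c l ^+ 2)%:E.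
Proof.
move=> a0 c0; set A := \esum_(m in _) (a m)%:E; set B := \esum_(l in _) (c l ^+ 2)%:E.
have aE0 i : 0 <= (a i)%:E by rewrite lee_fin.
have A0 : 0 <= A by apply: esum_ge0.
have cE0 i : 0 <= (c i ^+ 2)%:E by rewrite lee_fin sqr_ge0.
have B0 : 0 <= B by apply: esum_ge0.
have X0 k l : 0 <= (a (k - l) * c l ^+ 2)%:E by rewrite lee_fin mulr_ge0// sqr_ge0.
have [B00|Bn0] := eqVneq B 0.
  rewrite B00 mule0 esum1// => k _; rewrite [X in X ^+ 2]esum1 ?expe2 ?mule0// => l _.
  have := term_le_esum l cE0; rewrite -/B B00 lee_fin => cl0.
  have /eqP : (c l ^+ 2)%R = 0%R by apply/le_anti/andP; split => //; exact: sqr_ge0.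
  by rewrite expf_eq0/= => /eqP->; rewrite mulr0.
have Bpos : 0 < B by rewrite lt_def Bn0.
have : forall k, (\esum_(l in [set: V]) (a (k - l)%R * c l)%:E) ^+ 2 <=
    A * \esum_(l in [set: V]) (a (k - l) * c l ^+ 2)%:E.
  move=> k; have := @weighted_CS _ (fun l => a (k - l)%R) c (fun=> a0 _) c0.
  by rewrite (esum_shift k (fun l => (a l)%:E)).
have swap : \esum_(k in [set: V]) \esum_(l in [set: V]) (a (k - l) * c l ^+ 2)%:E =
   \esum_(l in [set: V]) ((c l ^+ 2)%:E * A).
  rewrite esum_swap//; apply: eq_esum => l _.
  under eq_esum do rewrite mulrC EFinM.
  rewrite esumZ ?sqr_ge0//; congr (_ * _).
  apply/esym/(@reindex_esum _ _ _ [set: V] [set: V] (fun k => (k - l)%R) (fun m => (a m)%:E)).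
  split => //; first by move=> i j _ _ /addIr.
  by move=> m _; exists (m + l)%R => //; rewrite addrK.
case: (A) A0 swap => [r| |//] r0 swap h; last first.
  by rewrite expe2 mulyy gt0_mulye// leey.
rewrite lee_fin in r0.
apply: (le_trans (le_esum (fun k _ => h k))).
rewrite esumZ//; last by move=> k; apply: esum_ge0.
rewrite swap; under eq_esum do rewrite muleC.
by rewrite esumZ// muleA expe2.
Qed.

End Esum.

(** * Summability of power weights on Z and Z^3 *)

Section IntegerSums.
Variable R : realType.

(** Comparison with a telescoping series. It reduces to 1 + q / (x + 1) <= ((x + 1) / x)^q, which
    follows from 1 + u <= exp u and ln (x / (x + 1)) <= - 1 / (x + 1). *)
Lemma powR_step (q x : R) : 0 < q -> 0 < x ->
  q * (x + 1) `^ (- (q + 1)) <= x `^ (- q) - (x + 1) `^ (- q).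
Proof.
move=> q0 x0; have x10 : 0 < x + 1 by lra.
rewrite /powR !gt_eqF//.
have e1 : expR (- (q + 1) * ln (x + 1)) = expR (- q * ln (x + 1)) * (x + 1)^-1.
  by rewrite mulNr mulrDl mul1r opprD -mulNr expRD expRN lnK.
have e2 : expR (- q * ln x) = expR (- q * ln (x + 1)) * expR (q * (ln (x + 1) - ln x)).
  by rewrite -expRD; congr expR; ring.
rewrite e1 e2.
have h : 1 + q / (x + 1) <= expR (q * (ln (x + 1) - ln x)).
  apply: le_trans (expR_ge1Dx _); rewrite lerD2l ler_pM2l//.
  have := @le_ln1Dx _ (- (x + 1)^-1).
  have -> : 1 + - (x + 1)^-1 = x / (x + 1) by field; rewrite gt_eqF.
  rewrite ln_div ?posrE// => H.
  have : ln x - ln (x + 1) <= - (x + 1)^-1.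
    by apply: H; rewrite ltrN2 invf_lt1//; lra.
  by lra.
have E : 0 < expR (- q * ln (x + 1)) by exact: expR_gt0.
have := ler_wpM2l (ltW E) h; rewrite mulrDr mulr1; lra.
Qed.

(** The negative last term is what makes the induction telescope; the bound 1 + 1 / q is what
    remains of it later. *)
Lemma sum_powR_bound (q : R) (N : nat) : 0 < q ->
  \sum_(i < N.+1) i.+1%:R `^ (- (q + 1)) <= 1 + q^-1 - q^-1 * N.+1%:R `^ (- q).
Proof.
move=> q0; have qi0 : 0 <= q^-1 by rewrite invr_ge0 ltW.
elim: N => [|N IH].
  by rewrite big_ord_recr big_ord0 /= !powR1 add0r; lra.
rewrite big_ord_recr /=; apply: le_trans (lerD IH (lexx _)) _.
have := ler_wpM2l qi0 (@powR_step q N.+1%:R q0 (ltr0Sn _ _)).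
rewrite mulrA mulVf ?gt_eqF// mul1r natr1 mulrBr; lra.
Qed.

Definition zweight (p : R) (n : int) : R := (`|n|%N).+1%:R `^ (- p).

Lemma zweight_ge0 p n : 0 <= zweight p n.
Proof. exact: powR_ge0. Qed.

Lemma zweight_summable (p : R) : 1 < p -> (\esum_(n in [set: int]) (zweight p n)%:E < +oo)%E.
Proof.
move=> p1; pose q := p - 1; have q0 : 0 < q by rewrite subr_gt0.
pose g (n : nat) : R := n.+1%:R `^ (- p).
have g0 n : 0 <= g n by exact: powR_ge0.
have sg : (\esum_(n in [set: nat]) (g n)%:E < +oo)%E.
  apply: (@le_lt_trans _ _ (1 + q^-1)%:E); last exact: ltry.
  rewrite -nneseries_esumT => [|n]; last by rewrite lee_fin.
  apply: lime_le; first by apply: is_cvg_nneseries => n _ _; rewrite lee_fin.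
  apply: nearW => N; rewrite sumEFin lee_fin.
  apply: (@le_trans _ _ (\sum_(0 <= i < N.+1) g i)).
    by rewrite big_nat_recr//= lerDl.
  rewrite big_mkord; have := @sum_powR_bound q N q0.
  rewrite /q subrK => h; apply: le_trans h _.
  by rewrite gerBl mulr_ge0 ?powR_ge0// invr_ge0 ltW.
have sb : (\esum_(b in [set: bool]) (1 : R)%:E < +oo)%E.
  apply: (@le_lt_trans _ _ (2%:R : R)%:E); last exact: ltry.
  apply: esum_le_sup => s us.
  rewrite sumEFin lee_fin big_const_seq count_predT iter_addr_0 ler_nat.
  by rewrite -card_bool -(card_uniqP us) max_card.
have := esum_pair (f := fun _ : bool => 1 : R) (fun _ => ler01) g0 sb sg.
apply: le_lt_trans.
(* Z is two copies of N: [Posz n] has the weight (n + 1)^(-p), [Negz n] the smaller weight (n +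
   2)^(-p). *)
rewrite (@reindex_esum _ _ _ [set: bool * nat] _ (fun k => if k.1 then Posz k.2 else Negz k.2)).
  apply: le_esum => -[b n] _; rewrite lee_fin mul1r /zweight /g; case: b => //=.
  rewrite !powRN lef_pV2 ?posrE ?powR_gt0//.
  by apply: ge0_ler_powR; rewrite ?nnegrE ?ler_nat//; lra.
split => //.
  by move=> [[] n] [[] m] _ _ //= [->].
by move=> [n|n] _; [exists (true, n)|exists (false, n)].
Qed.

(** A product over coordinates rather than a power of |n|: summability follows from the case of Z,
    and [L1_osc] can treat the vertical factor apart. *)
Definition fweight (p : R) (n : freq) : R :=
  zweight p n.1.1 * zweight p n.1.2 * zweight p n.2.

Lemma fweight_ge0 p n : 0 <= fweight p n.
Proof. by rewrite !mulr_ge0// zweight_ge0. Qed.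

Lemma fweight_summable (p : R) : 1 < p ->
  (\esum_(n in [set: freq]) (fweight p n)%:E < +oo)%E.
Proof.
move=> p1; have z := zweight_summable p1; have z0 := zweight_ge0 p.
have z2 := esum_pair z0 z0 z z.
exact: (esum_pair (f := fun n => zweight p n.1 * zweight p n.2) (fun n => mulr_ge0 (z0 _) (z0 _)) z0 z2 z).
Qed.

End IntegerSums.

Definition i0 : 'I_3 := @Ordinal 3 0 isT.
Definition i1 : 'I_3 := @Ordinal 3 1 isT.

Lemma sum3 (V : nmodType) (F : 'I_3 -> V) : \sum_(i < 3) F i = F i0 + F i1 + F vert.
Proof.
rewrite !big_ord_recr big_ord0 /= add0r; congr (F _ + F _ + F _); exact: val_inj.
Qed.

(** Lagrange's identity writes the difference as a sum of three squares. *)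
Lemma cauchy3 (R : realFieldType) (a1 a2 a3 b1 b2 b3 : R) :
  (a1 * b1 + a2 * b2 + a3 * b3) ^+ 2 <=
  (a1 ^+ 2 + a2 ^+ 2 + a3 ^+ 2) * (b1 ^+ 2 + b2 ^+ 2 + b3 ^+ 2).
Proof.
rewrite -subr_ge0.
rewrite (_ : _ - _ = (a1 * b2 - a2 * b1) ^+ 2 + (a1 * b3 - a3 * b1) ^+ 2 + (a2 * b3 - a3 * b2) ^+ 2).
  by rewrite !addr_ge0 ?sqr_ge0.
ring.
Qed.

(** * Rapid decay of Fourier coefficients *)

Section Rapid.
Variable R : realType.
Local Notation nc := (@ComplexField.Normc.normc R).
Implicit Types (n m : freq) (c d : freq -> R[i]).

Lemma wave_norm_sqr n : wave_norm R n ^+ 2 = \sum_(i < 3) kc R i n ^+ 2.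
Proof.
rewrite /wave_norm sqr_sqrtr; last by rewrite /dot3 -!expr2 !addr_ge0 ?sqr_ge0.
by rewrite !big_ord_recr big_ord0 /= add0r /dot3 -!expr2.
Qed.

Lemma wave_norm_ge0 n : 0 <= wave_norm R n. Proof. exact: sqrtr_ge0. Qed.

Lemma kc_le_wave_norm i n : `|kc R i n| <= wave_norm R n.
Proof.
rewrite -(@ler_pXn2r _ 2)// ?nnegrE ?wave_norm_ge0// real_normK ?num_real// wave_norm_sqr.
by rewrite (bigD1 i)//= lerDl sumr_ge0// => j _; exact: sqr_ge0.
Qed.

Lemma wave_norm_le n : wave_norm R n <= \sum_(i < 3) `|kc R i n|.
Proof.
rewrite -(@ler_pXn2r _ 2)// ?nnegrE ?wave_norm_ge0 ?sumr_ge0// wave_norm_sqr.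
rewrite !sum3.
rewrite -![kc _ _ _ ^+ 2]real_normK ?num_real//.
have [a b c] : [/\ 0 <= `|kc R i0 n|, 0 <= `|kc R i1 n| & 0 <= `|kc R vert n|] by [].
move: a b c; set x := `|_|; set y := `|_|; set z := `|_| => x0 y0 z0.
have : 0 <= x * y by exact: mulr_ge0.
have : 0 <= x * z by exact: mulr_ge0.
have : 0 <= y * z by exact: mulr_ge0.
nra.
Qed.

Lemma wave_normN n : wave_norm R (- n) = wave_norm R n.
Proof.
apply: (@pexpIrn _ 2); rewrite ?nnegrE ?wave_norm_ge0// !wave_norm_sqr.
by apply: eq_bigr => i _; rewrite kcN sqrrN.
Qed.

Lemma wave_normD n m : wave_norm R (n + m) <= wave_norm R n + wave_norm R m.
Proof.
rewrite -(@ler_pXn2r _ 2)// ?nnegrE ?addr_ge0 ?wave_norm_ge0// sqrrD.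
have CS : `|\sum_(i < 3) kc R i n * kc R i m| <= wave_norm R n * wave_norm R m.
  rewrite -(@ler_pXn2r _ 2)// ?nnegrE ?mulr_ge0 ?wave_norm_ge0// real_normK ?num_real//.
  by rewrite exprMn !wave_norm_sqr !sum3 cauchy3.
have -> : wave_norm R (n + m) ^+ 2 =
    wave_norm R n ^+ 2 + 2 * (\sum_(i < 3) kc R i n * kc R i m) + wave_norm R m ^+ 2.
  by rewrite !wave_norm_sqr !sum3 !kcD; ring.
rewrite lerD2r lerD2l mulr_natl lerMn2r/=.
exact: le_trans (ler_norm _) CS.
Qed.

Definition japanese n : R := 1 + wave_norm R n.
Local Notation J := japanese.

Lemma J_ge1 n : 1 <= J n. Proof. by rewrite lerDl wave_norm_ge0. Qed.
Lemma J_gt0 n : 0 < J n. Proof. exact: lt_le_trans (J_ge1 n). Qed.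
Lemma J_ge0 n : 0 <= J n. Proof. exact: ltW (J_gt0 n). Qed.
Lemma wave_norm_le_J n : wave_norm R n <= J n. Proof. by rewrite lerDr. Qed.
Lemma kc_le_J i n : `|kc R i n| <= J n.
Proof. exact: le_trans (kc_le_wave_norm i n) (wave_norm_le_J n). Qed.
Lemma idx_le_J i n : (`|idx i n|%N).+1%:R <= J n.
Proof.
rewrite -natr1 addrC lerD2l; apply: le_trans (kc_le_wave_norm i n).
rewrite /kc normrM -(@intr_norm R) -abszE -[X in X <= _]mul1r ler_wpM2r//.
rewrite ger0_norm ?mulr_ge0 ?pi_ge0//.
by have := @pi_ge2 R; lra.
Qed.

Definition rapid c := forall p : nat, exists C : R, forall n, J n ^+ p * nc (c n) <= C.

Lemma J_pow_le p n : J n ^+ p <= 4 ^+ p * (1 + \sum_(i < 3) `|kc R i n| ^+ p).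
Proof.
have : exists r : R, [/\ 0 <= r, J n <= 4 * r & r ^+ p <= 1 + \sum_(i < 3) `|kc R i n| ^+ p].
  have S0 : forall j : 'I_3, `|kc R j n| ^+ p <= \sum_(i < 3) `|kc R i n| ^+ p.
    by move=> j; rewrite (bigD1 j)//= lerDl sumr_ge0// => i _; rewrite exprn_ge0.
  have := wave_norm_le n; rewrite sum3 => h.
  (* [M] is one of the four numbers 1 and |k_i|, so its p-th power is at most the right-hand sum;
     the factor 4 counts these numbers. *)
  set M := Num.max 1 (Num.max `|kc R i0 n| (Num.max `|kc R i1 n| `|kc R vert n|)).
  have [M1 [Ma [Mb Mc]]] : 1 <= M /\ `|kc R i0 n| <= M /\ `|kc R i1 n| <= M /\ `|kc R vert n| <= M.
    by rewrite /M !le_max !lexx !orbT.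
  exists M; split; [exact: le_trans M1|by rewrite /J; lra|].
  have Sp : 0 <= \sum_(i < 3) `|kc R i n| ^+ p by apply: sumr_ge0 => i _; exact: exprn_ge0.
  have mc (x y : R) : Num.max x y = x \/ Num.max x y = y by case: leP; [right|left].
  rewrite /M; case: (mc 1 (Num.max `|kc R i0 n| (Num.max `|kc R i1 n| `|kc R vert n|))) => ->.
    by rewrite expr1n lerDl.
  case: (mc `|kc R i0 n| (Num.max `|kc R i1 n| `|kc R vert n|)) => ->.
    by rewrite (le_trans (S0 _))// lerDr.
  by case: (mc `|kc R i1 n| `|kc R vert n|) => ->; rewrite (le_trans (S0 _))// lerDr.
move=> [r [r0 Jr rp]]; apply: le_trans (_ : (4 * r) ^+ p <= _).
  by rewrite lerXn2r// nnegrE ?J_ge0// mulr_ge0.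
by rewrite exprMn ler_wpM2l// exprn_ge0.
Qed.

Lemma fourier_decay f (i : 'I_3) (p : nat) : torus_smooth f ->
  exists C, forall n, `|kc R i n| ^+ p * nc (fourier f n) <= C.
Proof.
elim: p f => [|p IH] f sf.
  by have [C HC] := fourier_bounded (smooth_continuous sf); exists C => n; rewrite mul1r.
have [C HC] := IH _ (smooth_partial i sf); exists C => n.
by have := HC n; rewrite fourier_partial// !ncM nc_i mul1r nc_real mulrA -exprSr.
Qed.

Lemma rapid_fourier f : torus_smooth f -> rapid (fourier f).
Proof.
move=> sf p.
have [C0 H0] := fourier_bounded (smooth_continuous sf).
have [Ca Ha] := fourier_decay i0 p sf; have [Cb Hb] := fourier_decay i1 p sf.
have [Cc Hc] := fourier_decay vert p sf.
exists (4 ^+ p * (C0 + (Ca + Cb + Cc))) => n.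
apply: le_trans (ler_wpM2r (nc_ge0 _) (J_pow_le p n)) _.
rewrite -mulrA ler_wpM2l ?exprn_ge0// mulrDl mul1r lerD// sum3 !mulrDl.
by rewrite !lerD.
Qed.

Lemma rapidM (m : freq -> R[i]) c (q : nat) (M : R) : (forall n, nc (m n) <= M * J n ^+ q) ->
  rapid c -> rapid (fun n => m n * c n).
Proof.
move=> hm hc p; have [C HC] := hc (p + q)%N.
have M0 : 0 <= M.
  have := le_trans (nc_ge0 _) (hm 0); rewrite pmulr_lge0// exprn_gt0//; exact: J_gt0.
exists (M * C) => n; rewrite ncM.
have Jp : 0 <= J n ^+ p by rewrite exprn_ge0// J_ge0.
apply: le_trans (_ : J n ^+ p * (M * J n ^+ q * nc (c n)) <= _).
  by rewrite ler_wpM2l// ler_wpM2r// nc_ge0.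
have := ler_wpM2l M0 (HC n); rewrite exprD; apply: le_trans.
by rewrite le_eqVlt; apply/orP; left; apply/eqP; ring.
Qed.

Lemma J_fweight n : (J n ^+ 6)^-1 <= fweight (2 : R) n.
Proof.
have z (k : int) : zweight (2 : R) k = ((`|k|%N).+1%:R ^+ 2)^-1.
  by rewrite /zweight powRN powR_mulrn.
rewrite /fweight !z -!invfM lef_pV2; last 2 first.
- by rewrite posrE exprn_gt0// J_gt0.
- by rewrite posrE; apply: mulr_gt0; [apply: mulr_gt0|]; exact: exprn_gt0.
rewrite (_ : 6 = 2 + 2 + 2)%N// !exprD.
have h i : (`|idx i n|%N).+1%:R ^+ 2 <= J n ^+ 2.
  by rewrite lerXn2r ?nnegrE ?J_ge0// idx_le_J.
have h0 := h i0; have h1 := h i1; have h2 := h vert.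
exact: (ler_pM (mulr_ge0 (sqr_ge0 _) (sqr_ge0 _)) (sqr_ge0 _) (ler_pM (sqr_ge0 _) (sqr_ge0 _) h0 h1) h2).
Qed.

Lemma rapid_summable c : rapid c -> (\esum_(n in [set: freq]) (nc (c n))%:E < +oo)%E.
Proof.
move=> hc; have [C HC] := hc 6%N.
have C0 : 0 <= C by apply: le_trans (HC 0); rewrite mulr_ge0 ?exprn_ge0 ?J_ge0 ?nc_ge0.
apply: (@le_lt_trans _ _ (\esum_(n in [set: freq]) (C%:E * (fweight (2 : R) n)%:E))%E).
  apply: le_esum => n _; rewrite -EFinM lee_fin.
  apply: le_trans (_ : C * (J n ^+ 6)^-1 <= _); last by rewrite ler_wpM2l// J_fweight.
  by rewrite ler_pdivlMr ?exprn_gt0 ?J_gt0// mulrC.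
rewrite esumZ//; last by move=> n; rewrite lee_fin fweight_ge0.
by rewrite lte_mul_pinfty// fweight_summable// ltr1n.
Qed.

End Rapid.

(** * Sums over growing boxes of frequencies *)

Section BoxSums.
Variable R : realType.
Local Notation nc := (@ComplexField.Normc.normc R).
Implicit Types (n m : freq) (u v w : freq -> R).

Lemma finite_freq_box N : finite_set (freq_box N).
Proof.
pose g (k : 'I_N.+1 * bool) : int := if k.2 then Posz k.1 else - Posz k.1.
have gE (z : int) : (`|z| <= N)%N -> exists k, g k = z.
  case: z => z; first by rewrite absz_nat -ltnS => h; exists (Ordinal h, true).
  move=> h; have h' : (z.+1 < N.+1)%N by [].
  by exists (Ordinal h', false); rewrite /g NegzE.
apply: (@sub_finite_set _ _
  ((fun k : 'I_N.+1 * bool * ('I_N.+1 * bool) * ('I_N.+1 * bool) => (g k.1.1, g k.1.2, g k.2)) @` setT)).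
  move=> n [/gE[x ex] [/gE[y ey] /gE[z ez]]]; exists (x, y, z) => //=.
  by rewrite ex ey ez; case: n {ex ey ez} => -[].
exact: finite_image.
Qed.

Definition box (N : nat) : seq freq := finmap.enum_fset (fset_set (freq_box N)).

Lemma mem_box N n : (n \in box N) = [&& `|n.1.1| <= N, `|n.1.2| <= N & `|n.2| <= N]%N.
Proof.
rewrite /box in_fset_set; last exact: finite_freq_box.
apply/idP/and3P => [/set_mem[? []]//|[? ? ?]]; exact/mem_set.
Qed.

Lemma box_uniq N : uniq (box N). Proof. exact: finmap.fset_uniq. Qed.

Lemma box_sum (V : nmodType) (F : freq -> V) N :
  \sum_(n \in freq_box N) F n = \sum_(n <- box N) F n.
Proof. by rewrite fsbig_finite//; exact: finite_freq_box. Qed.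

Lemma box_sub N M : (N <= M)%N -> {subset box N <= box M}.
Proof.
by move=> NM n; rewrite !mem_box => /and3P[a b c]; rewrite !(leq_trans _ NM).
Qed.

Lemma seq_sub_box (s : seq freq) : exists N, {subset s <= box N}.
Proof.
elim: s => [|n s [N H]]; first by exists 0%N.
exists (maxn N (maxn `|n.1.1| (maxn `|n.1.2| `|n.2|))) => k; rewrite inE => /predU1P[->|/H].
  by rewrite mem_box !leq_max !leqnn !orbT.
by apply: box_sub; exact: leq_maxl.
Qed.

Lemma sum_sub (V : zmodType) (s t : seq freq) (F : freq -> V) : uniq s -> uniq t ->
  {subset s <= t} -> \sum_(n <- t) F n = \sum_(n <- s) F n + \sum_(n <- t | n \notin s) F n.
Proof.
move=> us ut st; rewrite (bigID (mem s))/=; congr (_ + _).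
rewrite -big_filter; apply/perm_big/uniq_perm => //; first exact: filter_uniq.
by move=> n; rewrite mem_filter; apply/andP/idP => [[]//|ns]; split => //; exact: st.
Qed.

Lemma sum_box_mono v N M : (forall n, 0 <= v n) -> (N <= M)%N ->
  \sum_(n <- box N) v n <= \sum_(n <- box M) v n.
Proof.
move=> v0 NM; rewrite (sum_sub v (box_uniq N) (box_uniq M) (box_sub NM)) lerDl.
exact: sumr_ge0.
Qed.

Definition total v : R := fine (\esum_(n in [set: freq]) (v n)%:E).

Lemma totalE v : (forall n, 0 <= v n) -> (\esum_(n in [set: freq]) (v n)%:E < +oo)%E ->
  (total v)%:E = (\esum_(n in [set: freq]) (v n)%:E)%E.
Proof.
by move=> v0 sv; rewrite fineK// ge0_fin_numE//; apply: esum_ge0 => n _; rewrite lee_fin.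
Qed.

(** [esum] is a supremum over finite sets, and every finite set lies in a box. *)
Lemma box_cvg v : (forall n, 0 <= v n) -> (\esum_(n in [set: freq]) (v n)%:E < +oo)%E ->
  (fun N => \sum_(n <- box N) v n) @ \oo --> total v.
Proof.
move=> v0 sv.
have vE0 n : (0 <= (v n)%:E)%E by rewrite lee_fin.
have e : (\esum_(n in [set: freq]) (v n)%:E = ereal_sup (range (fun N => (\sum_(n <- box N) v n)%:E)))%E.
  apply/le_anti/andP; split.
    apply: esum_le_sup => s us; have [N sN] := seq_sub_box s.
    apply: le_trans (_ : ((\sum_(n <- box N) v n)%:E <= _)%E); last first.
      by apply: ereal_sup_ubound; exists N.
    rewrite sumEFin lee_fin (sum_sub v us (box_uniq N) sN) lerDl.
    exact: sumr_ge0.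
  apply: ge_ereal_sup => _ [N _ <-]; rewrite -sumEFin.
  by apply: sum_le_esum => //; exact: box_uniq.
have h : (fun N => (\sum_(n <- box N) v n)%:E) @ \oo --> (total v)%:E.
  rewrite totalE// e; apply: ereal_nondecreasing_cvgn => N M NM.
  by rewrite lee_fin; exact: sum_box_mono.
exact: (fine_cvg h).
Qed.

(** Writing u = (u + w) - w reduces the limit to two monotone ones. The error is bounded by a tail
    of [w], hence uniformly in any parameter on which [w] does not depend. *)
Lemma box_dominated u w : (forall n, `|u n| <= w n) ->
  (\esum_(n in [set: freq]) (w n)%:E < +oo)%E ->
  exists2 L, (fun N => \sum_(n <- box N) u n) @ \oo --> L &
    forall N, `|L - \sum_(n <- box N) u n| <= total w - \sum_(n <- box N) w n.
Proof.
move=> uw sw; have w0 n : 0 <= w n by exact: le_trans (uw n).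
have cw := box_cvg w0 sw.
have uw0 n : 0 <= u n + w n by have := uw n; rewrite ler_norml; lra.
have suw : (\esum_(n in [set: freq]) (u n + w n)%:E < +oo)%E.
  apply: (@le_lt_trans _ _ (\esum_(n in [set: freq]) (2%:E * (w n)%:E))%E).
    by apply: le_esum => n _; rewrite -EFinM lee_fin; have := uw n; rewrite ler_norml; lra.
  by rewrite esumZ// lte_mul_pinfty.
have cuw := box_cvg uw0 suw.
have cu : (fun N => \sum_(n <- box N) u n) @ \oo --> total (fun n => u n + w n) - total w.
  rewrite (_ : (fun N => \sum_(n <- box N) u n) =
    (fun N => \sum_(n <- box N) (u n + w n) - \sum_(n <- box N) w n)); last first.
    by apply/funext => N; rewrite big_split/= addrK.
  exact: cvgB.
exists (total (fun n => u n + w n) - total w) => // N.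
set L := _ - total w in cu *.
have c1 : (fun M => `|\sum_(n <- box M) u n - \sum_(n <- box N) u n|) @ \oo --> `|L - \sum_(n <- box N) u n|.
  by apply: cvg_norm; apply: cvgB => //; exact: cvg_cst.
have c2 : (fun M => \sum_(n <- box M) w n - \sum_(n <- box N) w n) @ \oo --> total w - \sum_(n <- box N) w n.
  by apply: cvgB => //; exact: cvg_cst.
apply: (ler_cvg_to c1 c2); near=> M.
have NM : (N <= M)%N by near: M; exact: nbhs_infty_ge.
rewrite (sum_sub u (box_uniq N) (box_uniq M) (box_sub NM)).
rewrite (sum_sub w (box_uniq N) (box_uniq M) (box_sub NM)).
rewrite [X in `|X|]addrAC subrr add0r [leRHS]addrAC subrr add0r.
apply: le_trans (ler_norm_sum _ _ _) _.
by apply: ler_sum => n _.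
Unshelve. all: by end_near. Qed.

End BoxSums.

(** * Taylor bounds for sine, cosine and the exponential *)

Section TrigBounds.
Variable R : realType.

Lemma mvt_bound (f df : R -> R) (M t : R) : (forall x : R, is_derive x 1 f (df x)) ->
  (forall x, 0 <= x <= t -> `|df x| <= M) -> 0 <= t -> `|f t - f 0| <= M * t.
Proof.
move=> fd dfM t0.
have cf : {within `[0, t], continuous f}.
  by apply: derivable_within_continuous => x _; have [] := fd x.
have [c ct ->] := MVT_segment t0 (fun x _ => fd x) cf.
by rewrite subr0 normrM (ger0_norm t0) ler_wpM2r// dfM//.
Qed.

Lemma sin_le_ge0 (t : R) : 0 <= t -> `|sin t| <= t.
Proof.
move=> t0; have := @mvt_bound sin cos 1 t (@is_derive_sin R) _ t0.
rewrite sin0 subr0 mul1r; apply => x _.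
by rewrite ler_norml cos_geN1 cos_le1.
Qed.

Lemma cos_sub1_ge0 (t : R) : 0 <= t -> `|cos t - 1| <= t ^+ 2.
Proof.
move=> t0; have := @mvt_bound cos (fun x => - sin x) t t (@is_derive_cos R) _ t0.
rewrite cos0 -expr2; apply => x /andP[x0 xt]; rewrite normrN.
exact: le_trans (sin_le_ge0 x0) xt.
Qed.

Lemma sin_sub_ge0 (t : R) : 0 <= t -> `|sin t - t| <= t ^+ 2.
Proof.
move=> t0; have d (x : R) : is_derive x 1 (sin \- id) (cos x - 1) by exact: is_deriveB.
have := @mvt_bound (sin \- id) (fun x => cos x - 1) t t d _ t0.
rewrite /= sin0 !subr0 -expr2; apply => x /andP[x0 xt].
have := @mvt_bound cos (fun x => - sin x) 1 x (@is_derive_cos R) _ x0.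
rewrite cos0 mul1r => h; apply: le_trans xt; apply: h => y _.
by rewrite normrN; exact: sin_max.
Qed.

(** The constants are crude, from repeated mean value inequalities; what matters is a quadratic
    remainder valid for all t. *)
Lemma expi_taylor (t : R) :
  ComplexField.Normc.normc (expi t - 1 - 'i%C * t%:C%C) <= 2 * t ^+ 2.
Proof.
apply: le_trans (nc_le _) _; rewrite /expi; simpc => /=.
have h (u : R) : 0 <= u -> `|cos u - 1| + `|sin u - u| <= 2 * u ^+ 2.
  by move=> u0; have := cos_sub1_ge0 u0; have := sin_sub_ge0 u0; lra.
have [t0|t0] := leP 0 t; first exact: h.
have := h (- t); rewrite cosN sinN sqrrN -opprD normrN; apply.
by rewrite oppr_ge0 ltW.
Qed.

End TrigBounds.

(** * Fourier inversion *)

Section Synth.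
Variable R : realType.
Local Notation nc := (@ComplexField.Normc.normc R).
Implicit Types (n m k : freq) (c d : freq -> R[i]) (f g : point R -> R) (x : point R).

(** The same expression as [multiplier] with the coefficients m(k) f^_k, so that [inv_hor_laplacian]
    and the components of [Lambda] are instances by conversion. *)
Definition synth c : point R -> R := fun x =>
  limn (fun N : nat => complex.Re (\sum_(n \in freq_box N) (c n * expi (dot3 (wave R n) x)))).

Definition term c n x : R := complex.Re (c n) * cosw n x - complex.Im (c n) * sinw n x.

Definition psum c N x : R := \sum_(n <- box N) term c n x.

Definition acvg c := (\esum_(n in [set: freq]) (nc (c n))%:E < +oo)%E.

Definition tail c N : R := total (fun n => nc (c n)) - \sum_(n <- box N) nc (c n).

Lemma Re_sum (I : Type) (r : seq I) (F : I -> R[i]) :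
  complex.Re (\sum_(i <- r) F i) = \sum_(i <- r) complex.Re (F i).
Proof.
elim: r => [|i r IH]; rewrite ?big_nil// !big_cons -IH.
by case: (F i) => a b; case: (\sum_(_ <- _) _).
Qed.

Lemma termE c n x : term c n x = complex.Re (c n * expi (phase n x)).
Proof. by rewrite /term /expi; case: (c n). Qed.

Lemma synthE c x : synth c x = limn (fun N => psum c N x).
Proof.
rewrite /synth; congr (limn _); apply/funext => N.
by rewrite box_sum Re_sum; apply: eq_bigr => n _; rewrite termE.
Qed.

Lemma term_le c n x : `|term c n x| <= nc (c n).
Proof. by rewrite termE (le_trans (nc_Re _))// ncM nc_expi mulr1. Qed.

Lemma synth_cvg c x : acvg c -> (fun N => psum c N x) @ \oo --> synth c x.
Proof.
move=> hc; rewrite synthE; have [L cL _] := box_dominated (fun n => term_le c n x) hc.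
exact/cvgP/cL.
Qed.

Lemma synth_tail c x N : acvg c -> `|synth c x - psum c N x| <= tail c N.
Proof.
move=> hc; rewrite synthE; have [L cL HL] := box_dominated (fun n => term_le c n x) hc.
by rewrite (cvg_lim _ cL)//; exact: HL.
Qed.

Lemma tail_cvg c : acvg c -> tail c @ \oo --> 0.
Proof.
move=> hc; rewrite -(subrr (total (fun n => nc (c n)))).
apply: cvgB; first exact: cvg_cst.
by apply: box_cvg => // n; exact: nc_ge0.
Qed.

Lemma term_continuous c n : continuous (term c n).
Proof.
by apply: continuousD3; [|apply: continuousN3]; apply: continuousM3;
  (try exact: continuous_cst3); [exact: cosw_continuous|exact: sinw_continuous].
Qed.

Lemma psum_continuous c N : continuous (psum c N).
Proof. by have [] := mean_sum (box N) (fun n => @term_continuous c n). Qed.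

Lemma synth_continuous c : acvg c -> continuous (synth c).
Proof.
move=> hc x; apply/cvgrPdist_le => e e0.
have e3 : 0 < e / 3 by rewrite divr_gt0.
have /cvgrPdist_le/(_ _ e3)[N _ HN] := tail_cvg hc.
have tN : tail c N <= e / 3.
  by have := HN N (leqnn _); rewrite sub0r normrN => /(le_trans (ler_norm _)).
have /cvgrPdist_le/(_ _ e3) := @psum_continuous c N x.
apply: filterS => y hy.
have h1 := le_trans (synth_tail x N hc) tN; have h2 := le_trans (synth_tail y N hc) tN.
rewrite (_ : synth c x - synth c y = (synth c x - psum c N x) + (psum c N x - psum c N y)
  - (synth c y - psum c N y)); last by ring.
apply: le_trans (ler_normB _ _) _; apply: le_trans (lerD (ler_normD _ _) (lexx _)) _.
by lra.
Qed.

Lemma synth_periodic c (i : 'I_3) : periodic (synth c) (basis_vec R i).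
Proof.
move=> x; rewrite !synthE; congr (limn _); apply/funext => N.
by apply: eq_bigr => n _; rewrite !termE expi_phase_periodic.
Qed.

(** A quadratic remainder divided by t is O(t). In [synth_partial] this takes the place of an
    exchange of limits. *)
Lemma is_derive_quadratic (F : R -> R) (d K : R) :
  (forall t : R, `|F t - F 0 - t * d| <= K * t ^+ 2) -> 0 < K ->
  is_derive (0 : R) 1 F d.
Proof.
move=> H K0.
have h : (fun h : R => h^-1 *: ((F \o shift 0) (h *: (1 : R)) - F 0)) @ 0^' --> d.
  apply/cvgrPdist_le => e e0.
  have he : \forall h \near (0 : R)^', `|h| <= e / K by apply: dnbhs0_le; rewrite divr_gt0.
  have nz : \forall h \near (0 : R)^', h != 0 by exact: nbhs_dnbhs_neq.
  apply: filterS2 he nz => h he h0.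
  rewrite /= addr0 /GRing.scale/= mulr1 distrC.
  have -> : h^-1 * (F h - F 0) - d = h^-1 * (F h - F 0 - h * d) by field.
  rewrite normrM normfV ler_pdivrMl ?normr_gt0//.
  apply: le_trans (H _) _; rewrite -[h ^+ 2]real_normK ?num_real// expr2 mulrCA.
  rewrite ler_wpM2l//.
  by move: he; rewrite ler_pdivlMr// mulrC.
split; first by apply/cvg_ex; exists d; exact: h.
exact/cvg_lim/h.
Qed.

Lemma acvg_rapid c : rapid c -> acvg c. Proof. exact: rapid_summable. Qed.

Definition dcoef (i : 'I_3) c n : R[i] := 'i%C * (kc R i n)%:C%C * c n.

Lemma nc_ikc i n : nc ('i%C * (kc R i n)%:C%C) = `|kc R i n|.
Proof. by rewrite ncM nc_i mul1r nc_real. Qed.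

Lemma rapid_dcoef i c : rapid c -> rapid (dcoef i c).
Proof.
move=> hc; apply: (@rapidM _ (fun n => 'i%C * (kc R i n)%:C%C) c 1 1) => // n.
by rewrite nc_ikc mul1r expr1 kc_le_J.
Qed.

End Synth.

(** * Termwise differentiation and the convolution theorem *)

Section SynthCalculus.
Variable R : realType.
Local Notation nc := (@ComplexField.Normc.normc R).
Implicit Types (n m k : freq) (c d : freq -> R[i]) (f g : point R -> R) (x : point R).

(** [synth] keeps only real parts, so it determines its coefficients only among Hermitian
    families. *)
Definition conj_sym c := forall n, c (- n) = (c n)^*%C.

(** The remainder of each term is at most 2 t^2 (1 + |k|)^2 |c_k|, which is summable by rapid decay;
    the bound on partial sums is uniform in N and passes to the limit. *)
Lemma synth_partial c (i : 'I_3) x : rapid c ->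
  derivable (synth c) x (basis_vec R i) /\ partial i (synth c) x = synth (dcoef i c) x.
Proof.
move=> hc; apply: directional.
have hJ : acvg (fun n => ((japanese R n) ^+ 2)%:C%C * c n).
  apply/acvg_rapid/(@rapidM _ _ _ 2 1) => // n.
  by rewrite nc_real mul1r ger0_norm// exprn_ge0// J_ge0.
set W := total (fun n => nc (((japanese R n) ^+ 2)%:C%C * c n)).
have W0 : 0 <= W by rewrite fine_ge0//; apply: esum_ge0 => n _; rewrite lee_fin nc_ge0.
(* The summand 1 only makes the constant positive. *)
apply: (@is_derive_quadratic _ _ _ (2 * W + 1)); last by lra.
move=> t; rewrite scale0r addr0.
have c1 := @synth_cvg _ c (x + t *: basis_vec R i) (acvg_rapid hc).
have c2 := @synth_cvg _ c x (acvg_rapid hc).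
have c3 := @synth_cvg _ _ x (acvg_rapid (rapid_dcoef i hc)).
have c4 : (fun N => `|psum c N (x + t *: basis_vec R i) - psum c N x - t * psum (dcoef i c) N x|) @ \oo -->
    `|synth c (x + t *: basis_vec R i) - synth c x - t * synth (dcoef i c) x|.
  by apply: cvg_norm; apply: cvgB; [exact: cvgB|apply: cvgM => //; exact: cvg_cst].
have c5 : (fun _ : nat => (2 * W + 1) * t ^+ 2) @ \oo --> (2 * W + 1) * t ^+ 2 by exact: cvg_cst.
apply: (ler_cvg_to c4 c5).
apply: nearW => N /=.
rewrite /psum mulr_sumr -!sumrB; apply: le_trans (ler_norm_sum _ _ _) _.
apply: (@le_trans _ _ (2 * t ^+ 2 * \sum_(n <- box N) nc (((japanese R n) ^+ 2)%:C%C * c n))).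
  rewrite mulr_sumr; apply: ler_sum => n _.
  rewrite !termE phase_shift expiD.
  set z := expi (phase n x); set w := t * kc R i n.
  have -> : complex.Re (c n * (z * expi w)) - complex.Re (c n * z) - t * complex.Re (dcoef i c n * z) =
    complex.Re (c n * z * (expi w - 1 - 'i%C * w%:C%C)).
    rewrite /dcoef /w; case: (c n) => a b; case: z => u v; case: (expi _) => p q /=; ring.
  apply: le_trans (nc_Re _) _; rewrite !ncM nc_expi mulr1 nc_real.
  rewrite [X in _ <= _ * X]mulrC mulrCA; apply: ler_wpM2l; first exact: nc_ge0.
  apply: le_trans (expi_taylor _) _; rewrite /w exprMn mulrA.
  apply: ler_wpM2l; first by rewrite mulr_ge0 ?sqr_ge0.
  rewrite ger0_norm ?exprn_ge0 ?J_ge0// -[kc _ _ _ ^+ 2]real_normK ?num_real//.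
  by rewrite lerXn2r ?nnegrE ?J_ge0// kc_le_J.
have : \sum_(n <- box N) nc (((japanese R n) ^+ 2)%:C%C * c n) <= W.
  rewrite -lee_fin totalE//; last by move=> n; exact: nc_ge0.
  by rewrite -sumEFin; apply: sum_le_esum; [move=> n; rewrite lee_fin nc_ge0|exact: box_uniq].
have := sqr_ge0 t; set S := \sum_(n <- _) _ => t2 SW.
have := ler_wpM2l t2 SW; nra.
Qed.

Lemma synth_smooth c : rapid c -> torus_smooth (synth c).
Proof.
move=> hc; apply/torus_smoothP; split; first by move=> i; exact: synth_periodic.
move=> k; elim: k c hc => [|k IH] c hc; first by split => //; exact/synth_continuous/acvg_rapid.
split; first exact/synth_continuous/acvg_rapid.
move=> i; split; first by move=> x; have [] := synth_partial i x hc.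
rewrite (_ : partial i _ = synth (dcoef i c)); first exact/IH/rapid_dcoef.
by apply/funext => x; have [] := synth_partial i x hc.
Qed.

Lemma cosw_waves n k x : cosw k x * cosw n x = 2^-1 * (cosw (k - n) x + cosw (k + n) x).
Proof. rewrite /cosw !phaseD !phaseN;
  move: (phase k x) (phase n x) => a b; rewrite !cosD cosN sinN; lra. Qed.

Lemma sinw_cosw n k x : sinw k x * cosw n x = 2^-1 * (sinw (k - n) x + sinw (k + n) x).
Proof. rewrite /cosw /sinw !phaseD !phaseN;
  move: (phase k x) (phase n x) => a b; rewrite !sinD cosN sinN; lra. Qed.

Lemma cosw_sinw n k x : cosw k x * sinw n x = 2^-1 * (sinw (k + n) x - sinw (k - n) x).
Proof. rewrite /cosw /sinw !phaseD !phaseN;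
  move: (phase k x) (phase n x) => a b; rewrite !sinD cosN sinN; lra. Qed.

Lemma sinw_sinw n k x : sinw k x * sinw n x = 2^-1 * (cosw (k - n) x - cosw (k + n) x).
Proof. rewrite /cosw /sinw !phaseD !phaseN;
  move: (phase k x) (phase n x) => a b; rewrite !cosD cosN sinN; lra. Qed.

Lemma mean_lin f g (a b : R) : continuous f -> continuous g ->
  mean (fun x => a * f x + b * g x) = a * mean f + b * mean g.
Proof.
move=> cf cg; rewrite -!meanZ// -meanD//.
- exact: (continuousM3 (@continuous_cst3 R a)).
- exact: (continuousM3 (@continuous_cst3 R b)).
Qed.

(** A real term is half the sum of a wave and its conjugate, so the frequency is shifted both
    ways. *)
Lemma fourier_term f c n k : continuous f ->
  fourier (fun x => f x * term c n x) k =
  (2^-1)%:C%C * (c n * fourier f (k - n) + (c n)^*%C * fourier f (k + n)).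
Proof.
move=> cf; have ct := @term_continuous R c n.
have cc j : continuous (fun x => cosw j x * f x) by apply: continuousM3 => //; exact: cosw_continuous.
have cs j : continuous (fun x => sinw j x * f x) by apply: continuousM3 => //; exact: sinw_continuous.
rewrite !fourierE//; last exact: continuousM3.
set a := complex.Re (c n); set b := complex.Im (c n).
have -> : mean (fun x => cosw k x * (f x * term c n x)) =
    (2^-1 * a * mean (fun x => cosw (k - n) x * f x) + 2^-1 * a * mean (fun x => cosw (k + n) x * f x)) +
    (2^-1 * b * mean (fun x => sinw (k - n) x * f x) + - (2^-1 * b) * mean (fun x => sinw (k + n) x * f x)).
  rewrite -!mean_lin// -meanD; last 2 first.
  - by apply: continuousD3; apply: continuousM3 => //; exact: continuous_cst3.
  - by apply: continuousD3; apply: continuousM3 => //; exact: continuous_cst3.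
  apply: eq_mean => x; rewrite /term -/a -/b.
  transitivity (f x * (a * (cosw k x * cosw n x) - b * (cosw k x * sinw n x))); first by ring.
  by rewrite cosw_waves cosw_sinw; ring.
have -> : mean (fun x => sinw k x * (f x * term c n x)) =
    (2^-1 * a * mean (fun x => sinw (k - n) x * f x) + 2^-1 * a * mean (fun x => sinw (k + n) x * f x)) +
    (- (2^-1 * b) * mean (fun x => cosw (k - n) x * f x) + 2^-1 * b * mean (fun x => cosw (k + n) x * f x)).
  rewrite -!mean_lin// -meanD; last 2 first.
  - by apply: continuousD3; apply: continuousM3 => //; exact: continuous_cst3.
  - by apply: continuousD3; apply: continuousM3 => //; exact: continuous_cst3.
  apply: eq_mean => x; rewrite /term -/a -/b.
  transitivity (f x * (a * (sinw k x * cosw n x) - b * (sinw k x * sinw n x))); first by ring.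
  by rewrite sinw_cosw sinw_sinw; ring.
have -> : c n = Complex a b by rewrite /a /b; case: (c n).
by simpc; congr Complex; ring.
Qed.

Lemma box_opp (V : nmodType) N (F : freq -> V) :
  \sum_(n <- box N) F (- n) = \sum_(n <- box N) F n.
Proof.
rewrite -(big_map (fun n => - n) xpredT F); apply/perm_big/uniq_perm.
- by rewrite map_inj_uniq ?box_uniq//; exact: oppr_inj.
- exact: box_uniq.
move=> n; rewrite -[n]opprK (mem_map (@oppr_inj _)) !mem_box /=.
by rewrite !abszN.
Qed.

(** Under n -> - n the conjugate terms turn into the other ones, which absorbs the factor 1/2 of
    [fourier_term]. *)
Lemma fourier_psum f c N k : continuous f -> conj_sym c ->
  fourier (fun x => f x * psum c N x) k = \sum_(n <- box N) c n * fourier f (k - n).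
Proof.
move=> cf cs; rewrite /psum; under eq_fun do rewrite mulr_sumr.
rewrite fourier_sum; last by move=> n; apply: continuousM3 => //; exact: term_continuous.
under eq_bigr do rewrite fourier_term//.
rewrite -mulr_sumr big_split/=.
have -> : \sum_(n <- box N) (c n)^*%C * fourier f (k + n) = \sum_(n <- box N) c n * fourier f (k - n).
  rewrite -[RHS]box_opp; apply: eq_bigr => n _; by rewrite cs opprK.
rewrite mulrDr -mulrDl -rmorphD/= (_ : 2^-1 + 2^-1 = 1 :> R); last by lra.
by rewrite rmorph1 mul1r.
Qed.

Lemma fourier_norm_le f (M : R) k : continuous f -> (forall x, unit_cube x -> `|f x| <= M) ->
  nc (fourier f k) <= 2 * M.
Proof.
move=> cf fM; rewrite fourierE//; apply: le_trans (nc_le _) _ => /=.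
rewrite mulr_natl mulr2n normrN; apply: lerD; apply: mean_norm_le.
- by apply: continuousM3 => //; exact: cosw_continuous.
- move=> x /fM h; rewrite normrM -[leRHS]mul1r; apply: ler_pM => //.
  by rewrite ler_norml cos_geN1 cos_le1.
- by apply: continuousM3 => //; exact: sinw_continuous.
- by move=> x /fM h; rewrite normrM -[leRHS]mul1r; apply: ler_pM => //; exact: sin_max.
Qed.

(** The difference is a coefficient of f (synth c - psum c N), and the second factor is at most
    [tail c N] everywhere: uniform convergence of one factor suffices. *)
Lemma fourier_mul_synth f c k : continuous f -> conj_sym c -> acvg c ->
  (fun N => nc (fourier (fun x => f x * synth c x) k - \sum_(n <- box N) c n * fourier f (k - n)))
    @ \oo --> 0.
Proof.
move=> cf cs hc; have [M0 [Mr HM]] := cube_bounded cf.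
pose M := M0 + 1.
have fM x : unit_cube x -> `|f x| <= M by move=> Cx; apply: HM => //; rewrite ltrDl.
have Mge0 : 0 <= M.
  by apply: le_trans (fM (0, 0, 0) _) => //; rewrite /unit_cube/= !in_itv/= !lexx !ler01.
have cS := synth_continuous hc.
have H N : nc (fourier (fun x => f x * synth c x) k - \sum_(n <- box N) c n * fourier f (k - n))
    <= 2 * M * tail c N.
  have -> : fourier (fun x => f x * synth c x) k - \sum_(n <- box N) c n * fourier f (k - n) =
     fourier (fun x => f x * synth c x + (-1) * (f x * psum c N x)) k.
    have cp : continuous (fun x => f x * psum c N x) by apply: continuousM3 => //; exact: psum_continuous.
    rewrite fourierD; [|exact: continuousM3|exact: (continuousM3 (@continuous_cst3 R (-1)))].
    by rewrite fourierZ// fourier_psum// rmorphN rmorph1 mulN1r.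
  rewrite -mulrA; apply: fourier_norm_le.
    apply: continuousD3; first exact: continuousM3.
    apply: (continuousM3 (@continuous_cst3 R (-1))); apply: continuousM3 => //; exact: psum_continuous.
  move=> x /fM h; rewrite mulN1r -mulrBr normrM ler_pM//; exact: synth_tail.
apply: (@squeeze_cvgr _ _ _ _ (fun=> 0) (fun N => 2 * M * tail c N)).
- by apply: nearW => N; rewrite nc_ge0 H.
- exact: cvg_cst.
- by rewrite -[X in _ --> X](mulr0 (2 * M)); apply: cvgM; [exact: cvg_cst|exact: tail_cvg].
Qed.

(** For n <> 0 some k_i is nonzero, and up to the factor k_i the wave is a partial derivative. *)
Lemma mean_waves n : mean (@cosw R n) = (n == 0)%:R /\ mean (@sinw R n) = 0.
Proof.
have [->|n0] := eqVneq n 0.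
  have p0 x : phase 0 x = 0 :> R by rewrite /phase /dot3 /wave/=; ring.
  under eq_mean do rewrite /cosw p0 cos0.
  rewrite mean_cst; split => //.
  by under eq_mean do rewrite /sinw p0 sin0; rewrite mean_cst.
have [i ki] : exists i, kc R i n != 0.
  have pi0 : 2 * pi != 0 :> R by rewrite gt_eqF// mulr_gt0 ?pi_gt0.
  have h i : idx i n != 0 -> kc R i n != 0 by move=> ?; rewrite mulf_neq0// intr_eq0.
  have [e1|] := eqVneq (idx i0 n) 0; last by exists i0; exact: h.
  have [e2|] := eqVneq (idx i1 n) 0; last by exists i1; exact: h.
  have [e3|] := eqVneq (idx vert n) 0; last by exists vert; exact: h.
  by move: n0; case: n e1 e2 e3 h => -[a b] c; rewrite /idx/= => -> -> ->; rewrite eqxx.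
have [sc ss] := @smooth_waves R n.
have cc := smooth_continuous sc; have cs := smooth_continuous ss.
split.
  have := @mean_partial R _ i cs (fun x => @smooth_derivable R _ i x ss)
    (smooth_continuous (smooth_partial i ss)) (ss.1 i).
  rewrite (_ : partial i _ = fun x => kc R i n * cosw n x); last first.
    by apply/funext => x; have [_ ->] := sinw_partial n i x.
  by rewrite meanZ// => /eqP; rewrite mulf_eq0 (negbTE ki)/= => /eqP.
have := @mean_partial R _ i cc (fun x => @smooth_derivable R _ i x sc)
  (smooth_continuous (smooth_partial i sc)) (sc.1 i).
rewrite (_ : partial i _ = fun x => - kc R i n * sinw n x); last first.
  by apply/funext => x; have [_ ->] := cosw_partial n i x; rewrite mulNr.
by rewrite meanZ// => /eqP; rewrite mulf_eq0 oppr_eq0 (negbTE ki)/= => /eqP.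
Qed.

Lemma fourier_one n : fourier (fun=> 1 : R) n = (n == 0)%:R.
Proof.
have [mc ms] := mean_waves n.
rewrite fourierE; last exact: continuous_cst3.
have -> : mean (fun x => cosw n x * (1 : R)) = (n == 0)%:R.
  by rewrite -mc; apply: eq_mean => x; rewrite mulr1.
have -> : mean (fun x => sinw n x * (1 : R)) = 0.
  by rewrite -ms; apply: eq_mean => x; rewrite mulr1.
by rewrite oppr0; case: eqP.
Qed.

Lemma mean_fourier0 f : continuous f -> mean f = complex.Re (fourier f 0).
Proof.
move=> cf; rewrite fourierE//=; apply: eq_mean => x.
have -> : cosw 0 x = 1 :> R.
  by rewrite /cosw (_ : phase 0 x = 0) ?cos0//; rewrite /phase /dot3 /wave/=; ring.
by rewrite mul1r.
Qed.

Lemma cvg_unique_eventually (u : nat -> R) (l : R) N :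
  (forall M, (N <= M)%N -> u M = l) -> u @ \oo --> 0 -> l = 0.
Proof.
move=> ul cu; have cl : u @ \oo --> l.
  apply: cvg_near_cst; exists N => // M /= NM; exact: ul.
exact: (cvg_unique _ cl cu).
Qed.

(** [fourier_mul_synth] with f = 1: the partial sums equal c_n as soon as the box contains n, so the
    sequence tending to 0 is eventually constant. *)
Lemma fourier_synth c n : conj_sym c -> rapid c -> fourier (synth c) n = c n.
Proof.
move=> cs hc.
have := fourier_mul_synth n (@continuous_cst3 R 1) cs (acvg_rapid hc).
have -> : (fun x => 1 * synth c x) = synth c by apply/funext => x; rewrite mul1r.
have [N HN] := seq_sub_box [:: n].
move=> /(@cvg_unique_eventually _ (nc (fourier (synth c) n - c n)) N) h.
apply/eqP; rewrite -subr_eq0; apply/eqP/(@ComplexField.Normc.eq0_normc R)/h => M NM.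
congr (nc (_ - _)); rewrite (bigD1_seq n) ?box_uniq//=; last first.
  by apply: (box_sub NM); apply: HN; rewrite inE.
rewrite subrr fourier_one eqxx mulr1 big1 ?addr0// => m mn.
by rewrite fourier_one subr_eq0 eq_sym (negbTE mn) mulr0.
Qed.

End SynthCalculus.

(** * Uniqueness of Fourier coefficients and inversion *)

Section Uniqueness.
Variable R : realType.
Local Notation nc := (@ComplexField.Normc.normc R).
Local Notation mu := (@lebesgue_measure R).
Implicit Types (n m k : freq) (c d : freq -> R[i]) (f g : point R -> R) (x a : point R).

(** Evenness and the reflection s -> 1 - s reduce to r <= s <= 1/2, where the cosine decreases. *)
Lemma cos_le_away (r s : R) : 0 < r <= 2^-1 -> r <= `|s| <= 1 - r ->
  cos (2 * pi * s) <= cos (2 * pi * r).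
Proof.
move=> /andP[r0 r2]; have p0 := @pi_gt0 R.
have main (t : R) : r <= t <= 2^-1 -> cos (2 * pi * t) <= cos (2 * pi * r).
  move=> /andP[rt t2]; have [->//|tr] := eqVneq t r.
  apply: ltW; rewrite ltr_cos ?in_itv/=.
  - rewrite ltr_pM2l ?lt_def ?tr//; lra.
  - apply/andP; split; first by rewrite !mulr_ge0//; lra.
    by rewrite mulrAC ler_piMl ?pi_ge0//; lra.
  - apply/andP; split; first by rewrite !mulr_ge0//; lra.
    by rewrite mulrAC ler_piMl ?pi_ge0//; lra.
move=> /andP[rs s1]; have -> : cos (2 * pi * s) = cos (2 * pi * `|s|).
  by rewrite -[LHS]cos_norm normrM ger0_norm// mulr_ge0// ltW.
have [h|h] := leP `|s| 2^-1; first by apply: main; rewrite rs.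
have -> : cos (2 * pi * `|s|) = cos (2 * pi * (1 - `|s|)).
  have := @expi_2piM R 1; rewrite mulr1z mulr1 /expi => -[c1 s1'].
  by rewrite mulrBr mulr1 cosB c1 s1' mul1r mul0r addr0.
by apply: main; apply/andP; split; lra.
Qed.

Lemma cos_lt1_away (r : R) : 0 < r <= 2^-1 -> cos (2 * pi * r) < 1.
Proof.
move=> /andP[r0 r2]; have p0 := @pi_gt0 R; rewrite -[ltRHS]cos0 ltr_cos ?in_itv/=.
- by rewrite !mulr_gt0.
- by rewrite lexx ltW.
- apply/andP; split; first by rewrite !mulr_ge0// ltW.
  by rewrite mulrAC ler_piMl ?pi_ge0//; lra.
Qed.

Definition unit_freq (i : 'I_3) : freq :=
  ((i == 0%N :> nat)%:R, (i == 1%N :> nat)%:R, (i == 2%N :> nat)%:R).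

Definition crd (i : 'I_3) x : R :=
  match nat_of_ord i with 0%N => x.1.1 | 1%N => x.1.2 | _ => x.2 end.

Lemma phase_unit i x : phase (unit_freq i) x = 2 * pi * crd i x.
Proof.
case: i => -[|[|[|//]]] i3; rewrite /phase /dot3 /wave /crd /unit_freq/=; ring.
Qed.

Definition bump a (i : 'I_3) x : R := 2^-1 * (1 + cos (2 * pi * (crd i x - crd i a))).

Definition kern a x : R := bump a i0 x * bump a i1 x * bump a vert x.

Lemma bump_itv a i x : 0 <= bump a i x <= 1.
Proof.
by rewrite /bump; set t := 2 * pi * _; have := cos_geN1 t; have := cos_le1 t; lra.
Qed.

Lemma bump_term a i : exists c, forall x, bump a i x = 2^-1 * (1 + term c (unit_freq i) x).
Proof.
exists (fun=> Complex (cosw (unit_freq i) a) (- sinw (unit_freq i) a)) => x.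
by rewrite /bump /term /= mulrBr cosB /cosw /sinw !phase_unit; ring.
Qed.

Definition fnull g := continuous g /\ forall k, fourier g k = 0.

(** Multiplication by a wave shifts coefficients, so the vanishing of all of them is preserved. *)
Lemma fnull_bump a i g : fnull g -> fnull (fun x => g x * bump a i x).
Proof.
move=> [cg g0]; have [c bc] := bump_term a i.
have e : (fun x => g x * bump a i x) = (fun x => 2^-1 * (g x + g x * term c (unit_freq i) x)).
  by apply/funext => x; rewrite bc; ring.
have ct : continuous (fun x => g x * term c (unit_freq i) x).
  by apply: continuousM3 => //; exact: term_continuous.
rewrite e; split; first by apply: (continuousM3 (@continuous_cst3 R 2^-1)); exact: continuousD3.
move=> k; rewrite fourierZ; last exact: continuousD3.
by rewrite fourierD// fourier_term// !g0 !(mulr0, addr0).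
Qed.

Lemma fnull_kern a g N : fnull g -> fnull (fun x => g x * kern a x ^+ N).
Proof.
move=> g0; elim: N => [|N IH].
  by rewrite (_ : (fun x => _) = g)//; apply/funext => x; rewrite mulr1.
rewrite (_ : (fun x => _) = fun x => g x * kern a x ^+ N * bump a i0 x * bump a i1 x * bump a vert x).
  by do 3 apply: fnull_bump.
by apply/funext => x; rewrite exprSr /kern; ring.
Qed.

Lemma bump_continuous a i : continuous (bump a i).
Proof.
have [c bc] := bump_term a i.
rewrite (_ : bump a i = fun x => 2^-1 * (1 + term c (unit_freq i) x)); last exact/funext.
apply: (continuousM3 (@continuous_cst3 R 2^-1)).
by apply: (continuousD3 (@continuous_cst3 R 1)); exact: term_continuous.
Qed.

Lemma kern_continuous a : continuous (kern a).
Proof.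
by apply: continuousM3; [apply: continuousM3|]; exact: bump_continuous.
Qed.

Lemma kern_center a : kern a a = 1.
Proof. by rewrite /kern /bump !subrr !mulr0 cos0; field. Qed.

Lemma kern_itv a x : 0 <= kern a x <= 1.
Proof.
have /andP[a0 b0] := bump_itv a i0 x; have /andP[a1 b1] := bump_itv a i1 x.
have /andP[a2 b2] := bump_itv a vert x.
rewrite /kern; apply/andP; split; first exact: (mulr_ge0 (mulr_ge0 _ _)).
exact: (mulr_ile1 (mulr_ge0 a0 a1) a2 (mulr_ile1 a0 a1 b0 b1) b2).
Qed.

Lemma kern_away a x (r : R) i : 0 < r <= 2^-1 -> r <= `|crd i x - crd i a| <= 1 - r ->
  kern a x <= 2^-1 * (1 + cos (2 * pi * r)).
Proof.
move=> r0 hr.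
have h : bump a i x <= 2^-1 * (1 + cos (2 * pi * r)).
  by rewrite /bump ler_wpM2l ?invr_ge0// lerD2l cos_le_away.
have /andP[a0 b0] := bump_itv a i0 x; have /andP[a1 b1] := bump_itv a i1 x.
have /andP[a2 b2] := bump_itv a vert x.
apply: le_trans h; rewrite /kern.
case: i {hr} => -[|[|[|//]]] i3.
- rewrite (_ : Ordinal i3 = i0); last exact: val_inj.
  by rewrite -mulrA ler_piMr// mulr_ile1.
- rewrite (_ : Ordinal i3 = i1); last exact: val_inj.
  by rewrite mulrAC ler_piMl// mulr_ile1.
- rewrite (_ : Ordinal i3 = vert); last exact: val_inj.
  by rewrite ler_piMl// mulr_ile1.
Qed.

Definition small_box a (r : R) : set (point R) :=
  (`]a.1.1 - r, a.1.1 + r[ `*` `]a.1.2 - r, a.1.2 + r[) `*` `]a.2 - r, a.2 + r[.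

Lemma small_boxP a r x : small_box a r x <-> forall i, `|crd i x - crd i a| < r.
Proof.
rewrite /small_box/= !in_itv/=; split.
  move=> [[/andP[? ?] /andP[? ?]] /andP[? ?]] -[[|[|[|//]]] i3]; rewrite /crd/= ltr_norml; lra.
move=> h; have := h i0; have := h i1; have := h vert; rewrite /crd/= !ltr_norml.
by move=> /andP[? ?] /andP[? ?] /andP[? ?]; do !split; lra.
Qed.

Lemma nbhs_small_box a (P : set (point R)) : nbhs a P ->
  exists2 r : R, 0 < r & small_box a r `<=` P.
Proof.
move=> /nbhs_ballP[r /= r0 rP]; exists r => // x /small_boxP h; apply: rP.
have := h i0; have := h i1; have := h vert; rewrite /crd/=.
by rewrite !(distrC _ (a.1.1)) !(distrC _ a.1.2) !(distrC _ a.2) => h2 h1 h0; split; [split|].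
Qed.

Lemma measurable_small_box a (r : R) : measurable (small_box a r : set (measurable_space R)).
Proof. by apply: measurableX; [apply: measurableX|]; exact: measurable_itv. Qed.

Lemma leb3_small_box a (r : R) : 0 < r -> leb3 R (small_box a r) = ((2 * r) ^+ 3)%:E.
Proof.
move=> r0.
have m (z : R) : measurable (`]z - r, z + r[%classic : set (measurableTypeR R)) by exact: measurable_itv.
have l (z : R) : mu (`]z - r, z + r[%classic : set (measurableTypeR R)) = (2 * r)%:E.
  rewrite lebesgue_measure_itv/= lte_fin ifT; last by lra.
  by rewrite -EFinB; congr EFin; ring.
apply: (etrans (@product_measure1E _ _ _ _ _ (mu \x mu)%E mu _ _ _ (m a.2))).
  by apply: measurableX; exact: m.
apply: (etrans (congr2 mule (@product_measure1E _ _ _ _ _ mu mu _ _ (m a.1.1) (m a.1.2)) (l a.2))).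
rewrite (etrans (congr2 mule (congr2 mule (l a.1.1) (l a.1.2)) (erefl _)) (erefl _)).
by rewrite -!EFinM; congr EFin; ring.
Qed.

Lemma mean_ge_box g a (r M : R) : continuous g -> (forall x, 0 <= g x) -> 0 < r -> 0 <= M ->
  small_box a r `<=` @unit_cube R -> (forall x, small_box a r x -> M <= g x) ->
  M * (2 * r) ^+ 3 <= mean g.
Proof.
move=> cg g0 r0 M0 bC gM; rewrite /mean /Rintegral.
have mg (A : set (measurable_space R)) : measurable A -> measurable_fun A (g : measurable_space R -> R).
  move=> mA; apply: (@measurable_funS _ _ _ _ setT) => //; exact: continuous_measurable3.
have fin : (\int[leb3 R]_(x in @unit_cube R) (g x)%:E)%E \is a fin_num.
  exact: (integrable_fin_num (@measurable_unit_cube R) (cube_integrable cg)).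
rewrite -lee_fin fineK//.
apply: (@le_trans _ _ (\int[leb3 R]_(x in small_box a r) (g x)%:E)%E); last first.
  apply: ge0_subset_integral => //.
  - exact: measurable_small_box.
  - exact: measurable_unit_cube.
  - by apply/measurable_realfun.measurable_EFinP; exact: (mg _ (@measurable_unit_cube R)).
  - by move=> x _; rewrite lee_fin.
rewrite EFinM -(leb3_small_box a r0) -integral_cst; last exact: measurable_small_box.
apply: ge0_le_integral.
- exact: measurable_small_box.
- by move=> x _; rewrite lee_fin.
- exact: measurable_cst.
- by apply/measurable_realfun.measurable_EFinP; exact: (mg _ (@measurable_small_box a r)).
- by move=> x bx; rewrite lee_fin; exact: gM.
Qed.

(** If f(a) > 0, then f >= [del] on a box of radius r, while the kernel is at most [rho] on the rest
    of the cube and at least [rho'] > [rho] on a smaller box. Orthogonality to its N-th power bounds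
    [rho']^N by a constant times [rho]^N, which fails for large N. *)
Lemma fnull_interior_le0 f a : fnull f ->
  0 < a.1.1 < 1 -> 0 < a.1.2 < 1 -> 0 < a.2 < 1 -> f a <= 0.
Proof.
move=> f0 a1 a2 a3; have cf := f0.1; rewrite leNgt; apply/negP => fa.
pose del := f a / 2; have del0 : 0 < del by rewrite divr_gt0.
have [r1 r10 fr1] : exists2 r, 0 < r & small_box a r `<=` [set x | del <= f x].
  apply: nbhs_small_box; have /cvgrPdist_le/(_ _ del0) := cf a.
  by apply: filterS => x /=; rewrite ler_norml /del; lra.
(* [r] is also at most the distance from [a] to the faces, so |x_i - a_i| <= 1 - r on the cube and
   the periodic copies of the peak are avoided. *)
pose r := Num.min r1 (Num.min (Num.min a.1.1 (1 - a.1.1))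
  (Num.min (Num.min a.1.2 (1 - a.1.2)) (Num.min a.2 (1 - a.2)))).
have r0 : 0 < r by rewrite /r !lt_min r10; lra.
have rle i : r <= crd i a /\ r <= 1 - crd i a.
  by case: i => -[|[|[|//]]] ?; rewrite /crd/= /r !ge_min !lexx !orbT.
have rr1 : r <= r1 by rewrite /r ge_min lexx.
have r2 : 0 < r <= 2^-1 by rewrite r0/=; have [] := rle i0; lra.
pose rho := 2^-1 * (1 + cos (2 * pi * r)).
have rho0 : 0 <= rho by rewrite /rho; have := cos_geN1 (2 * pi * r); lra.
have rho1 : rho < 1 by rewrite /rho; have := cos_lt1_away r2; lra.
pose rho' := (1 + rho) / 2.
have [r3 r30 kr3] : exists2 r, 0 < r & small_box a r `<=` [set x | rho' <= kern a x].
  apply: nbhs_small_box; have e0 : 0 < (1 - rho) / 2 by lra.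
  have /cvgrPdist_le/(_ _ e0) := @kern_continuous a a.
  by apply: filterS => x /=; rewrite kern_center ler_norml /rho'; lra.
pose q := Num.min r r3; have q0 : 0 < q by rewrite lt_min r0.
have [M0 [Mr HM]] := cube_bounded cf.
pose M := M0 + 1.
have fM x : unit_cube x -> `|f x| <= M by move=> Cx; apply: HM => //; rewrite ltrDl.
have inC x : unit_cube x -> forall i, 0 <= crd i x <= 1.
  by move=> [[]] /=; rewrite !in_itv/= => ? ? ? [[|[|[|//]]] ?]; rewrite /crd.
have bC : small_box a q `<=` @unit_cube R.
  move=> x /small_boxP h.
  have hh i : 0 <= crd i x <= 1.
    have := h i; rewrite ltr_norml /q => hi; have [? ?] := rle i.
    have : q <= r by rewrite /q ge_min lexx.
    by rewrite /q; lra.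
  have := hh i0; have := hh i1; have := hh vert; rewrite /crd/= => ? ? ?.
  by split; [split|] => /=; rewrite in_itv.
have M00 : 0 <= M.
  apply: le_trans (normr_ge0 _) (fM a _); apply: bC; apply/small_boxP => i.
  by rewrite subrr normr0.
have key N : del * (rho' ^+ N * (2 * q) ^+ 3) <= (M + del) * rho ^+ N.
  have cK : continuous (fun x => kern a x ^+ N).
    move: (@kern_continuous a) => ck; elim: N => [|N IH]; first exact: continuous_cst3.
    by under eq_fun do rewrite exprS; exact: continuousM3.
  have rho'0 : 0 <= rho' by rewrite /rho'; lra.
  have K0 x : 0 <= kern a x ^+ N by rewrite exprn_ge0//; have /andP[] := kern_itv a x.
  have low : rho' ^+ N * (2 * q) ^+ 3 <= mean (fun x => kern a x ^+ N).
    apply: (@mean_ge_box _ a) => //; first by rewrite exprn_ge0.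
    move=> x /small_boxP h; rewrite lerXn2r ?nnegrE//; first by have /andP[] := kern_itv a x.
    apply: kr3; apply/small_boxP => i; apply: lt_le_trans (h i) _.
    by rewrite /q ge_min lexx orbT.
  apply: le_trans (ler_wpM2l (ltW del0) low) _.
  have [cfK fK0] := fnull_kern a N f0.
  have m0 : mean (fun x => f x * kern a x ^+ N) = 0 by rewrite mean_fourier0// fK0.
  have cc := @continuous_cst3 R.
  (* With K = ([kern a])^N, the cube satisfies [del] K <= f K + (M + [del]) [rho]^N: near [a]
     because f >= [del], elsewhere because f >= - M and K <= [rho]^N. The mean of f K is 0. *)
  rewrite -[leRHS]add0r -m0 -[X in _ + X]mean_cst -meanZ// -meanD//.
  apply: le_mean; [exact: (continuousM3 (cc del))|exact: continuousD3|].
  move=> x Cx; have [h|h] := pselect (small_box a r x).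
    rewrite ler_wpDr//; first by rewrite mulr_ge0 ?exprn_ge0//; lra.
    rewrite ler_wpM2r//; apply: fr1; apply/small_boxP => i.
    by move/small_boxP : h => /(_ i) h; exact: lt_le_trans h rr1.
  have [i hi] : exists i, r <= `|crd i x - crd i a|.
    apply: contrapT => hn; apply: h; apply/small_boxP => i; rewrite ltNge; apply/negP => hi.
    by apply: hn; exists i.
  have Kr : kern a x ^+ N <= rho ^+ N.
    rewrite lerXn2r ?nnegrE//; first by have /andP[] := kern_itv a x.
    apply: (kern_away (i := i)) => //; rewrite hi/=.
    have := inC x Cx i; have [? ?] := rle i; rewrite ler_norml; lra.
  have := fM x Cx; rewrite ler_norml => /andP[h1 _].
  have := ler_wpM2r (K0 x) h1.
  have : (M + del) * kern a x ^+ N <= (M + del) * rho ^+ N by rewrite ler_wpM2l//; lra.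
  lra.
have rho'0 : 0 < rho' by rewrite /rho'; lra.
pose V := (2 * q) ^+ 3; have V0 : 0 < V by rewrite exprn_gt0// mulr_gt0.
have c0 : (fun N => (M + del) * (rho / rho') ^+ N) @ \oo --> (M + del) * 0.
  apply: cvgM; first exact: cvg_cst.
  have qq : 0 <= rho / rho' by apply: divr_ge0 => //; exact: ltW.
  have q1 : rho / rho' < 1 by rewrite ltr_pdivrMr// mul1r /rho'; lra.
  by apply: cvg_expr; rewrite ger0_norm.
have : del * V <= (M + del) * 0.
  have cV : (fun _ : nat => del * V) @ \oo --> del * V by exact: cvg_cst.
  apply: (ler_cvg_to cV c0); apply: nearW => N.
  have P : 0 < rho' ^+ N by rewrite exprn_gt0.
  by rewrite expr_div_n [leRHS]mulrA ler_pdivlMr// -mulrA [X in del * X]mulrC; exact: key.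
by rewrite mulr0 leNgt mulr_gt0.
Qed.

Lemma fnull_interior f a : fnull f ->
  0 < a.1.1 < 1 -> 0 < a.1.2 < 1 -> 0 < a.2 < 1 -> f a = 0.
Proof.
move=> f0 a1 a2 a3; apply/le_anti/andP; split; first exact: fnull_interior_le0.
rewrite -oppr_le0; apply: (@fnull_interior_le0 (fun x => - f x)) => //.
split=> [|k]; first exact: (continuousN3 f0.1).
have -> : (fun x => - f x) = (fun x => -1 * f x) by apply/funext => x; rewrite mulN1r.
by rewrite fourierZ ?f0.2 ?mulr0//; exact: f0.1.
Qed.

Lemma periodic_int f (v : point R) (z : int) x : periodic f v -> f (x + v *~ z) = f x.
Proof.
move=> pf; case: z => n; first exact: periodicn.
by rewrite NegzE mulrNz -[in RHS](subrK (v *+ n.+1) x) (periodicn pf n.+1 (x - v *+ n.+1)).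
Qed.

(* For small t > 0 this moves x + t (1, 1, 1) into the open unit cube, so that
   every x is a limit of points that are interior up to periodicity. *)
Lemma diagonal_shift x (t : R) (z1 z2 z3 : int) :
  x + t *: ((1, 1, 1) : point R) =
  (x.1.1 - z1%:~R + t, x.1.2 - z2%:~R + t, x.2 - z3%:~R + t)
    + basis_vec R i0 *~ z1 + basis_vec R i1 *~ z2 + basis_vec R vert *~ z3.
Proof.
have sc (v : point R) (z : int) : v *~ z = z%:~R *: v by rewrite scaler_int.
rewrite !(sc (basis_vec R _)); case: x => -[x1 x2] x3.
rewrite -[LHS]/((x1 + t * 1, x2 + t * 1, x3 + t * 1) : point R).
rewrite -[RHS]/((x1 - z1%:~R + t + z1%:~R * 1 + z2%:~R * 0 + z3%:~R * 0,
  x2 - z2%:~R + t + z1%:~R * 0 + z2%:~R * 1 + z3%:~R * 0,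
  x3 - z3%:~R + t + z1%:~R * 0 + z2%:~R * 0 + z3%:~R * 1) : point R).
by congr (_, _, _); ring.
Qed.

Lemma fnull_eq0 f : fnull f -> (forall i, periodic f (basis_vec R i)) -> f = fun=> 0.
Proof.
move=> f0 pf; apply/funext => x.
have cf := f0.1.
pose y (t : R) : point R := x + t *: (1, 1, 1).
have yc : y @ (0 : R)^'+ --> x.
  apply: cvg_at_right_filter.
  rewrite -[X in _ --> X]addr0 -(scale0r ((1, 1, 1) : point R)).
  by apply: cvgD; [exact: cvg_cst|apply: cvgZr_tmp; exact: cvg_id].
have fyc : (f \o y) @ (0 : R)^'+ --> f x by exact: (cvg_comp _ _ yc (cf x)).
have : (f \o y) @ (0 : R)^'+ --> (0 : R).
  apply: cvg_near_cst.
  (* Fractional parts lie in [0, 1), so adding t with 0 < t < [e] lands strictly inside the cube. *)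
  pose e := Num.min (1 - (x.1.1 - (Num.floor x.1.1)%:~R)) (Num.min (1 - (x.1.2 - (Num.floor x.1.2)%:~R))
     (1 - (x.2 - (Num.floor x.2)%:~R))).
  have fl (t : R) : 0 <= t - (Num.floor t)%:~R < 1.
    by have := floor_itv t; rewrite intrD => /andP[? ?]; lra.
  have e0 : 0 < e.
    by rewrite /e !lt_min; have := fl x.1.1; have := fl x.1.2; have := fl x.2; lra.
  near=> t.
  have t0 : 0 < t by near: t; exact: nbhs_right_gt.
  have te : t < e by near: t; exact: nbhs_right_lt.
  pose a : point R := (x.1.1 - (Num.floor x.1.1)%:~R + t, x.1.2 - (Num.floor x.1.2)%:~R + t,
    x.2 - (Num.floor x.2)%:~R + t).
  have -> : (f \o y) t = f a.
    rewrite /= /y (diagonal_shift x t (Num.floor x.1.1) (Num.floor x.1.2) (Num.floor x.2)).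
    by rewrite (periodic_int _ _ (pf vert)) (periodic_int _ _ (pf i1)) (periodic_int _ _ (pf i0)).
  move: te; rewrite /e !lt_min => /andP[te1 /andP[te2 te3]].
  have := fl x.1.1; have := fl x.1.2; have := fl x.2 => /andP[? ?] /andP[? ?] /andP[? ?].
  by apply: fnull_interior => //=; apply/andP; split; lra.
by move=> c0; exact: (cvg_unique _ fyc c0).
Unshelve. all: by end_near. Qed.

Lemma conj_sym_fourier f : continuous f -> conj_sym (fourier f).
Proof. by move=> cf n; exact: fourier_herm. Qed.

Theorem synth_fourier f : torus_smooth f -> synth (fourier f) = f.
Proof.
move=> sf; have cf := smooth_continuous sf.
have rf := rapid_fourier sf; have hf := conj_sym_fourier cf.
have ss := synth_smooth rf; have cs := smooth_continuous ss.
have h : (fun x => synth (fourier f) x + (-1) * f x) = fun=> 0.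
  apply: fnull_eq0.
    have cf1 : continuous (fun x => -1 * f x) by exact: (continuousM3 (@continuous_cst3 R (-1))).
    split=> [|k]; first exact: continuousD3.
    by rewrite fourierD// fourierZ// fourier_synth// rmorphN rmorph1 mulN1r subrr.
  by move=> i x; rewrite ss.1 sf.1.
apply/funext => x; have := congr1 (fun g : point R -> R => g x) h.
by rewrite /= mulN1r => /eqP; rewrite subr_eq0 => /eqP.
Qed.

End Uniqueness.

(** * The commutator with the hydrostatic Leray projection *)

Section Convolution.
Variable R : realType.
Local Notation nc := (@ComplexField.Normc.normc R).
Local Notation mu := (@lebesgue_measure R).
Implicit Types (n m k l : freq) (c d : freq -> R[i]) (f g : point R -> R) (x a : point R).

(** Convergence along boxes, absolute or not: it is linear in [t] and already yields [boxlim_bound],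
    whose right side may be +oo. *)
Definition boxlim (t : freq -> R[i]) (z : R[i]) :=
  (fun N => nc (z - \sum_(n <- box N) t n)) @ \oo --> (0 : R).

Lemma boxlim_bound (t : freq -> R[i]) z : boxlim t z ->
  ((nc z)%:E <= \esum_(n in [set: freq]) (nc (t n))%:E)%E.
Proof.
move=> tz; have t0 n : (0 <= (nc (t n))%:E)%E by rewrite lee_fin nc_ge0.
have H N : nc z <= nc (z - \sum_(n <- box N) t n) + \sum_(n <- box N) nc (t n).
  rewrite -[X in nc X <= _](subrK (\sum_(n <- box N) t n) z).
  by apply: le_trans (ncD _ _) _; rewrite lerD2l nc_sum.
have HE N : ((\sum_(n <- box N) nc (t n))%:E <= \esum_(n in [set: freq]) (nc (t n))%:E)%E.
  by rewrite -sumEFin; apply: sum_le_esum => //; exact: box_uniq.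
case: (\esum_(n in _) _)%E HE => [T| |] HE; last by have := HE 0%N; rewrite leeNy_eq.
- rewrite lee_fin; have cz : (fun _ : nat => nc z) @ \oo --> nc z by exact: cvg_cst.
  have cT : (fun N => nc (z - \sum_(n <- box N) t n) + T) @ \oo --> 0 + T.
    by apply: cvgD => //; exact: cvg_cst.
  rewrite -[leRHS]add0r; apply: (ler_cvg_to cz cT); apply: nearW => N.
  by apply: le_trans (H N) _; rewrite lerD2l -lee_fin.
- by rewrite leey.
Qed.

Lemma boxlimD t t' z z' : boxlim t z -> boxlim t' z' -> boxlim (fun n => t n + t' n) (z + z').
Proof.
move=> h h'; rewrite /boxlim; apply: (@squeeze_cvgr _ _ _ _ (fun=> 0)
   (fun N => nc (z - \sum_(n <- box N) t n) + nc (z' - \sum_(n <- box N) t' n))).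
- apply: nearW => N; rewrite nc_ge0/= big_split/= opprD addrACA; exact: ncD.
- exact: cvg_cst.
- by rewrite -[X in _ --> X](addr0 0); exact: cvgD.
Qed.

Lemma boxlimZ (a : R[i]) t z : boxlim t z -> boxlim (fun n => a * t n) (a * z).
Proof.
move=> h; rewrite /boxlim (_ : (fun N => _) = (fun N => nc a * nc (z - \sum_(n <- box N) t n))).
  by rewrite -[X in _ --> X](mulr0 (nc a)); apply: cvgM => //; exact: cvg_cst.
by apply/funext => N; rewrite -mulr_sumr -mulrBr ncM.
Qed.

Lemma boxlim0 : boxlim (fun=> 0) 0.
Proof.
rewrite /boxlim (_ : (fun N => _) = (fun=> 0)); first exact: cvg_cst.
by apply/funext => N; rewrite big1 ?subrr ?nc0.
Qed.

Lemma boxlim_sum (I : Type) (r : seq I) (t : I -> freq -> R[i]) (z : I -> R[i]) :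
  (forall i, boxlim (t i) (z i)) ->
  boxlim (fun n => \sum_(i <- r) t i n) (\sum_(i <- r) z i).
Proof.
move=> h; elim: r => [|i r IH].
  rewrite big_nil; under eq_fun do rewrite big_nil; exact: boxlim0.
by rewrite big_cons; under eq_fun do rewrite big_cons; exact: boxlimD.
Qed.

Lemma fourier_mul f g k : torus_smooth f -> torus_smooth g ->
  boxlim (fun n => fourier g n * fourier f (k - n)) (fourier (fun x => f x * g x) k).
Proof.
move=> sf sg; have cf := smooth_continuous sf; have cg := smooth_continuous sg.
have := fourier_mul_synth k cf (conj_sym_fourier cg) (acvg_rapid (rapid_fourier sg)).
by rewrite synth_fourier.
Qed.

Lemma smooth_advect (p : nat) (b : field 3 R) (u : field p R) :
  smooth_field b -> smooth_field u -> smooth_field (advect b u).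
Proof.
move=> sb su j; apply: smooth_sum => i; apply: smoothM; first exact: sb.
exact/smooth_partial/su.
Qed.

Lemma fourier_advect (p : nat) (b : field 3 R) (u : field p R) (j : 'I_p) k :
  smooth_field b -> smooth_field u ->
  boxlim (fun l => \sum_(i < 3) 'i%C * (kc R i l)%:C%C * fourier (u j) l * fourier (b i) (k - l))
    (fourier (advect b u j) k).
Proof.
move=> sb su; rewrite /advect fourier_sum; last first.
  by move=> i; apply: smooth_continuous; apply: smoothM; [exact: sb|exact/smooth_partial/su].
apply: boxlim_sum => i.
under eq_fun do rewrite -(fourier_partial _ _ (su j)).
by apply: fourier_mul; [exact: sb|exact/smooth_partial/su].
Qed.

Lemma div_fourier (b : field 3 R) k : smooth_field b -> divergence_free b ->
  \sum_(i < 3) (kc R i k)%:C%C * fourier (b i) k = 0.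
Proof.
move=> sb db.
have : fourier (fun x => \sum_(i < 3) partial i (b i) x) k = 0.
  rewrite (_ : (fun x => _) = (fun x => 0 * (1 : R))); last first.
    by apply/funext => x; rewrite db mul0r.
  by rewrite fourierZ ?mul0r//; exact: continuous_cst3.
rewrite fourier_sum; last by move=> i; apply: smooth_continuous; exact/smooth_partial/sb.
under eq_bigr do rewrite fourier_partial//.
have -> : \sum_(i < 3) 'i%C * (kc R i k)%:C%C * fourier (b i) k =
  'i%C * \sum_(i < 3) (kc R i k)%:C%C * fourier (b i) k.
  by rewrite mulr_sumr; apply: eq_bigr => i _; rewrite mulrA.
move=> /eqP; rewrite mulf_eq0 => /orP[/eqP/(congr1 nc)|/eqP//].
by rewrite nc_i nc0 => /eqP; rewrite oner_eq0.
Qed.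

Lemma vertical_line x (z : R) :
  ((x.1, 0) : point R) + z *: basis_vec R vert = (x.1, z).
Proof.
case: x => -[x1 x2] x3; rewrite -[LHS]/((x1 + z * 0, x2 + z * 0, 0 + z * 1) : point R).
by congr (_, _, _); ring.
Qed.

Lemma slice_continuous f x : continuous f -> continuous (fun z : R => f (x.1, z)).
Proof.
move=> cf; under eq_fun do rewrite -vertical_line.
exact: continuous_line.
Qed.

Lemma unit_integrable (h : R -> R) : continuous h -> mu.-integrable `[0, 1] (EFin \o h).
Proof.
move=> ch; apply: continuous_compact_integrable; first exact: segment_compact.
exact: continuous_subspaceT.
Qed.

Lemma unit_Rintegral_cst (r : R) : \int[mu]_(z in `[0, 1]) r = r.
Proof.
rewrite Rintegral_cst; last exact: measurable01.
by rewrite -[RHS]mulr1; congr (_ * _); exact: (congr1 fine (lebesgue_unit_interval R)).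
Qed.

Lemma vert_avg_term c n x :
  vert_avg (term c n) x = if n.2 == 0 then term c n x else 0.
Proof.
rewrite /vert_avg; case: eqP => [n0|/eqP n0].
  have e (z : R) : term c n (x.1, z) = term c n x.
    by rewrite !termE /phase /dot3 /wave/= n0 mulr0 !mul0r.
  rewrite (_ : (fun z => _) = fun=> term c n x); last exact/funext.
  by rewrite unit_Rintegral_cst.
pose K := kc R vert n.
have K0 : K != 0 by rewrite mulf_neq0 ?intr_eq0// gt_eqF// mulr_gt0 ?pi_gt0.
pose a := complex.Re (c n); pose b := complex.Im (c n).
(* A vertical antiderivative of [term c n], available since [K] is nonzero; its periodicity makes
   the integral vanish. *)
pose f := fun y => a / K * sinw n y + b / K * cosw n y.
have [sc ss] := @smooth_waves R n.
have sf : torus_smooth f := smoothD (smoothM (smooth_cst _) ss) (smoothM (smooth_cst _) sc).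
have := @line_integral_partial0 R f vert (x.1, 0) (smooth_continuous sf)
  (fun y => @smooth_derivable R f vert y sf) (smooth_continuous (smooth_partial vert sf)) (sf.1 vert).
rewrite /Rintegral => h; rewrite -[RHS]/(fine 0%E) -h; congr fine.
apply: eq_integral => z _; congr EFin.
rewrite vertical_line.
have dM (r : R) (g : point R -> R) y : torus_smooth g ->
    partial vert (fun y => r * g y) y = r * partial vert g y.
  move=> sg; have [_ ->] := partialM (derivable_cst r y (basis_vec R vert)) (@smooth_derivable R g vert y sg).
  by rewrite /partial derive_cst mulr0 addr0.
have [_ ->] := partialD (@smooth_derivable R _ vert (x.1, z) (smoothM (smooth_cst (a / K)) ss))
  (@smooth_derivable R _ vert (x.1, z) (smoothM (smooth_cst (b / K)) sc)).
rewrite !dM//; have [_ ->] := cosw_partial n vert (x.1, z); have [_ ->] := sinw_partial n vert (x.1, z).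
by rewrite /term -/a -/b -/K; field.
Qed.

Lemma vert_avg_psum c N x :
  vert_avg (psum c N) x = psum (fun n => if n.2 == 0 then c n else 0) N x.
Proof.
rewrite /psum; elim: (box N) => [|n s IH].
  rewrite big_nil /vert_avg; under eq_Rintegral do rewrite big_nil.
  exact: unit_Rintegral_cst.
rewrite big_cons -{}IH /vert_avg; under eq_Rintegral do rewrite big_cons.
rewrite RintegralD//; last 2 first.
- by apply: unit_integrable; apply: (@slice_continuous (term c n)); exact: term_continuous.
- apply: unit_integrable; apply: (@slice_continuous (fun y => \sum_(j <- s) term c j y)).
  by have [] := mean_sum s (fun n => @term_continuous R c n).
congr (_ + _); rewrite -[LHS]/(vert_avg (term c n) x) vert_avg_term.
by rewrite /term; case: ifP => // _; rewrite /= !mul0r subrr.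
Qed.

Definition hcoef c n : R[i] := if n.2 == 0 then c n else 0.

Lemma rapid_hcoef c : rapid c -> rapid (hcoef c).
Proof.
move=> hc p; have [C HC] := hc p; exists C => n; rewrite /hcoef; case: ifP => // _.
by rewrite nc0 mulr0; apply: le_trans (HC n); rewrite mulr_ge0 ?nc_ge0// exprn_ge0// J_ge0.
Qed.

(** Partial sums are handled by [vert_avg_psum], and averaging over a unit interval does not
    increase the uniform error [tail c N]. *)
Lemma vert_avg_synth c : rapid c -> vert_avg (synth c) = synth (hcoef c).
Proof.
move=> hc; apply/funext => x; have ac := acvg_rapid hc.
have c1 := @synth_cvg _ _ x (acvg_rapid (rapid_hcoef hc)).
have c2 : (fun N => psum (hcoef c) N x) @ \oo --> vert_avg (synth c) x.
  have H N : `|vert_avg (synth c) x - psum (hcoef c) N x| <= tail c N.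
    rewrite -vert_avg_psum /vert_avg -RintegralB//; last 2 first.
    - by apply: unit_integrable; apply: (@slice_continuous (synth c)); exact: synth_continuous.
    - by apply: unit_integrable; apply: (@slice_continuous (psum c N)); exact: psum_continuous.
    have ci : continuous (fun z : R => synth c (x.1, z) - psum c N (x.1, z)).
      move=> z; apply: cvgB; first exact: (slice_continuous (synth_continuous ac)).
      exact: (slice_continuous (@psum_continuous R c N)).
    apply: le_trans (le_normr_Rintegral _ _) _ => //; first exact: unit_integrable.
    have t1 : tail c N = \int[mu]_(z in `[0, 1]) tail c N.
      by rewrite unit_Rintegral_cst.
    rewrite [leRHS]t1; apply: le_Rintegral => //.
    - by apply: unit_integrable => z; apply: cvg_norm; exact: ci.
    - by apply: unit_integrable => z; exact: cvg_cst.
    - by move=> z _; exact: synth_tail.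
  apply/cvgrPdist_le => e e0; have /cvgrPdist_le/(_ _ e0) := tail_cvg ac.
  apply: filterS => N; rewrite sub0r normrN => h.
  by apply: le_trans (H N) (le_trans (ler_norm _) h).
exact: (cvg_unique _ c2 c1).
Qed.

End Convolution.

(** * The hydrostatic Leray projection in Fourier coefficients *)

Section Leray.
Variable R : realType.
Local Notation nc := (@ComplexField.Normc.normc R).
Implicit Types (n m k l : freq) (c d : freq -> R[i]) (f g : point R -> R) (x a : point R).

Lemma conj_symM (m : freq -> R) c : (forall n, m (- n) = m n) -> conj_sym c ->
  conj_sym (fun n => (m n)%:C%C * c n).
Proof. by move=> hm hc n; rewrite hm hc; case: (c n) => a b; simpc; congr Complex; ring. Qed.

Definition khsq n : R := kc R i0 n ^+ 2 + kc R i1 n ^+ 2.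

Lemma khsqN n : khsq (- n) = khsq n.
Proof. by rewrite /khsq !kcN !sqrrN. Qed.

Lemma khsq_ge0 n : 0 <= khsq n.
Proof. by rewrite addr_ge0 ?sqr_ge0. Qed.

Lemma kc_sqr_ge1 i n : kc R i n != 0 -> 1 <= kc R i n ^+ 2.
Proof.
rewrite /kc mulf_eq0 intr_eq0 negb_or => /andP[_ z0].
have : 1 <= `|2 * pi * (idx i n)%:~R : R|.
  rewrite normrM -(@intr_norm R) -abszE.
  have h1 : 1 <= (Posz `|idx i n|%N)%:~R :> R by rewrite ler1n lt0n absz_eq0.
  rewrite ger0_norm ?mulr_ge0 ?pi_ge0//.
  by have := @pi_ge2 R => h2; have := ler_wpM2l (ltW (ltr01 : 0 < 1 :> R)) h1; nra.
by move=> h; rewrite -real_normK ?num_real// exprn_ege1.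
Qed.

(** Nonzero components of k have modulus at least 2 pi, and at k' = 0 the value is 0^-1 = 0. Hence
    the inverse Laplacian has a bounded symbol. *)
Lemma khsq_inv_le n : (khsq n)^-1 <= 1.
Proof.
have [k0|k0] := eqVneq (kc R i0 n) 0; last first.
  rewrite invf_le1; [|apply: lt_le_trans ltr01 _]; rewrite (le_trans (kc_sqr_ge1 k0))// lerDl sqr_ge0//.
have [k1|k1] := eqVneq (kc R i1 n) 0; last first.
  rewrite invf_le1; [|apply: lt_le_trans ltr01 _]; rewrite (le_trans (kc_sqr_ge1 k1))// lerDr sqr_ge0//.
by rewrite /khsq k0 k1 expr0n /= addr0 invr0 ler01.
Qed.

(* The coefficients of grad_h lap_h^-1 div_h avg(u). *)
Definition pcoef (u : field 2 R) (i : 'I_2) n : R[i] :=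
  dcoef (hor i) (fun n => (- (khsq n)^-1)%:C%C *
    \sum_(j < 2) dcoef (hor j) (hcoef (fourier (u j))) n) n.

Lemma pcoefE u i n : pcoef u i n =
  if n.2 == 0 then (kc R (hor i) n / khsq n)%:C%C * \sum_(j < 2) (kc R (hor j) n)%:C%C * fourier (u j) n
  else 0.
Proof.
rewrite /pcoef /dcoef /hcoef; case: ifP => _; last first.
  by rewrite big1 ?mulr0// => j _; rewrite mulr0.
have -> : \sum_(j < 2) 'i%C * (kc R (hor j) n)%:C%C * fourier (u j) n =
  'i%C * \sum_(j < 2) (kc R (hor j) n)%:C%C * fourier (u j) n.
  by rewrite mulr_sumr; apply: eq_bigr => j _; rewrite mulrA.
case: (\sum_(j < 2) _) => a b; simpc; congr Complex; ring.
Qed.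

Lemma smooth_divavg (u : field 2 R) : smooth_field u ->
  let w := fun y => \sum_(j < 2) partial (hor j) (vert_avg (u j)) y in
  torus_smooth w /\ forall n, fourier w n = \sum_(j < 2) dcoef (hor j) (hcoef (fourier (u j))) n.
Proof.
move=> su w.
have va j : torus_smooth (vert_avg (u j)) /\ forall n, fourier (vert_avg (u j)) n = hcoef (fourier (u j)) n.
  have rj := rapid_fourier (su j); rewrite -{1 2}(synth_fourier (su j)) vert_avg_synth//.
  have rh := rapid_hcoef rj; split; first exact: synth_smooth.
  move=> n; apply: fourier_synth => // k; rewrite /hcoef /= oppr_eq0.
  by case: ifP => _; rewrite ?conjc0// conj_sym_fourier//; exact/smooth_continuous/su.
have sp j : torus_smooth (partial (hor j) (vert_avg (u j))) by apply: smooth_partial; have [] := va j.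
split; first exact: smooth_sum.
move=> n; rewrite /w fourier_sum; last by move=> j; exact: smooth_continuous.
apply: eq_bigr => j _; have [sv fv] := va j.
by rewrite fourier_partial// fv.
Qed.

Lemma hydro_leray_fourier (u : field 2 R) i : smooth_field u ->
  torus_smooth (hydro_leray u i) /\
  forall n, fourier (hydro_leray u i) n = fourier (u i) n - pcoef u i n.
Proof.
move=> su; have [sw fw] := smooth_divavg su.
set w := (fun y => _) in sw fw.
pose m n : R := - (khsq n)^-1.
have rw : rapid (fun n => (m n)%:C%C * fourier w n).
  apply: (@rapidM _ _ _ 0 1) (rapid_fourier sw) => n.
  by rewrite nc_real expr0 mulr1 normrN ger0_norm ?khsq_inv_le// invr_ge0 khsq_ge0.
have cw : conj_sym (fun n => (m n)%:C%C * fourier w n).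
  apply: conj_symM; first by move=> n; rewrite /m khsqN.
  exact/conj_sym_fourier/smooth_continuous.
have hl : hydro_leray u i =
    fun x => u i x + (-1) * partial (hor i) (synth (fun n => (m n)%:C%C * fourier w n)) x.
  by apply/funext => x; rewrite mulN1r.
have ss := synth_smooth rw; have sp := smooth_partial (hor i) ss.
rewrite hl; split.
  exact: (smoothD (su i) (smoothM (smooth_cst (-1)) sp)).
move=> n; rewrite fourierD; [|exact/smooth_continuous/su|]; last first.
  by apply: (continuousM3 (@continuous_cst3 R (-1))); exact: smooth_continuous.
rewrite fourierZ; last exact: smooth_continuous.
rewrite fourier_partial// fourier_synth// rmorphN rmorph1 mulN1r; congr (_ - _).
by rewrite /pcoef /dcoef fw.
Qed.

Lemma sum2 (V : nmodType) (F : 'I_2 -> V) : \sum_(i < 2) F i = F ord0 + F ord_max.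
Proof. by rewrite !big_ord_recr big_ord0 /= add0r; congr (F _ + F _); exact: val_inj. Qed.

Lemma kc_hor0 n : kc R (hor ord0) n = kc R i0 n. Proof. by []. Qed.
Lemma kc_hor1 n : kc R (hor ord_max) n = kc R i1 n. Proof. by []. Qed.

(** A fixed point of P has no gradient part: k_i (k.u^_k) / |k'|^2 = 0 for both i. Some k_i is
    nonzero unless k' = 0, where k.u^_k is trivially 0. *)
Lemma leray_fixed_div (u : field 2 R) n : smooth_field u -> hydro_leray u = u ->
  n.2 = 0 -> \sum_(j < 2) (kc R (hor j) n)%:C%C * fourier (u j) n = 0.
Proof.
move=> su hu n0.
have [k0|k0] := eqVneq (khsq n) 0.
  move: k0 => /eqP; rewrite paddr_eq0 ?sqr_ge0// !expf_eq0/= => /andP[/eqP h0 /eqP h1].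
  by rewrite sum2 kc_hor0 kc_hor1 h0 h1 !mul0r addr0.
have H i : pcoef u i n = 0.
  have [_ /(_ n)] := hydro_leray_fourier i su; rewrite hu => /eqP.
  by rewrite -subr_eq0 opprB addrC subrK => /eqP.
have H' i : (kc R (hor i) n / khsq n)%:C%C * \sum_(j < 2) (kc R (hor j) n)%:C%C * fourier (u j) n = 0.
  by have := H i; rewrite pcoefE n0 eqxx.
apply/eqP/negPn/negP => S0.
have Z i : kc R (hor i) n = 0.
  move/eqP: (H' i); rewrite mulf_eq0 (negbTE S0) orbF => /eqP/(@complexI R)/eqP.
  by rewrite mulf_eq0 invr_eq0 (negbTE k0) orbF => /eqP.
by move: k0; rewrite /khsq -kc_hor0 -kc_hor1 !Z expr0n addr0 eqxx.
Qed.

Lemma commutator_leray (b : field 3 R) (phi : field 2 R) i :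
  smooth_field b -> smooth_field phi -> hydro_leray phi = phi ->
  torus_smooth (commutator (@hydro_leray R) (advect b) phi i) /\
  forall n, fourier (commutator (@hydro_leray R) (advect b) phi i) n = - pcoef (advect b phi) i n.
Proof.
move=> sb sp hp; rewrite /commutator hp.
have sa := smooth_advect sb sp.
have [sh fh] := hydro_leray_fourier i sa.
have e : (fun x => hydro_leray (advect b phi) i x - advect b phi i x) =
  (fun x => hydro_leray (advect b phi) i x + (-1) * advect b phi i x).
  by apply/funext => x; rewrite mulN1r.
rewrite e; split.
  exact: (smoothD sh (smoothM (smooth_cst (-1)) (sa i))).
move=> n; rewrite fourierD; [|exact: smooth_continuous|]; last first.
  by apply: (continuousM3 (@continuous_cst3 R (-1))); exact/smooth_continuous/sa.
rewrite fourierZ; last exact/smooth_continuous/sa.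
by rewrite fh rmorphN rmorph1 mulN1r addrAC subrr add0r.
Qed.

End Leray.

(** * Bound on the coefficients of the Leray commutator *)

Section CommutatorBound.
Variable R : realType.
Local Notation nc := (@ComplexField.Normc.normc R).
Local Notation W := (wave_norm R).
Implicit Types (n m k l : freq) (c d : freq -> R[i]) (f g : point R -> R) (x a : point R).

Definition nsum (p : nat) (u : field p R) k : R := \sum_(i < p) nc (fourier (u i) k).

Lemma nsum_ge0 p (u : field p R) k : 0 <= nsum u k.
Proof. by apply: sumr_ge0 => i _; exact: nc_ge0. Qed.

Definition hpart (b : field 3 R) : field 2 R := fun i => b (hor i).

(* The coefficients of (b^1, b^2) off the plane m_3 = 0, the only ones that
   dz (b^1, b^2) sees. *)
Definition bosc (b : field 3 R) m : R := if m.2 == 0 then 0 else nsum (hpart b) m.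

Lemma bosc_ge0 b m : 0 <= bosc b m.
Proof. by rewrite /bosc; case: ifP => // _; exact: nsum_ge0. Qed.

Lemma nc_dot_le (u : field 2 R) k l :
  nc (\sum_(j < 2) (kc R (hor j) k)%:C%C * fourier (u j) l) <= W k * nsum u l.
Proof.
apply: le_trans (nc_sum _ _ _) _; rewrite mulr_sumr; apply: ler_sum => j _.
by rewrite ncM nc_real ler_wpM2r ?nc_ge0// kc_le_wave_norm.
Qed.

Lemma advect_symbol (b : field 3 R) (phi : field 2 R) k l :
  smooth_field b -> divergence_free b ->
  \sum_(j < 2) (kc R (hor j) k)%:C%C *
    \sum_(i < 3) 'i%C * (kc R i l)%:C%C * fourier (phi j) l * fourier (b i) (k - l) =
  'i%C * (\sum_(j < 2) (kc R (hor j) k)%:C%C * fourier (phi j) l) *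
    \sum_(i < 3) (kc R i k)%:C%C * fourier (b i) (k - l).
Proof.
move=> sb db.
have e : \sum_(i < 3) (kc R i k)%:C%C * fourier (b i) (k - l) =
    \sum_(i < 3) (kc R i l)%:C%C * fourier (b i) (k - l).
  have := div_fourier (k - l) sb db => h; apply/eqP; rewrite -subr_eq0 -sumrB -[X in _ == X]h; apply/eqP.
  by apply: eq_bigr => i _; rewrite -mulrBl kcB rmorphB.
rewrite e [X in _ = X * _]mulr_sumr [RHS]mulr_suml; apply: eq_bigr => j _.
rewrite !mulr_sumr; apply: eq_bigr => i _; ring.
Qed.

(** The symbol k_i / |k|^2 is at most 1 / |k|, which cancels the factor |k| coming from k.b^; the
    other dot product, with phi^, leaves [W (k - l)] or [W k]. Both cases of l are covered by one
    sum of nonnegative terms. *)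
Lemma leray_commutator_bound (b : field 3 R) (phi : field 2 R) (i : 'I_2) k :
  smooth_field b -> divergence_free b -> smooth_field phi -> hydro_leray phi = phi ->
  ((nc (fourier (commutator (@hydro_leray R) (advect b) phi i) k))%:E <=
   \esum_(l in [set: freq])
     (W (k - l) * nsum (hpart b) (k - l) * nsum phi l + W k * bosc b (k - l) * nsum phi l)%:E)%E.
Proof.
move=> sb db sp hp; have [_ ->] := commutator_leray i sb sp hp.
rewrite ncN pcoefE.
have W0 := @wave_norm_ge0 R; have n0 := @nsum_ge0; have b0 := @bosc_ge0.
have X0 l : (0 <= (W (k - l) * nsum (hpart b) (k - l) * nsum phi l + W k * bosc b (k - l) * nsum phi l)%:E)%E.
  by rewrite lee_fin addr_ge0// !mulr_ge0.
case: eqP => [k0|_]; last by rewrite nc0; apply: esum_ge0 => l _; exact: X0.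
have kv : kc R vert k = 0 by rewrite /kc /idx/= k0 mulr0.
have Wk : W k ^+ 2 = khsq R k by rewrite wave_norm_sqr sum3 kv expr0n addr0.
have [kk0|kk0] := eqVneq (khsq R k) 0.
  by rewrite kk0 invr0 mulr0 mul0r nc0; apply: esum_ge0 => l _; exact: X0.
have Wk0 : 0 < W k.
  by rewrite lt_def W0 andbT; apply: contraNneq kk0 => w0; rewrite -Wk w0 expr0n.
pose t l := 'i%C * (\sum_(j < 2) (kc R (hor j) k)%:C%C * fourier (phi j) l) *
    \sum_(i < 3) (kc R i k)%:C%C * fourier (b i) (k - l).
have lim : boxlim t (\sum_(j < 2) (kc R (hor j) k)%:C%C * fourier (advect b phi j) k).
  have -> : t = fun l => \sum_(j < 2) (kc R (hor j) k)%:C%C *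
    \sum_(i < 3) 'i%C * (kc R i l)%:C%C * fourier (phi j) l * fourier (b i) (k - l).
    by apply/funext => l; rewrite advect_symbol.
  by apply: boxlim_sum => j; apply: boxlimZ; exact: fourier_advect.
have tb l : nc (t l) <=
      W k * (W (k - l) * nsum (hpart b) (k - l) * nsum phi l + W k * bosc b (k - l) * nsum phi l).
  rewrite /t !ncM nc_i mul1r.
  (* k_3 = 0 removes b^3, so only horizontal components of b are estimated; this is what lets dz
     (b^1, b^2) control the oscillating part. *)
  have hb : nc (\sum_(i < 3) (kc R i k)%:C%C * fourier (b i) (k - l)) <= W k * nsum (hpart b) (k - l).
    have -> : \sum_(i < 3) (kc R i k)%:C%C * fourier (b i) (k - l) =
       \sum_(i < 2) (kc R (hor i) k)%:C%C * fourier (hpart b i) (k - l).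
      rewrite sum3 sum2 kv mul0r addr0 /hpart.
      have h0 : hor ord0 = i0 by exact: val_inj.
      have h1 : hor ord_max = i1 by exact: val_inj.
      by rewrite /hpart h0 h1.
    exact: nc_dot_le.
  have [l0|l0] := eqVneq l.2 0.
    have e : \sum_(j < 2) (kc R (hor j) k)%:C%C * fourier (phi j) l =
      \sum_(j < 2) (kc R (hor j) (k - l))%:C%C * fourier (phi j) l.
      have h := leray_fixed_div sp hp l0; apply/eqP; rewrite -subr_eq0 -sumrB -[X in _ == X]h; apply/eqP.
      by apply: eq_bigr => j _; rewrite -mulrBl kcB rmorphB opprB addrCA subrr addr0.
    rewrite e mulrDr -[leLHS]addr0; apply: lerD; last by rewrite !mulr_ge0.
    have hA := nc_dot_le phi (k - l) l.
    apply: le_trans (ler_pM (nc_ge0 _) (nc_ge0 _) hA hb) _.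
    by rewrite le_eqVlt; apply/orP; left; apply/eqP; ring.
  rewrite mulrDr -[leLHS]add0r; apply: lerD; first by rewrite !mulr_ge0.
  have -> : bosc b (k - l) = nsum (hpart b) (k - l).
    by rewrite /bosc /= k0 sub0r oppr_eq0 (negbTE l0).
  have hA := nc_dot_le phi k l.
  apply: le_trans (ler_pM (nc_ge0 _) (nc_ge0 _) hA hb) _.
  by rewrite le_eqVlt; apply/orP; left; apply/eqP; ring.
rewrite ncM nc_real EFinM.
apply: (@le_trans _ _ ((W k)^-1%:E * \esum_(l in [set: freq]) (nc (t l))%:E)%E).
  apply: lee_pmul; rewrite ?lee_fin ?nc_ge0//; last exact: boxlim_bound.
  rewrite normrM normfV (ger0_norm (khsq_ge0 _ _)) ler_pdivrMr -?Wk ?exprn_gt0//.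
  by rewrite expr2 mulrA mulVf ?mul1r ?gt_eqF// kc_le_wave_norm.
rewrite -esumZ ?invr_ge0//; last by move=> l; rewrite lee_fin nc_ge0.
apply: le_esum => l _; rewrite -EFinM lee_fin.
have := ler_wpM2l (_ : 0 <= (W k)^-1) (tb l); rewrite invr_ge0 => /(_ (W0 k)).
by rewrite mulrA mulVf ?mul1r ?gt_eqF.
Qed.

End CommutatorBound.

(** * Estimates in weighted sequence spaces *)

Section WeightedSums.
Variable R : realType.
Local Notation nc := (@ComplexField.Normc.normc R).
Local Notation W := (wave_norm R).
Local Notation J := (japanese R).
Implicit Types (n m k l : freq) (g h : freq -> R).

Definition L1 g : \bar R := (\esum_(n in [set: freq]) (g n)%:E)%E.
(* The square of the l^2 norm. *)
Definition L2 g : \bar R := (\esum_(n in [set: freq]) (g n ^+ 2)%:E)%E.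

Lemma L1_ge0 g : (forall n, 0 <= g n) -> (0 <= L1 g)%E.
Proof. by move=> g0; apply: esum_ge0 => n _; rewrite lee_fin. Qed.

Lemma L2_ge0 g : (0 <= L2 g)%E.
Proof. by apply: esum_ge0 => n _; rewrite lee_fin sqr_ge0. Qed.

Lemma youngC (a c : freq -> R) : (forall i, 0 <= a i) -> (forall i, 0 <= c i) ->
  (\esum_(k in [set: freq]) (\esum_(l in [set: freq]) (a (k - l) * c l)%:E) ^+ 2 <=
   L2 a * L1 c ^+ 2)%E.
Proof.
move=> a0 c0; have := young c0 a0; rewrite muleC; apply: le_trans.
apply: le_esum => k _; rewrite -(esum_shift k (fun l => (c (k - l) * a l)%:E)).
by under [X in (_ <= X ^+ 2)%E]eq_esum do rewrite subKr mulrC.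
Qed.

Lemma sqre3_le (x y z : \bar R) : (0 <= x -> 0 <= y -> 0 <= z ->
  (x + y + z) ^+ 2 <= 3%:E * (x ^+ 2 + y ^+ 2 + z ^+ 2))%E.
Proof.
have p3 : (0 < 3%:E :> \bar R)%E by rewrite lte_fin.
have top (t : \bar R) : (t <= 3%:E * +oo)%E by rewrite gt0_muley ?leey.
case: x => [x| |] // x0; case: y => [y| |] // y0; case: z => [z| |] // z0;
  try by rewrite !expe2 ?mulyy -?EFinM; exact: top.
rewrite !expe2 -[leLHS]/(((x + y + z) * (x + y + z))%:E) -[leRHS]/((3 * (x * x + y * y + z * z))%:E) lee_fin.
have := sqr_ge0 (x - y); have := sqr_ge0 (y - z); have := sqr_ge0 (x - z); nra.
Qed.

(** In each product one factor is measured in l^1 and the other in l^2. The first product has them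
    in the opposite order, to suit a heavy weight on [a1]. The 3 comes from (x + y + z)^2 <= 3 (x^2
    + y^2 + z^2). *)
Lemma conv3_estimate (h a1 c1 a2 c2 a3 c3 : freq -> R) (C : R) : 0 <= C ->
  (forall k, 0 <= h k) ->
  (forall k, 0 <= a1 k) -> (forall k, 0 <= c1 k) -> (forall k, 0 <= a2 k) ->
  (forall k, 0 <= c2 k) -> (forall k, 0 <= a3 k) -> (forall k, 0 <= c3 k) ->
  (forall k, (h k)%:E <= \esum_(l in [set: freq])
    (C * (a1 (k - l) * c1 l + a2 (k - l) * c2 l + a3 (k - l) * c3 l))%:E)%E ->
  (L2 h <= (3 * C ^+ 2)%:E * (L2 a1 * L1 c1 ^+ 2 + L1 a2 ^+ 2 * L2 c2 + L1 a3 ^+ 2 * L2 c3))%E.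
Proof.
move=> C0 h0 a10 c10 a20 c20 a30 c30 H.
have X0 (a c : freq -> R) k l : (forall k, 0 <= a k) -> (forall k, 0 <= c k) -> (0 <= (a (k - l) * c l)%:E)%E.
  by move=> ? ?; rewrite lee_fin mulr_ge0.
pose X (a c : freq -> R) k := (\esum_(l in [set: freq]) (a (k - l) * c l)%:E)%E.
have XX0 a c k : (forall k, 0 <= a k) -> (forall k, 0 <= c k) -> (0 <= X a c k)%E.
  by move=> ? ?; apply: esum_ge0 => l _; exact: X0.
have hX k : ((h k ^+ 2)%:E <= (3 * C ^+ 2)%:E * (X a1 c1 k ^+ 2 + X a2 c2 k ^+ 2 + X a3 c3 k ^+ 2))%E.
  have h1 : ((h k)%:E <= C%:E * (X a1 c1 k + X a2 c2 k + X a3 c3 k))%E.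
    apply: le_trans (H k) _; rewrite le_eqVlt; apply/orP; left; apply/eqP.
    under eq_esum do rewrite EFinM.
    rewrite esumZ//; last first.
      by move=> l; rewrite lee_fin; rewrite !addr_ge0// mulr_ge0.
    congr (_ * _)%E; under eq_esum do rewrite !EFinD.
    rewrite esumD; [|by move=> l _; rewrite adde_ge0 ?X0|by move=> l _; exact: X0].
    by rewrite esumD//; move=> l _; exact: X0.
  rewrite EFin_expe; apply: le_trans (_ : ((C%:E * (X a1 c1 k + X a2 c2 k + X a3 c3 k)) ^+ 2 <= _)%E).
    by rewrite lee_sqr ?lee_fin// mule_ge0 ?lee_fin// !adde_ge0// XX0.
  have -> : ((C%:E * (X a1 c1 k + X a2 c2 k + X a3 c3 k)) ^+ 2 =
      (C ^+ 2)%:E * (X a1 c1 k + X a2 c2 k + X a3 c3 k) ^+ 2)%E by rewrite !expe2 muleACA -EFinM -expr2.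
  rewrite [(3 * _)%R]mulrC [(_ * 3)%:E]EFinM -muleA.
  apply: lee_pmul => //; first by rewrite lee_fin sqr_ge0.
    exact: sqre_ge0.
  by apply: sqre3_le; exact: XX0.
apply: le_trans (le_esum (fun k _ => hX k)) _.
have S0 a c k : (0 <= X a c k ^+ 2)%E by exact: sqre_ge0.
rewrite esumZ; [|by rewrite mulr_ge0 ?sqr_ge0|by move=> k; rewrite !adde_ge0].
apply: lee_pmul => //; first by rewrite lee_fin mulr_ge0 ?sqr_ge0.
  by apply: esum_ge0 => k _; rewrite !adde_ge0.
rewrite esumD; [|by move=> k _; rewrite adde_ge0|by []].
rewrite esumD//.
by apply: leeD; [apply: leeD; [exact: youngC|exact: young]|exact: young].
Qed.

Definition wsum (p : R) : R := fine (L1 (fweight p)).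

Lemma wsumE p : 1 < p -> (wsum p)%:E = L1 (fweight p).
Proof.
move=> p1; rewrite /wsum fineK// ge0_fin_numE; first exact: fweight_summable.
by apply: L1_ge0 => n; exact: fweight_ge0.
Qed.

Lemma wsum_ge0 p : 0 <= wsum p.
Proof. by rewrite fine_ge0// L1_ge0// => n; exact: fweight_ge0. Qed.

Lemma fweight_gt0 (p : R) n : 0 < fweight p n.
Proof. by rewrite /fweight !mulr_gt0// powR_gt0. Qed.

(** Cauchy-Schwarz for g = w (g / w) with the summable weight w = [fweight p]. *)
Lemma L1_le_L2 (p : R) g (q : freq -> R) : 1 < p -> (forall n, 0 <= g n) ->
  (forall n, 0 <= q n) -> (forall n, g n ^+ 2 <= fweight p n * q n) ->
  (L1 g ^+ 2 <= (wsum p)%:E * L1 q)%E.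
Proof.
move=> p1 g0 q0 gq.
have f0 := @fweight_gt0 p.
have r0 n : 0 <= g n / fweight p n by rewrite divr_ge0// ltW.
have := weighted_CS (fun n => ltW (f0 n)) r0.
under eq_esum do rewrite mulrC divfK ?gt_eqF//.
rewrite -/(L1 g) -/(L1 (fweight p)) -wsumE//.
move=> h; apply: le_trans h _; apply: lee_pmul => //.
- by rewrite lee_fin wsum_ge0.
- by apply: esum_ge0 => n _; rewrite lee_fin mulr_ge0 ?sqr_ge0// ltW.
- apply: le_esum => n _; rewrite lee_fin.
  have -> : fweight p n * (g n / fweight p n) ^+ 2 = g n ^+ 2 / fweight p n.
    by field; rewrite gt_eqF.
  by rewrite ler_pdivrMr// mulrC.
Qed.

Lemma powR_sqr (a r : R) : (a `^ r) ^+ 2 = a `^ (2 * r).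
Proof. by rewrite -powR_mulrn ?powR_ge0// -powRrM mulrC. Qed.

Lemma J_powR_ge1 k (r : R) : 0 <= r -> 1 <= J k `^ r.
Proof. by move=> r0; rewrite -(powRr0 (J k)); apply: ler_powR => //; exact: J_ge1. Qed.

Lemma J_powR_le k (r : R) : 0 <= r -> J k `^ r <= 2 `^ r * (1 + W k `^ r).
Proof.
move=> r0; have w0 := wave_norm_ge0 R k.
have [w1|w1] := leP (W k) 1.
  apply: le_trans (_ : 2 `^ r <= _).
    by apply: ge0_ler_powR; rewrite ?nnegrE ?J_ge0// /japanese; lra.
  by rewrite ler_peMr ?powR_ge0// lerDl powR_ge0.
apply: le_trans (_ : (2 * W k) `^ r <= _).
  by apply: ge0_ler_powR; rewrite ?nnegrE ?J_ge0 ?mulr_ge0// /japanese; lra.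
by rewrite powRM// ler_wpM2l ?powR_ge0// lerDr.
Qed.

Lemma wave_powR_le k (r : R) : 0 <= r -> 1 + W k `^ r <= 2 * J k `^ r.
Proof.
move=> r0; rewrite mulr_natl mulr2n; apply: lerD; first exact: J_powR_ge1.
by apply: ge0_ler_powR; rewrite ?nnegrE ?J_ge0 ?wave_norm_ge0// wave_norm_le_J.
Qed.

(** The larger of [J (k - l)] and [J l] is at least half of [J k], which serves every exponent r >=
    0. *)
Lemma J_add_powR k l (r : R) : 0 <= r -> J k `^ r <= 2 `^ r * (J (k - l) `^ r + J l `^ r).
Proof.
move=> r0; have h : J k <= J (k - l) + J l.
  by have := wave_normD R (k - l) l; rewrite subrK /japanese => h; have := wave_norm_ge0 R l; lra.
have j0 := J_ge0 R.
have [c|c] := leP (J l) (J (k - l)).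
  apply: le_trans (_ : (2 * J (k - l)) `^ r <= _).
    by apply: ge0_ler_powR; rewrite ?nnegrE ?mulr_ge0//; lra.
  by rewrite powRM// ler_wpM2l ?powR_ge0// lerDl powR_ge0.
apply: le_trans (_ : (2 * J l) `^ r <= _).
  by apply: ge0_ler_powR; rewrite ?nnegrE ?mulr_ge0//; lra.
by rewrite powRM// ler_wpM2l ?powR_ge0// lerDr powR_ge0.
Qed.

Definition sqsum (p : nat) (u : field p R) k : R :=
  \sum_(i < p) nc (fourier (u i) k) ^+ 2.

Lemma sqsum_ge0 p (u : field p R) k : 0 <= sqsum u k.
Proof. by apply: sumr_ge0 => i _; exact: sqr_ge0. Qed.

(** The square of [Hnorm], kept as a plain sum. *)
Definition Ssq (p : nat) (r : R) (u : field p R) : \bar R :=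
  (\esum_(k in [set: freq]) ((1 + W k `^ (2 * r)) * sqsum u k)%:E)%E.

Lemma HnormE p (r : R) (u : field p R) : Hnorm r u = (Ssq r u `^ 2^-1)%E.
Proof. by []. Qed.

Lemma Ssq_term_ge0 p (r : R) (u : field p R) k :
  (0 <= ((1 + W k `^ (2 * r)) * sqsum u k)%:E)%E.
Proof. by rewrite lee_fin mulr_ge0 ?sqsum_ge0// addr_ge0 ?powR_ge0. Qed.

Lemma Ssq_ge0 p (r : R) (u : field p R) : (0 <= Ssq r u)%E.
Proof. by apply: esum_ge0 => k _; exact: Ssq_term_ge0. Qed.

Lemma sum_sqr_le p (a : 'I_p -> R) : (\sum_(i < p) a i) ^+ 2 <= p%:R * \sum_(i < p) a i ^+ 2.
Proof.
rewrite expr2 big_distrlr /=.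
apply: le_trans (_ : \sum_(i < p) \sum_(j < p) (a i ^+ 2 + a j ^+ 2) / 2 <= _).
  apply: ler_sum => i _; apply: ler_sum => j _.
  by rewrite ler_pdivlMr// -subr_ge0 (_ : _ - _ = (a i - a j) ^+ 2) ?sqr_ge0//; ring.
rewrite le_eqVlt; apply/orP; left; apply/eqP.
transitivity (\sum_(i < p) (p%:R * a i ^+ 2 + \sum_(j < p) a j ^+ 2) / 2).
  by apply: eq_bigr => i _; rewrite -mulr_suml big_split/= sumr_const card_ord -[_ *+ p]mulr_natl.
by rewrite -mulr_suml big_split/= sumr_const card_ord -mulr_sumr -[_ *+ p]mulr_natl; field.
Qed.

Lemma nsum_sqr p (u : field p R) k : nsum u k ^+ 2 <= p%:R * sqsum u k.
Proof. exact: sum_sqr_le. Qed.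

(** In the constant, p comes from Cauchy-Schwarz over the components in [nsum], and 2^(2r) from
    comparing (1 + |k|)^(2r) with 1 + |k|^(2r). *)
Lemma L2_weighted p (u : field p R) (q r : R) : q <= r -> 0 <= r ->
  (L2 (fun k => J k `^ q * nsum u k)%R <= (p%:R * 2 `^ (2 * r))%:E * Ssq r u)%E.
Proof.
move=> qr r0; rewrite /Ssq -esumZ; [|by rewrite mulr_ge0 ?powR_ge0|exact: Ssq_term_ge0].
apply: le_esum => k _; rewrite -EFinM lee_fin exprMn powR_sqr.
have h1 : J k `^ (2 * q) <= J k `^ (2 * r) by apply: ler_powR; [exact: J_ge1|lra].
have h2 := J_powR_le k (_ : 0 <= 2 * r); rewrite mulr_ge0// in h2.
have := ler_pM (powR_ge0 _ _) (sqr_ge0 _) (le_trans h1 (h2 isT)) (nsum_sqr u k).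
move=> h; apply: le_trans h _; rewrite le_eqVlt; apply/orP; left; apply/eqP; ring.
Qed.

Lemma fweight_J (p : R) n : 0 <= p -> 1 <= fweight p n * J n `^ (3 * p).
Proof.
move=> p0; have -> : 3 * p = p + p + p by ring.
have jn i : 1 <= zweight p (idx i n) * J n `^ p.
  rewrite /zweight powRN mulrC ler_pdivlMr ?powR_gt0// mul1r.
  by apply: ge0_ler_powR; rewrite ?nnegrE ?J_ge0// idx_le_J.
have J0 : J n != 0 by rewrite gt_eqF// J_gt0.
rewrite !powRD; try by rewrite J0 implybT.
apply: le_trans (mulr_ege1 (mulr_ege1 (jn i0) (jn i1)) (jn vert)) _.
by rewrite le_eqVlt; apply/orP; left; apply/eqP; rewrite /fweight /idx /=; ring.
Qed.

(* Cauchy-Schwarz against [fweight p]; the loss of 2 in the exponent dictates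
   3 p <= 4, and summability p > 1, hence p = 4 / 3. *)
Lemma L1_weighted p (u : field p R) (q r : R) : q + 2 <= r -> 0 <= r ->
  (L1 (fun k => J k `^ q * nsum u k)%R ^+ 2 <=
   (wsum (4 / 3) * (p%:R * 2 `^ (2 * r)))%:E * Ssq r u)%E.
Proof.
move=> qr r0; have p43 : 1 < 4 / 3 :> R by lra.
have n0 := @nsum_ge0 R.
apply: le_trans (@L1_le_L2 _ _ (fun k => (J k `^ (q + 2) * nsum u k) ^+ 2) p43 _ _ _) _.
- by move=> k; rewrite mulr_ge0 ?powR_ge0.
- by move=> k; exact: sqr_ge0.
- move=> k; rewrite !exprMn !powR_sqr.
  have J0 : J k != 0 by rewrite gt_eqF// J_gt0.
  have -> : 2 * (q + 2) = 2 * q + 3 * (4 / 3) by field.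
  rewrite powRD; last by rewrite J0 implybT.
  have h := @fweight_J (4 / 3) k (ltac:(lra)).
  have X0 : 0 <= J k `^ (2 * q) * nsum u k ^+ 2 by rewrite mulr_ge0 ?powR_ge0 ?sqr_ge0.
  have := ler_wpM2l X0 h; rewrite mulr1; move=> h'; apply: le_trans h' _.
  by rewrite le_eqVlt; apply/orP; left; apply/eqP; ring.
rewrite [X in (_ <= X * _)%E]EFinM -muleA; apply: lee_pmul => //.
- by rewrite lee_fin wsum_ge0.
- by apply: L1_ge0 => k; exact: sqr_ge0.
- exact: L2_weighted.
Qed.

Lemma Ssq_hpart (b : field 3 R) (r : R) : (Ssq r (hpart b) <= Ssq r b)%E.
Proof.
apply: le_esum => k _; rewrite lee_fin ler_wpM2l ?addr_ge0 ?powR_ge0//.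
have h0 : hor ord0 = i0 by exact: val_inj.
have h1 : hor ord_max = i1 by exact: val_inj.
by rewrite /sqsum /hpart sum3 sum2 h0 h1 lerDl sqr_ge0.
Qed.

Lemma nsum_dz (b : field 3 R) k : smooth_field b ->
  nsum (dz_hor b) k = `|kc R vert k| * nsum (hpart b) k.
Proof.
move=> sb; rewrite /nsum mulr_sumr; apply: eq_bigr => i _.
by rewrite (fourier_partial _ _ (sb (hor i))) ncM nc_ikc.
Qed.

(* Two of the three factors of [fweight p] are absorbed by the weight J^(r-1)
   each, the vertical one by the factor |k_3|^2 that comes from dz; this needs
   1 < p <= min (r - 1) 2. *)
Definition osc_const (r : R) : R := wsum (Num.min (r - 1) 2) * (2 * 2 `^ (2 * (r - 1))).

Lemma L1_osc (b : field 3 R) (r : R) : smooth_field b -> 2 < r ->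
  (L1 (bosc b) ^+ 2 <= (osc_const r)%:E * Ssq (r - 1) (dz_hor b))%E.
Proof.
move=> sb r2; set p := Num.min (r - 1) 2.
have p1 : 1 < p by rewrite lt_min; apply/andP; split; lra.
have p2 : p <= 2 by rewrite ge_min lexx orbT.
have pr : p <= r - 1 by rewrite ge_min lexx.
apply: le_trans (@L1_le_L2 p _ (fun k => (J k `^ (r - 1) * nsum (dz_hor b) k) ^+ 2) p1 _ _ _) _.
- exact: bosc_ge0.
- by move=> k; exact: sqr_ge0.
- move=> k; rewrite /bosc; case: eqP => [_|/eqP k3].
    by rewrite expr0n mulr_ge0 ?fweight_ge0 ?sqr_ge0.
  rewrite nsum_dz// !exprMn powR_sqr.
  have z i : 1 <= zweight p (idx i k) * J k `^ (r - 1).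
    rewrite /zweight powRN mulrC ler_pdivlMr ?powR_gt0// mul1r.
    apply: le_trans (_ : J k `^ p <= _); last by apply: ler_powR => //; exact: J_ge1.
    by apply: ge0_ler_powR; rewrite ?nnegrE ?J_ge0 ?idx_le_J//; lra.
  (* For n_3 <> 0 one has 1 + |n_3| <= 2 pi |n_3| = |k_3|, so two powers of |k_3| pay for the
     vertical factor, whose exponent p is at most 2. *)
  have zv : 1 <= zweight p (idx vert k) * `|kc R vert k| ^+ 2.
    rewrite /zweight powRN mulrC ler_pdivlMr ?powR_gt0// mul1r.
    have n1 : 1 <= (`|k.2|%N)%:R :> R by rewrite ler1n lt0n absz_eq0.
    apply: le_trans (_ : (`|k.2|%N).+1%:R `^ 2 <= _).
      by apply: ler_powR => //; rewrite ler1n.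
    rewrite powR_mulrn// lerXn2r ?nnegrE//.
    rewrite /kc normrM -(@intr_norm R) -abszE /idx/= -natr1 ger0_norm ?mulr_ge0 ?pi_ge0//.
    have := @pi_ge2 R => h2; rewrite -[X in _ <= _ * X]/((`|k.2|%N)%:R : R).
    have := ler_wpM2r (le_trans ler01 n1) h2; nra.
  have -> : 2 * (r - 1) = (r - 1) + (r - 1) by ring.
  rewrite powRD; last by apply/implyP => _; rewrite gt_eqF ?J_gt0.
  have h := mulr_ege1 (mulr_ege1 (z i0) (z i1)) zv; have := ler_wpM2r (sqr_ge0 (nsum (hpart b) k)) h.
  rewrite mul1r => h'; apply: le_trans h' _.
  by rewrite le_eqVlt; apply/orP; left; apply/eqP; rewrite /fweight /idx /=; ring.
rewrite /osc_const EFinM -muleA; apply: lee_pmul => //.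
- by rewrite lee_fin wsum_ge0.
- by apply: L1_ge0 => k; exact: sqr_ge0.
- by apply: L2_weighted => //; lra.
Qed.

End WeightedSums.

(** * The estimate for the Leray commutator *)

Section FirstEstimate.
Variable R : realType.
Local Notation nc := (@ComplexField.Normc.normc R).
Local Notation W := (wave_norm R).
Local Notation J := (japanese R).
Implicit Types (n m k l : freq) (g h : freq -> R).

Lemma bosc_le (b : field 3 R) m : bosc b m <= nsum (hpart b) m.
Proof. by rewrite /bosc; case: ifP => // _; exact: nsum_ge0. Qed.

(** The powers r (first summand) and r + 1 (second summand) of [J k] are split between k - l and l.
    The share of k - l in the second summand goes to the first product through [bo] <= [B]; only the
    share of l keeps [bo]. The exponents 0 and 1 are written out to fit [L1_weighted]. *)
Lemma commutator_weight (r : R) k l (B bo G : R) : 0 <= r -> 0 <= bo -> bo <= B -> 0 <= G ->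
  J k `^ r * (W (k - l) * B * G + W k * bo * G) <=
  4 * 2 `^ r * (J (k - l) `^ (r + 1) * B * (J l `^ 0 * G) + J (k - l) `^ 1 * B * (J l `^ r * G) +
    bo * (J l `^ (r + 1) * G)).
Proof.
move=> r0 bo0 boB G0; have B0 : 0 <= B by exact: le_trans boB.
have j0 := @J_ge0 R; have w0 := @wave_norm_ge0 R.
have pw m : J m `^ (r + 1) = J m `^ r * J m.
  rewrite powRD; first by rewrite powRr1.
  by apply/implyP => _; rewrite gt_eqF ?J_gt0.
rewrite powRr0 powRr1// mul1r.
have h1 := @J_add_powR R k l r r0.
have r10 : 0 <= r + 1 by lra.
have h2 := @J_add_powR R k l (r + 1) r10.
have p2 : 2 `^ (r + 1) = 2 * 2 `^ r :> R.
  rewrite powRD; first by rewrite powRr1// mulrC.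
  by apply/implyP => _; rewrite gt_eqF.
rewrite p2 in h2.
set P := 2 `^ r in h1 h2 *; have P0 : 0 <= P by exact: powR_ge0.
set X := J (k - l) `^ (r + 1) in h2 *; have X0 : 0 <= X by exact: powR_ge0.
set Y := J l `^ (r + 1) in h2 *; have Y0 : 0 <= Y by exact: powR_ge0.
set Z := J l `^ r in h1 *; have Z0 : 0 <= Z by exact: powR_ge0.
have A1 : J k `^ r * W (k - l) <= P * (X + J (k - l) * Z).
  apply: le_trans (ler_pM (powR_ge0 _ _) (w0 _) h1 (wave_norm_le_J R (k - l))) _.
  by rewrite -mulrA mulrDl /X pw [X in _ <= _ * (_ + X)]mulrC.
have A2 : J k `^ r * W k <= 2 * P * (X + Y).
  by apply: le_trans h2; rewrite pw ler_wpM2l ?powR_ge0// wave_norm_le_J.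
have BG0 : 0 <= B * G by exact: mulr_ge0.
have bG0 : 0 <= bo * G by exact: mulr_ge0.
have bG : bo * G <= B * G by rewrite ler_wpM2r.
have B1 := ler_wpM2r BG0 A1; have B2 := ler_wpM2r bG0 A2.
have PX : 0 <= P * X := mulr_ge0 P0 X0.
have B3 := ler_wpM2l PX bG.
have C1 : 0 <= P * (J (k - l) * Z) * (B * G) by rewrite !mulr_ge0.
have C2 : 0 <= P * Y * (bo * G) by rewrite !mulr_ge0.
have C3 : 0 <= P * X * (B * G) := mulr_ge0 PX BG0.
have -> : J k `^ r * (W (k - l) * B * G + W k * bo * G) =
  J k `^ r * W (k - l) * (B * G) + J k `^ r * W k * (bo * G) by ring.
apply: le_trans (lerD B1 B2) _.
have -> : P * (X + J (k - l) * Z) * (B * G) + 2 * P * (X + Y) * (bo * G) =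
  P * X * (B * G) + P * (J (k - l) * Z) * (B * G) + 2 * (P * X * (bo * G)) + 2 * (P * Y * (bo * G)) by ring.
have -> : 4 * P * (X * B * G + J (k - l) * B * (Z * G) + bo * (Y * G)) =
  4 * (P * X * (B * G)) + 4 * (P * (J (k - l) * Z) * (B * G)) + 4 * (P * Y * (bo * G)) by ring.
lra.
Qed.

Lemma Ssq_le_L2 (r : R) (u : field 2 R) : 0 <= r ->
  (Ssq r u <= 2%:E * (L2 (fun k => J k `^ r * nc (fourier (u ord0) k))%R
                    + L2 (fun k => J k `^ r * nc (fourier (u ord_max) k))%R))%E.
Proof.
move=> r0; rewrite -esumD; [|by move=> k _; rewrite lee_fin sqr_ge0..].
rewrite -esumZ//; last by move=> k; rewrite adde_ge0 ?lee_fin ?sqr_ge0.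
apply: le_esum => k _; rewrite -EFinD -EFinM lee_fin /sqsum sum2 !exprMn powR_sqr -mulrDr mulrA.
by rewrite ler_wpM2r ?addr_ge0 ?sqr_ge0// wave_powR_le// mulr_ge0.
Qed.

Lemma mule_constACA (a c : R) (x y : \bar R) : ((a%:E * x) * (c%:E * y) = (a * c)%:E * (x * y))%E.
Proof. by rewrite muleACA EFinM. Qed.

(** The lightly weighted factors are taken in l^1: phi with weight 0 needs 0 + 2 <= r, b with weight
    1 needs 1 + 2 <= r + 1, and the oscillating part needs r > 2 in [L1_osc]. *)
Theorem leray_commutator_sq (r : R) : 2 < r -> exists2 C : R, 0 <= C &
  forall (b : field 3 R) (phi : field 2 R),
  smooth_field b -> divergence_free b -> smooth_field phi -> hydro_leray phi = phi ->
  (Ssq r (commutator (@hydro_leray R) (advect b) phi) <=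
   C%:E * (Ssq (r + 1) b * Ssq r phi + Ssq (r - 1) (dz_hor b) * Ssq (r + 1) phi))%E.
Proof.
move=> r2; have r0 : 0 <= r by lra.
pose K (r : R) := 2%:R * 2 `^ (2 * r) : R.
have K0 t : 0 <= K t by rewrite mulr_ge0 ?powR_ge0.
pose w := wsum (4 / 3 : R); have w0 : 0 <= w by exact: wsum_ge0.
have o0 : 0 <= osc_const r by rewrite mulr_ge0 ?wsum_ge0// mulr_ge0 ?powR_ge0.
pose M := K (r + 1) * (w * K r) + (w * K (r + 1)) * K r + osc_const r * K (r + 1).
have kwk a c : 0 <= K a * (w * K c) by exact: mulr_ge0 (K0 _) (mulr_ge0 w0 (K0 _)).
have wkk a c : 0 <= (w * K a) * K c by exact: mulr_ge0 (mulr_ge0 w0 (K0 _)) (K0 _).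
have ok a : 0 <= osc_const r * K a by exact: mulr_ge0 o0 (K0 _).
have M0 : 0 <= M by rewrite !addr_ge0.
pose D := 3 * (4 * 2 `^ r) ^+ 2 : R.
have D0 : 0 <= D by rewrite mulr_ge0// sqr_ge0.
(* [D] stems from [conv3_estimate] with the constant of [commutator_weight], [M] from the norms of
   the factors; one 2 is that of [Ssq_le_L2], the other counts its two components. *)
exists (2 * (2 * (D * M))); first by rewrite !mulr_ge0.
move=> b phi sb db sp hp.
set X1 := Ssq (r + 1) b; set X2 := Ssq r phi; set Y1 := Ssq (r - 1) _; set Y2 := Ssq (r + 1) phi.
have X10 : (0 <= X1)%E by exact: Ssq_ge0.
have X20 : (0 <= X2)%E by exact: Ssq_ge0.
have Y10 : (0 <= Y1)%E by exact: Ssq_ge0.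
have Y20 : (0 <= Y2)%E by exact: Ssq_ge0.
have n0 := @nsum_ge0 R; have b0 := @bosc_ge0 R.
have main i : (L2 (fun k => J k `^ r * nc (fourier (commutator (@hydro_leray R) (advect b) phi i) k))%R <=
    (D * M)%:E * (X1 * X2 + Y1 * Y2))%E.
  have := @conv3_estimate R (fun k => J k `^ r * nc (fourier (commutator (@hydro_leray R) (advect b) phi i) k))
    (fun k => J k `^ (r + 1) * nsum (hpart b) k) (fun k => J k `^ 0 * nsum phi k)
    (fun k => J k `^ 1 * nsum (hpart b) k) (fun k => J k `^ r * nsum phi k)
    (bosc b) (fun k => J k `^ (r + 1) * nsum phi k) (4 * 2 `^ r).
  rewrite -/D => H.
  have c0 : 0 <= 4 * 2 `^ r :> R by rewrite mulr_ge0 ?powR_ge0.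
  apply: le_trans (H c0 _ _ _ _ _ _ _ _) _; rewrite {H}.
  - by move=> k; rewrite mulr_ge0 ?powR_ge0 ?nc_ge0.
  - by move=> k; rewrite mulr_ge0 ?powR_ge0.
  - by move=> k; rewrite mulr_ge0 ?powR_ge0.
  - by move=> k; rewrite mulr_ge0 ?powR_ge0.
  - by move=> k; rewrite mulr_ge0 ?powR_ge0.
  - exact: b0.
  - by move=> k; rewrite mulr_ge0 ?powR_ge0.
  - move=> k; rewrite EFinM.
    apply: (le_trans (lee_pmul _ _ (lexx _) (leray_commutator_bound i k sb db sp hp))).
    + by rewrite lee_fin powR_ge0.
    + by rewrite lee_fin nc_ge0.
    rewrite -esumZ ?powR_ge0//; last first.
      by move=> l; rewrite lee_fin addr_ge0// !mulr_ge0// wave_norm_ge0.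
    apply: le_esum => l _; rewrite -EFinM lee_fin.
    by apply: commutator_weight => //; exact: bosc_le.
  have -> : ((D * M)%:E * (X1 * X2 + Y1 * Y2) = D%:E * (M%:E * (X1 * X2 + Y1 * Y2)))%E.
    by rewrite EFinM muleA.
  have wm (x y : \bar R) (z : R) : 0 <= z -> (x <= y)%E -> (z%:E * x <= z%:E * y)%E.
    by move=> z0 xy; rewrite lee_wpmul2l.
  apply: (wm _ _ D D0).
  have e1 : (L2 (fun k => J k `^ (r + 1) * nsum (hpart b) k)%R <= (K (r + 1))%:E * X1)%E.
    apply: le_trans (@L2_weighted R _ (hpart b) (r + 1) (r + 1) _ _) _; [by []|by lra|].
    by apply: lee_wpmul2l; [rewrite lee_fin; exact: K0|exact: Ssq_hpart].
  have e2 : (L1 (fun k => J k `^ 0 * nsum phi k)%R ^+ 2 <= (w * K r)%:E * X2)%E.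
    by apply: L1_weighted => //; lra.
  have e3 : (L1 (fun k => J k `^ 1 * nsum (hpart b) k)%R ^+ 2 <= (w * K (r + 1))%:E * X1)%E.
    apply: le_trans (@L1_weighted R _ (hpart b) 1 (r + 1) _ _) _; [by lra|by lra|].
    by apply: lee_wpmul2l; [rewrite lee_fin; exact: (mulr_ge0 w0 (K0 _))|exact: Ssq_hpart].
  have e4 : (L2 (fun k => J k `^ r * nsum phi k)%R <= (K r)%:E * X2)%E by exact: L2_weighted.
  have e5 : (L1 (bosc b) ^+ 2 <= (osc_const r)%:E * Y1)%E by exact: L1_osc.
  have e6 : (L2 (fun k => J k `^ (r + 1) * nsum phi k)%R <= (K (r + 1))%:E * Y2)%E.
    by apply: L2_weighted => //; lra.
  have s0 := @L2_ge0 R; have q0 := @sqre_ge0 R.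
  apply: le_trans (leeD (leeD (lee_pmul (s0 _) (q0 _) e1 e2) (lee_pmul (q0 _) (s0 _) e3 e4))
    (lee_pmul (q0 _) (s0 _) e5 e6)) _.
  rewrite !mule_constACA.
  rewrite -ge0_muleDl ?lee_fin// -EFinD.
  have XX : (0 <= X1 * X2)%E := mule_ge0 X10 X20.
  have YY : (0 <= Y1 * Y2)%E := mule_ge0 Y10 Y20.
  rewrite [leRHS]ge0_muleDr//; apply: leeD; apply: lee_wpmul2r => //; rewrite lee_fin.
  - by rewrite lerDl.
  - by rewrite lerDr addr_ge0.
apply: le_trans (Ssq_le_L2 _ r0) _.
rewrite [(2 * (2 * (D * M)))%:E]EFinM -muleA; apply: lee_wpmul2l; first by rewrite lee_fin.
apply: le_trans (leeD (main _) (main _)) _.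
by rewrite -ge0_muleDl ?lee_fin ?mulr_ge0// -EFinD -mulr2n -[(_ *+ 2)%R]mulr_natl.
Qed.

Lemma sqre2_ge (x y : \bar R) : (0 <= x -> 0 <= y -> x ^+ 2 + y ^+ 2 <= (x + y) ^+ 2)%E.
Proof.
case: x => [x| |] // x0; case: y => [y| |] // y0; try by rewrite !expe2 ?mulyy leey.
rewrite !expe2 -[leLHS]/((x * x + y * y)%:E) -[leRHS]/(((x + y) * (x + y))%:E) lee_fin.
by rewrite !lee_fin in x0 y0; have := mulr_ge0 x0 y0; nra.
Qed.

Lemma poweR_half_sqr (x : \bar R) : (0 <= x -> (x `^ 2^-1) ^+ 2 = x)%E.
Proof. by move=> x0; rewrite poweR12_sqrt// sqr_sqrte. Qed.

Lemma poweR_half_le (x y : \bar R) : (0 <= x -> 0 <= y -> x <= y ^+ 2 -> x `^ 2^-1 <= y)%E.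
Proof.
by move=> x0 y0 xy; rewrite -lee_sqr ?poweR_ge0// poweR_half_sqr.
Qed.

(** Since x^2 + y^2 <= (x + y)^2 for nonnegative x and y, the constant is just replaced by its
    square root. *)
Lemma sqrt_passage (S X1 X2 Y1 Y2 : \bar R) (C : R) : 0 <= C ->
  (0 <= S -> 0 <= X1 -> 0 <= X2 -> 0 <= Y1 -> 0 <= Y2 ->
  S <= C%:E * (X1 * X2 + Y1 * Y2) ->
  S `^ 2^-1 <= (Num.sqrt C)%:E *
    (X1 `^ 2^-1 * X2 `^ 2^-1 + Y1 `^ 2^-1 * Y2 `^ 2^-1))%E.
Proof.
move=> C0 S0 X10 X20 Y10 Y20 h.
have p0 (x : \bar R) : (0 <= x `^ 2^-1)%E by exact: poweR_ge0.
apply: poweR_half_le => //.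
  by rewrite mule_ge0 ?lee_fin ?sqrtr_ge0// adde_ge0// mule_ge0.
apply: le_trans h _.
rewrite [leRHS]expe2 muleACA -EFinM -expr2 sqr_sqrtr// -expe2.
apply: lee_wpmul2l; first by rewrite lee_fin.
apply: le_trans (sqre2_ge _ _); rewrite ?mule_ge0//.
have eM (x y : \bar R) : ((x * y) ^+ 2 = x ^+ 2 * y ^+ 2)%E by rewrite !expe2 muleACA.
by rewrite !eM !poweR_half_sqr.
Qed.

End FirstEstimate.

(** * The commutator with a fractional power of the Laplacian *)

Section SecondEstimate.
Variable R : realType.
Local Notation nc := (@ComplexField.Normc.normc R).
Local Notation W := (wave_norm R).
Local Notation J := (japanese R).
Implicit Types (n m k l : freq) (c : freq -> R[i]) (f g : point R -> R).

Lemma bernoulli_sub (y : R) (N : nat) : 0 <= y <= 1 -> 1 - N%:R * y <= (1 - y) ^+ N.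
Proof.
move=> /andP[y0 y1]; elim: N => [|N IH]; first by rewrite mul0r subr0.
rewrite exprS; apply: le_trans (ler_wpM2l _ IH); last by rewrite subr_ge0.
rewrite -natr1 -subr_ge0.
have -> : (1 - y) * (1 - N%:R * y) - (1 - (N%:R + 1) * y) = N%:R * y ^+ 2 by ring.
by rewrite mulr_ge0 ?sqr_ge0.
Qed.

(** A mean value inequality from Bernoulli's: with x = b / a <= 1, x^s >= x^N >= 1 - N (1 - x),
    where the integer [N] bounds s from above. *)
Lemma powR_sub_le (s a b : R) (N : nat) : 1 <= s -> s <= N%:R -> 0 < b -> b <= a ->
  a `^ s - b `^ s <= N%:R * (a - b) * a `^ (s - 1).
Proof.
move=> s1 sN b0 ba; have a0 : 0 < a by exact: lt_le_trans ba.
pose x := b / a; have x0 : 0 < x by rewrite divr_gt0.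
have x1 : x <= 1 by rewrite ler_pdivrMr// mul1r.
have bE : b = a * x by rewrite mulrC divfK// gt_eqF.
have xs : 1 - N%:R * (1 - x) <= x `^ s.
  have h : 1 - N%:R * (1 - x) <= x ^+ N.
    have := @bernoulli_sub (1 - x) N; rewrite subKr; apply.
    by apply/andP; split; lra.
  apply: le_trans h _; rewrite -powR_mulrn ?(ltW x0)//.
  have -> : N%:R = s + (N%:R - s) by ring.
  rewrite powRD; last by apply/implyP => _; rewrite gt_eqF.
  rewrite ler_piMr ?powR_ge0//.
  have := @ge0_ler_powR R (N%:R - s) _ x 1; rewrite powR1; apply; rewrite ?nnegrE//; try lra.
have aE : a `^ s = a `^ (s - 1) * a.
  have -> : a `^ s = a `^ (s - 1 + 1) by rewrite subrK.
  rewrite powRD ?powRr1 ?(ltW a0)//.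
  by apply/implyP => _; rewrite gt_eqF.
rewrite [in leLHS]bE powRM ?(ltW a0) ?(ltW x0)//.
have := ler_wpM2l (powR_ge0 a s) xs => h.
have -> : N%:R * (a - b) * a `^ (s - 1) = a `^ s * (N%:R * (1 - x)).
  by rewrite aE bE; ring.
by lra.
Qed.

(* For w = |k|, v = |l| and j = 1 + |k - l|. *)
Lemma symbol_bound (w v j s : R) (N : nat) : 1 <= w -> 1 <= v -> 1 <= j -> `|w - v| <= j ->
  w <= v * j -> v <= w * j -> 1 <= s -> s <= N%:R ->
  w `^ (- (1 / 2)) * `|w `^ s - v `^ s| * v <= N%:R * j `^ (s + 1 / 2) * v `^ (s - 1 / 2).
Proof.
move=> w1 v1 j1 wvj wv vw s1 sN.
have w0 : 0 < w by lra. have v0 : 0 < v by lra. have j0 : 0 < j by lra.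
have vj0 : 0 <= v * j by rewrite mulr_ge0// ltW.
have D (a : R) (x y : R) : 0 < a -> a `^ (x + y) = a `^ x * a `^ y.
  by move=> a0; rewrite powRD//; apply/implyP => _; rewrite gt_eqF.
(* In either ordering the larger of w and v is at most v j, which moves the power s - 1 onto v. *)
have P1 : `|w `^ s - v `^ s| <= N%:R * j * (v * j) `^ (s - 1).
  have main (a b : R) : 0 < b -> b <= a -> a - b <= j -> a <= v * j ->
      a `^ s - b `^ s <= N%:R * j * (v * j) `^ (s - 1).
    move=> b0 ba abj avj; apply: le_trans (powR_sub_le s1 sN b0 ba) _.
    have a0 : 0 <= a by lra.
    apply: ler_pM; rewrite ?powR_ge0//.
    - by rewrite mulr_ge0// subr_ge0.
    - by rewrite ler_wpM2l.
    - by apply: ge0_ler_powR; rewrite ?nnegrE//; lra.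
  move: wvj; have [h|h] := leP v w.
    rewrite !ger0_norm ?subr_ge0//; first by move=> wvj; exact: main.
    by apply: ge0_ler_powR; rewrite ?nnegrE//; lra.
  rewrite !ler0_norm ?subr_le0 ?(ltW h)//; last first.
    by apply: ge0_ler_powR; rewrite ?nnegrE//; lra.
  by rewrite !opprB => wvj; apply: main => //; [exact: ltW|rewrite ler_peMr//; exact: ltW].
(* By v <= w j, the negative power moves from w to v at the price of j^(1/2). *)
have P2 : w `^ (- (1 / 2)) <= v `^ (- (1 / 2)) * j `^ (1 / 2).
  rewrite !powRN -[leLHS]mul1r ler_pdivrMr ?powR_gt0// -mulrA mulrC ler_pdivlMr ?powR_gt0// !mul1r.
  rewrite mulrC -powRM ?(ltW v0) ?(ltW w0) ?(ltW j0)//.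
  by apply: ge0_ler_powR; rewrite ?nnegrE ?mulr_ge0//; lra.
apply: le_trans (_ : v `^ (- (1 / 2)) * j `^ (1 / 2) * (N%:R * j * (v * j) `^ (s - 1)) * v <= _).
  by rewrite ler_wpM2r ?(ltW v0)// ler_pM ?powR_ge0.
rewrite le_eqVlt; apply/orP; left; apply/eqP; rewrite powRM ?ltW//.
have -> : s + 1 / 2 = (s - 1) + 1 + 1 / 2 by field.
have -> : s - 1 / 2 = (s - 1) + 1 + (- (1 / 2)) by field.
by rewrite !D// !powRr1 ?ltW//; ring.
Qed.

Lemma wave_norm_ge1 k : W k != 0 -> 1 <= W k.
Proof.
move=> wk; have [i ki] : exists i, kc R i k != 0.
  apply: contrapT => h; move/eqP: wk; apply.
  have z i : kc R i k = 0 by apply/eqP/negPn/negP => ki; apply: h; exists i.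
  by apply: (@pexpIrn _ 2); rewrite ?nnegrE ?wave_norm_ge0// wave_norm_sqr sum3 !z !expr0n !addr0.
rewrite -(@ler_pXn2r _ 2)// ?nnegrE ?wave_norm_ge0// expr1n wave_norm_sqr (bigD1 i)//=.
by apply: le_trans (kc_sqr_ge1 ki) _; rewrite lerDl sumr_ge0// => j _; exact: sqr_ge0.
Qed.

(** At k = 0 the left side vanishes because 0 to a nonzero power is 0, at l = 0 because of the
    factor |l|. Otherwise both norms are at least 1, which turns the triangle inequality into |k| <=
    |l| (1 + |k - l|) and the same with k and l exchanged. *)
Lemma lambda_symbol (s : R) (N : nat) k l : 1 <= s -> s <= N%:R ->
  W k `^ (- (1 / 2)) * `|W k `^ s - W l `^ s| * W l <=
  N%:R * J (k - l) `^ (s + 1 / 2) * J l `^ (s - 1 / 2).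
Proof.
move=> s1 sN; have w0 := @wave_norm_ge0 R; have j0 := @J_ge0 R.
have r0 : 0 <= N%:R * J (k - l) `^ (s + 1 / 2) * J l `^ (s - 1 / 2) by rewrite !mulr_ge0 ?powR_ge0.
have [->|wk] := eqVneq (W k) 0.
  by rewrite powR0 ?mul0r// oppr_eq0 mulf_neq0// ?oner_eq0// invr_eq0 pnatr_eq0.
have [->|wl] := eqVneq (W l) 0; first by rewrite mulr0.
have k1 := wave_norm_ge1 wk; have l1 := wave_norm_ge1 wl.
have t1 : W k <= W (k - l) + W l by have := wave_normD R (k - l) l; rewrite subrK.
have t2 : W l <= W (k - l) + W k.
  by have := wave_normD R (l - k) k; rewrite subrK -(wave_normN R (l - k)) opprB.
have d0 := w0 (k - l).
have p1 := ler_wpM2r d0 k1; have p2 := ler_wpM2r d0 l1.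
have h : W l `^ (s - 1 / 2) <= J l `^ (s - 1 / 2).
  by apply: ge0_ler_powR; rewrite ?nnegrE ?wave_norm_le_J//; lra.
apply: le_trans (ler_wpM2l _ h); last by rewrite mulr_ge0 ?powR_ge0.
apply: symbol_bound => //.
- exact: J_ge1.
- by rewrite ler_norml /japanese; lra.
- by rewrite /japanese mulrDr mulr1; lra.
- by rewrite /japanese mulrDr mulr1; lra.
Qed.

Lemma Lambda_fourier (p : nat) (r : R) (u : field p R) (j : 'I_p) (q : nat) (M : R) :
  (forall n, W n `^ r <= M * J n ^+ q) -> smooth_field u ->
  [/\ rapid (fun n => (W n `^ r)%:C%C * fourier (u j) n),
      conj_sym (fun n => (W n `^ r)%:C%C * fourier (u j) n),
      torus_smooth (Lambda r u j) &
      forall n, fourier (Lambda r u j) n = (W n `^ r)%:C%C * fourier (u j) n].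
Proof.
move=> hr su.
have rc : rapid (fun n => (W n `^ r)%:C%C * fourier (u j) n).
  apply: (@rapidM _ _ _ q M) (rapid_fourier (su j)) => n.
  by rewrite nc_real ger0_norm ?powR_ge0.
have cs : conj_sym (fun n => (W n `^ r)%:C%C * fourier (u j) n).
  apply: conj_symM; first by move=> n; rewrite wave_normN.
  exact/conj_sym_fourier/smooth_continuous/su.
split => //; first exact: synth_smooth.
by move=> n; exact: fourier_synth.
Qed.

Lemma Lambda_half_bound n : W n `^ (- (1 / 2)) <= 1 * J n ^+ 0.
Proof.
rewrite expr0 mulr1; have [->|wn] := eqVneq (W n) 0.
  by rewrite powR0 ?ler01// oppr_eq0 mulf_neq0// ?oner_eq0// invr_eq0 pnatr_eq0.
rewrite powRN invf_le1 ?powR_gt0//.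
  have := @ler_powR R (W n) (wave_norm_ge1 wn) 0 (1 / 2); rewrite powRr0; apply; lra.
exact: lt_le_trans (wave_norm_ge1 wn).
Qed.

Lemma Lambda_pos_bound (s : R) (N : nat) n : 0 <= s -> s <= N%:R -> W n `^ s <= 1 * J n ^+ N.
Proof.
move=> s0 sN; rewrite mul1r -powR_mulrn ?J_ge0//.
apply: le_trans (_ : J n `^ s <= _).
  by apply: ge0_ler_powR; rewrite ?nnegrE ?wave_norm_ge0 ?J_ge0 ?wave_norm_le_J.
by apply: ler_powR => //; exact: J_ge1.
Qed.

(** Half of Parseval: the mean of f^2 is the zeroth coefficient of f f, and Hermitian symmetry turns
    the moduli in its convolution sum into |f^_n|^2. *)
Lemma mean_sqr_le f : torus_smooth f ->
  ((mean (fun x => f x ^+ 2))%:E <= L2 (fun n => nc (fourier f n)))%E.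
Proof.
move=> sf; have cf := smooth_continuous sf.
have e : (fun x => f x ^+ 2) = (fun x => f x * f x) by apply/funext => x; rewrite expr2.
rewrite e mean_fourier0; last exact: continuousM3.
have := boxlim_bound (fourier_mul 0 sf sf).
under eq_esum do rewrite ncM sub0r fourier_herm// nc_conj -expr2.
by apply: le_trans; rewrite lee_fin; exact: le_trans (ler_norm _) (nc_Re _).
Qed.

Lemma L2norm_sqr_le (u : field 2 R) : smooth_field u ->
  (\int[leb3 R]_(x in @unit_cube R) (\sum_(i < 2) u i x ^+ 2)%:E <=
    L2 (fun n => nc (fourier (u ord0) n)) + L2 (fun n => nc (fourier (u ord_max) n)))%E.
Proof.
move=> su.
have ss i : torus_smooth (fun x => u i x ^+ 2).
  by rewrite (_ : (fun x => _) = fun x => u i x * u i x)//; apply: smoothM; exact: su.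
have cs i := smooth_continuous (ss i).
have [cS mS] := mean_sum (index_enum 'I_2) cs.
have iS := cube_integrable cS.
rewrite -[X in (X <= _)%E]fineK; last first.
  exact: (integrable_fin_num (@measurable_unit_cube R) iS).
rewrite -[X in (X%:E <= _)%E]/(mean (fun x => \sum_(i < 2) u i x ^+ 2)) mS sum2 EFinD.
by apply: leeD; exact: mean_sqr_le.
Qed.

(** The commutator acts through (|k|^s - |l|^s) (l.b^_(k-l)); the factor |l| taken from the dot
    product is the one that [lambda_symbol] absorbs. *)
Lemma lambda_commutator_bound (s : R) (N : nat) (b : field 3 R)
  (u : field 2 R) (j : 'I_2) k :
  1 <= s -> s <= N%:R -> smooth_field b -> smooth_field u ->
  ((W k `^ (- (1 / 2)) * nc (fourier (commutator (Lambda s) (advect b) u j) k))%:E <=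
   \esum_(l in [set: freq]) (N%:R * (J (k - l) `^ (s + 1 / 2) * nsum b (k - l) *
      (J l `^ (s - 1 / 2) * nc (fourier (u j) l))))%:E)%E.
Proof.
move=> s1 sN sb su; have s0 : 0 <= s by lra.
have gr n := @Lambda_pos_bound s N n s0 sN.
have sa := smooth_advect sb su.
have [_ _ sLa fLa] := Lambda_fourier j gr sa.
have sL i : torus_smooth (Lambda s u i) by have [] := Lambda_fourier i gr su.
have fL i n : fourier (Lambda s u i) n = (W n `^ s)%:C%C * fourier (u i) n.
  by have [] := Lambda_fourier i gr su.
have saL := smooth_advect sb sL.
have -> : fourier (commutator (Lambda s) (advect b) u j) k =
    (W k `^ s)%:C%C * fourier (advect b u j) k + (-1) * fourier (advect b (Lambda s u) j) k.
  rewrite /commutator.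
  have -> : (fun x => Lambda s (advect b u) j x - advect b (Lambda s u) j x) =
    (fun x => Lambda s (advect b u) j x + (-1) * advect b (Lambda s u) j x).
    by apply/funext => x; rewrite mulN1r.
  have ca := smooth_continuous (saL j).
  rewrite fourierD; [|exact: smooth_continuous|exact: (continuousM3 (@continuous_cst3 R (-1)))].
  by rewrite fLa fourierZ// rmorphN rmorph1.
have lim := boxlimD (boxlimZ (W k `^ s)%:C%C (fourier_advect j k sb su))
  (boxlimZ (-1) (fourier_advect j k sb sL)).
have wk0 : 0 <= W k `^ (- (1 / 2)) by exact: powR_ge0.
rewrite EFinM; apply: (@le_trans _ _ ((W k `^ (- (1 / 2)))%:E * \esum_(l in [set: freq])
  (nc ((W k `^ s)%:C%C * (\sum_(i < 3) 'i%C * (kc R i l)%:C%C * fourier (u j) l * fourier (b i) (k - l)) +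
   -1 * \sum_(i < 3) 'i%C * (kc R i l)%:C%C * fourier (Lambda s u j) l * fourier (b i) (k - l)))%:E)%E).
  by rewrite lee_wpmul2l ?lee_fin//; exact: (boxlim_bound lim).
rewrite -esumZ//; last by move=> l; rewrite lee_fin nc_ge0.
apply: le_esum => l _; rewrite -EFinM lee_fin.
have -> : (W k `^ s)%:C%C * (\sum_(i < 3) 'i%C * (kc R i l)%:C%C * fourier (u j) l * fourier (b i) (k - l)) +
   -1 * (\sum_(i < 3) 'i%C * (kc R i l)%:C%C * fourier (Lambda s u j) l * fourier (b i) (k - l)) =
  (W k `^ s - W l `^ s)%:C%C * fourier (u j) l * ('i%C * \sum_(i < 3) (kc R i l)%:C%C * fourier (b i) (k - l)).
  rewrite fL rmorphB !mulr_sumr -big_split/=; apply: eq_bigr => i _; ring.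
rewrite !ncM nc_real nc_i [1 * nc _]mul1r.
have hb : nc (\sum_(i < 3) (kc R i l)%:C%C * fourier (b i) (k - l)) <= W l * nsum b (k - l).
  apply: le_trans (nc_sum _ _ _) _; rewrite mulr_sumr; apply: ler_sum => i _.
  by rewrite ncM nc_real ler_wpM2r ?nc_ge0// kc_le_wave_norm.
have gl0 : 0 <= nc (fourier (u j) l) by exact: nc_ge0.
have n0 : 0 <= nsum b (k - l) by exact: nsum_ge0.
set g := nc (fourier (u j) l) in gl0 *.
apply: le_trans (_ : W k `^ (- (1 / 2)) * (`|W k `^ s - W l `^ s| * g * (W l * nsum b (k - l))) <= _).
  by rewrite ler_wpM2l// ler_wpM2l// mulr_ge0.
have := ler_wpM2r (mulr_ge0 gl0 n0) (lambda_symbol k l s1 sN) => h.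
rewrite (_ : W k `^ (- (1 / 2)) * _ =
    W k `^ (- (1 / 2)) * `|W k `^ s - W l `^ s| * W l * (g * nsum b (k - l))); last by ring.
by apply: le_trans h _; rewrite le_eqVlt; apply/orP; left; apply/eqP; ring.
Qed.

Theorem lambda_commutator_sq (s : R) : 1 <= s -> exists2 C : R, 0 <= C &
  forall (b : field 3 R) (u : field 2 R), smooth_field b -> smooth_field u ->
  (\int[leb3 R]_(x in @unit_cube R)
    (\sum_(i < 2) Lambda (- (1 / 2)) (commutator (Lambda s) (advect b) u) i x ^+ 2)%:E <=
   C%:E * (Ssq (s + 3) b * Ssq (s - 1 / 2) u))%E.
Proof.
move=> s1; have s0 : 0 <= s by lra.
(* The l^1 norm of b with weight s + 1/2 costs two more powers, which s + 3 covers with 1/2 to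
   spare. *)
have f1 : s + 1 / 2 + 2 <= s + 3 by lra.
have f2 : 0 <= s + 3 by lra.
have f3 : 0 <= s - 1 / 2 by lra.
pose N := Num.bound s; have sN : s <= N%:R by exact/ltW/archi_boundP.
pose K1 := wsum (4 / 3 : R) * (3%:R * 2 `^ (2 * (s + 3))) : R.
pose K2 := 2%:R * 2 `^ (2 * (s - 1 / 2)) : R.
have K10 : 0 <= K1 by rewrite mulr_ge0 ?wsum_ge0// mulr_ge0 ?powR_ge0.
have K20 : 0 <= K2 by rewrite mulr_ge0 ?powR_ge0.
pose D := 3 * N%:R ^+ 2 * (K1 * K2) : R.
have D0 : 0 <= D by exact: (mulr_ge0 (mulr_ge0 (ler0n R 3) (sqr_ge0 N%:R)) (mulr_ge0 K10 K20)).
exists (2 * D); first by rewrite mulr_ge0.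
move=> b u sb su.
have gr n := @Lambda_pos_bound s N n s0 sN.
have sH : smooth_field (commutator (Lambda s) (advect b) u).
  move=> j; rewrite /commutator.
  have [_ _ sLa _] := Lambda_fourier j gr (smooth_advect sb su).
  have sL : smooth_field (Lambda s u) by move=> i; have [] := Lambda_fourier i gr su.
  exact: (smoothD sLa (smoothN (smooth_advect sb sL j))).
have sLH : smooth_field (Lambda (- (1 / 2)) (commutator (Lambda s) (advect b) u)).
  by move=> j; have [] := Lambda_fourier j Lambda_half_bound sH.
have fLH j n : nc (fourier (Lambda (- (1 / 2)) (commutator (Lambda s) (advect b) u) j) n) =
    W n `^ (- (1 / 2)) * nc (fourier (commutator (Lambda s) (advect b) u j) n).
  have [_ _ _ ->] := Lambda_fourier j Lambda_half_bound sH.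
  by rewrite ncM nc_real ger0_norm ?powR_ge0.
apply: le_trans (L2norm_sqr_le sLH) _.
set X := Ssq (s + 3) b; set Y := Ssq (s - 1 / 2) u.
have X0 : (0 <= X)%E by exact: Ssq_ge0.
have Y0 : (0 <= Y)%E by exact: Ssq_ge0.
have n0 := @nsum_ge0 R.
have z0 : forall k : freq, 0 <= (fun=> 0 : R) k by [].
have L10 : L1 (fun=> 0 : R) = 0%E by apply: esum1.
have L20 : L2 (fun=> 0 : R) = 0%E by apply: esum1 => i _; rewrite expr0n.
have main j : (L2 (fun n => nc (fourier (Lambda (- (1 / 2)) (commutator (Lambda s) (advect b) u) j) n))
    <= D%:E * (X * Y))%E.
  (* Only the middle product is present, with b in l^1 and u in l^2; the other two are filled with
     0. *)
  have := @conv3_estimate R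
    (fun n => nc (fourier (Lambda (- (1 / 2)) (commutator (Lambda s) (advect b) u) j) n))
    (fun=> 0) (fun=> 0) (fun k => J k `^ (s + 1 / 2) * nsum b k)
    (fun k => J k `^ (s - 1 / 2) * nc (fourier (u j) k)) (fun=> 0) (fun=> 0) N%:R.
  move=> /(_ (ler0n _ _) _ z0 z0 _ _ z0 z0 _) H; apply: le_trans (H _ _ _ _) _; rewrite {H}.
  - by move=> k; exact: nc_ge0.
  - by move=> k; rewrite mulr_ge0 ?powR_ge0.
  - by move=> k; rewrite mulr_ge0 ?powR_ge0 ?nc_ge0.
  - move=> k; rewrite fLH; apply: le_trans (lambda_commutator_bound j k s1 sN sb su) _.
    by apply: le_esum => l _; rewrite mul0r add0r addr0.
  rewrite L10 L20 mul0e mule0 add0e adde0.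
  have e1 : (L1 (fun k => J k `^ (s + 1 / 2) * nsum b k)%R ^+ 2 <= K1%:E * X)%E.
    exact: L1_weighted.
  have e2 : (L2 (fun k => J k `^ (s - 1 / 2) * nc (fourier (u j) k))%R <= K2%:E * Y)%E.
    apply: le_trans (_ : L2 (fun k => J k `^ (s - 1 / 2) * nsum u k)%R <= _)%E; last first.
      exact: L2_weighted.
    apply: le_esum => k _; rewrite lee_fin lerXn2r ?nnegrE ?mulr_ge0 ?powR_ge0 ?nc_ge0//.
    rewrite ler_wpM2l ?powR_ge0// /nsum (bigD1 j)// lerDl.
    apply: sumr_ge0 => i _; exact: nc_ge0.
  have -> : (D%:E * (X * Y) = (3 * N%:R ^+ 2)%:E * ((K1 * K2)%:E * (X * Y)))%E.
    by rewrite [RHS]muleA -EFinM.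
  apply: lee_wpmul2l; first by rewrite lee_fin mulr_ge0 ?sqr_ge0.
  by rewrite -mule_constACA; apply: lee_pmul => //; [exact: sqre_ge0|exact: L2_ge0].
apply: le_trans (leeD (main _) (main _)) _.
by rewrite -ge0_muleDl ?lee_fin// -EFinD -mulr2n -[(_ *+ 2)%R]mulr_natl.
Qed.

(** From 1 + t^(2r) <= 2 (1 + t^(2r')) for t >= 0. The factor is attained at k = 0 when r = 0 < r',
    because 0^0 = 1. *)
Lemma Hnorm_mono (p : nat) (r r' : R) (u : field p R) : 0 <= r -> r <= r' ->
  (Hnorm r u <= (Num.sqrt 2)%:E * Hnorm r' u)%E.
Proof.
move=> r0 rr; rewrite !HnormE; apply: poweR_half_le.
- exact: Ssq_ge0.
- by rewrite mule_ge0 ?lee_fin ?sqrtr_ge0 ?poweR_ge0.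
rewrite [leRHS]expe2 muleACA -EFinM -expr2 sqr_sqrtr// -expe2 poweR_half_sqr ?Ssq_ge0//.
rewrite /Ssq -esumZ//; last exact: Ssq_term_ge0.
apply: le_esum => k _; rewrite -EFinM lee_fin mulrA ler_wpM2r ?sqsum_ge0//.
have w0 := wave_norm_ge0 R k; have p0 := powR_ge0 (W k) (2 * r').
have [w1|w1] := leP (W k) 1.
  have := @ge0_ler_powR R (2 * r) (ltac:(lra)) (W k) 1; rewrite powR1 !nnegrE => /(_ w0 ler01 w1).
  by lra.
have := @ler_powR R (W k) (ltW w1) (2 * r) (2 * r'); move=> /(_ (ltac:(lra))) h; lra.
Qed.

End SecondEstimate.

(** * Combination of the two commutator estimates *)

Theorem lemmaB4 (R : realType) (s : R) (hs : 2 < s) :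
  (exists C : R, forall (b : field 3 R) (phi : field 2 R),
     smooth_field b -> divergence_free b ->
     smooth_field phi -> hydro_leray phi = phi ->
     (Hnorm s (commutator (@hydro_leray R) (advect b) phi)
      <= C%:E * (Hnorm (s + 1) b * Hnorm s phi
                 + Hnorm (s - 1) (dz_hor b) * Hnorm (s + 1) phi))%E)
  /\
  (5 / 2 < s ->
   exists C : R, forall (b : field 3 R) (phi : field 2 R),
     smooth_field b -> divergence_free b ->
     smooth_field phi -> hydro_leray phi = phi ->
     (L2norm (Lambda (- (1 / 2))
        (commutator (Lambda s) (advect b)
          (commutator (@hydro_leray R) (advect b) phi)))
      <= C%:E * (Hnorm (s + 3) b ^+ 2 * Hnorm (s - 1 / 2) phi
                 + Hnorm (s + 3) b * Hnorm (s - 3 / 2) (dz_hor b)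
                   * Hnorm (s + 1 / 2) phi))%E).
Proof.
(* The sign of the constant is recorded because the second estimate multiplies an inequality by
   it. *)
have part1 (r : R) : 2 < r -> exists2 C : R, 0 <= C & forall (b : field 3 R) (phi : field 2 R),
    smooth_field b -> divergence_free b -> smooth_field phi -> hydro_leray phi = phi ->
    (Hnorm r (commutator (@hydro_leray R) (advect b) phi)
      <= C%:E * (Hnorm (r + 1) b * Hnorm r phi + Hnorm (r - 1) (dz_hor b) * Hnorm (r + 1) phi))%E.
  move=> r2; have [C C0 HC] := leray_commutator_sq r2.
  exists (Num.sqrt C); first exact: sqrtr_ge0.
  move=> b phi sb db sp lp; rewrite !HnormE.
  by apply: sqrt_passage => //; [exact: Ssq_ge0..|exact: HC].
split; first by have [C _ HC] := part1 s hs; exists C.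
move=> hs2; have s1 : 1 <= s by lra.
have [Q Q0 HQ] := lambda_commutator_sq s1.
(* s > 5/2 is exactly what the first estimate asks for at level s - 1/2, where
   [lambda_commutator_sq] measures the inner commutator. *)
have r2 : 2 < s - 1 / 2 by lra.
have [C C0 HC] := part1 _ r2.
exists (Num.sqrt Q * (C * Num.sqrt 2)) => b phi sb db sp lp.
set G := commutator (@hydro_leray R) (advect b) phi.
have sG : smooth_field G by move=> i; have [] := commutator_leray i sb sp lp.
have H0 n (u : field n R) r : (0 <= Hnorm r u)%E by rewrite HnormE poweR_ge0.
have q0 := sqrtr_ge0 Q.
have h1 : (L2norm (Lambda (- (1 / 2)) (commutator (Lambda s) (advect b) G)) <=
    (Num.sqrt Q)%:E * (Hnorm (s + 3) b * Hnorm (s - 1 / 2) G))%E.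
  apply: poweR_half_le.
  - by apply: integral_ge0 => x _; rewrite lee_fin sumr_ge0// => i _; exact: sqr_ge0.
  - by rewrite mule_ge0 ?lee_fin// mule_ge0.
  apply: le_trans (HQ b G sb sG) _.
  rewrite [leRHS]expe2 muleACA -EFinM -expr2 sqr_sqrtr// muleACA !HnormE -!expe2.
  by rewrite !poweR_half_sqr ?Ssq_ge0.
apply: le_trans h1 _; rewrite EFinM -muleA; apply: lee_wpmul2l; first by rewrite lee_fin.
have := HC b phi sb db sp lp; rewrite -/G.
have -> : s - 1 / 2 + 1 = s + 1 / 2 by field.
have -> : s - 1 / 2 - 1 = s - 3 / 2 by field.
set A := Hnorm (s + 3) b; set X := Hnorm (s - 1 / 2) phi; set Y := Hnorm (s - 3 / 2) (dz_hor b).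
set Z := Hnorm (s + 1 / 2) phi => hG.
have A0 : (0 <= A)%E by exact: H0.
have X0 : (0 <= X)%E by exact: H0.
have YZ0 : (0 <= Y * Z)%E by apply: mule_ge0; exact: H0.
have r20 : 0 <= Num.sqrt 2 :> R := sqrtr_ge0 2.
(* The first estimate yields the norm of b at level s + 1/2; raising it to s + 3 produces the square
   of one norm. *)
have hA : (Hnorm (s + 1 / 2) b <= (Num.sqrt 2)%:E * A)%E by apply: Hnorm_mono; lra.
(* The second product takes the harmless factor sqrt 2 >= 1, so that both products share one
   constant. *)
have hYZ : (Y * Z <= (Num.sqrt 2)%:E * (Y * Z))%E.
  rewrite -[leLHS]mul1e lee_wpmul2r// lee_fin -[leLHS]sqrtr1.
  by apply: ler_wsqrtr; rewrite ler1n.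
clearbody A X Y Z; apply: le_trans (lee_wpmul2l A0 hG) _.
rewrite EFinM muleCA -muleA; apply: lee_wpmul2l; first by rewrite lee_fin.
have -> : (A ^+ 2 * X + A * Y * Z = A * (A * X + Y * Z))%E.
  by rewrite ge0_muleDr ?expe2 ?muleA// mule_ge0.
rewrite muleCA; apply: lee_wpmul2l => //.
rewrite ge0_muleDr ?lee_fin//; last exact: mule_ge0.
by apply: leeD => //; rewrite muleA lee_wpmul2r.
Qed.
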